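(* Let $0<p<1/2$ and let $\mu\ge 0$ be a finite positive measure on $\partial\mathbb{D}$ that is singular with respect to Lebesgue measure. Let $S_\mu$ be the associated singular inner function. Consider the following conditions: (1) $S_\mu'\in H^p$. (2) $S_\mu$ satisfies the $(1+p)$-area condition: for every $0<c<1$, $$\int_{\{z\in\mathbb{D}:\ |S_\mu(z)|<c\}}\frac{dA(z)}{(1-|z|)^{1+p}}<\infty .$$ (3) The measure $\mu$ is concentrated on a countable union of $(1-p)$-Beurling-Carleson sets. Then $(1)\Rightarrow(2)\Rightarrow(3)$.
   Context: $\mathbb{D}$ is the open unit disk, $\partial\mathbb{D}$ the unit circle, $dA$ is area measure, $|J|$ is the length of an arc $J$, and $H^p$ is the Hardy space on $\mathbb{D}$. For a finite positive singular measure $\mu$ on $\partial\mathbb{D}$, the singular inner function is $$S_\mu(z)=\exp\Bigl(-\int_{\partial\mathbb{D}}\frac{\zeta+z}{\zeta-z}\,d\mu(\zeta)\Bigr),\qquad |z|<1.$$ For $0<\alpha<1$, an $\alpha$-Beurling-Carleson set is a closed subset $E\subset\partial\mathbb{D}$ of zero length whose complementary arcs $\{J\}$ (the connected components of $\partial\mathbb{D}\setminus E$) satisfy $\sum_J|J|^\alpha<\infty$. A measure $\mu$ is concentrated on a Borel set $A$ if $\mu(\partial\mathbb{D}\setminus A)=0$. *)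

(* Defs.v *)
From mathcomp Require Import all_boot all_order all_algebra.
From mathcomp Require Import complex.
From mathcomp Require Import all_classical all_reals all_analysis.
Set Implicit Arguments.
Unset Strict Implicit.
Unset Printing Implicit Defensive.
Import Order.TTheory GRing.Theory Num.Theory.
Import numFieldNormedType.Exports.
Local Open Scope classical_set_scope.
Local Open Scope ring_scope.
Local Open Scope complex_scope.

(* Naming the [numClosedFieldType] structure, rather than using [R[i]], lets
   [numFieldNormedType] equip the complex numbers with their topology and make
   them a normed module over themselves: [derivable f z 1] and [derive1 f z] then
   are complex differentiability and the complex derivative. *)
Definition C (R : realType) : numClosedFieldType := R[i].

Notation borelC R := (g_sigma_algebraType (@open (C R))).

Section Defs.
Context {R : realType}.

(* [`|z|] is an element of [C R]; this is the same modulus as a real number. *)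
Definition cabs (z : C R) : R := complex.Re `|z|.

Definition cexp (z : C R) : C R :=
  (expR (complex.Re z) * cos (complex.Im z)) +i*
  (expR (complex.Re z) * sin (complex.Im z)).

Definition cis (t : R) : C R := cos t +i* sin t.

Definition disk : set (C R) := [set z | cabs z < 1].

Definition circle : set (C R) := [set z | cabs z = 1].

Definition circle_length (A : set (C R)) : \bar R :=
  lebesgue_measure (`[0, 2 * pi[ `&` cis @^-1` A).

Definition area_integral (D : set (C R)) (f : C R -> \bar R) : \bar R :=
  (\int[lebesgue_measure \x lebesgue_measure]_(w in
      [set w : R * R | D (w.1 +i* w.2)]) f (w.1 +i* w.2)%C)%E.

Definition holomorphic_on (D : set (C R)) (f : C R -> C R) : Prop :=
  forall z, D z -> derivable f z 1.

Definition hardy (p : R) (f : C R -> C R) : Prop :=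
  holomorphic_on disk f /\
  (ereal_sup [set \int[lebesgue_measure]_(t in `[0%R, (2 * pi)%R])
       (cabs (f (r%:C * cis t)%R) `^ p)%:E | r in `[0%R, 1%R[] < +oo)%E.

Section Measure.
Variable mu : {finite_measure set (borelC R) -> \bar R}.

(* Together with this condition, a Borel measure on the plane amounts to a
   Borel measure on the unit circle. *)
Definition carried_by_circle : Prop := mu (~` circle) = 0%E.

Definition singular_wrt_length : Prop :=
  exists N : set (borelC R),
    [/\ measurable N, circle_length N = 0%E & mu (circle `\` N) = 0%E].

Definition concentrated_on (A : set (borelC R)) : Prop :=
  measurable A /\ mu (circle `\` A) = 0%E.

Definition complex_integral (D : set (C R)) (f : C R -> C R) : C R :=
  (\int[mu]_(zeta in D) complex.Re (f zeta)) +i*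
  (\int[mu]_(zeta in D) complex.Im (f zeta)).

(* Meaningful for [z] in the open disk only. *)
Definition singular_inner (z : C R) : C R :=
  cexp (- complex_integral circle (fun zeta => (zeta + z) / (zeta - z))).

End Measure.

Definition area_condition (q : R) (S : C R -> C R) : Prop :=
  forall c : R, 0 < c < 1 ->
    (area_integral [set z | disk z /\ (cabs (S z) < c)%R]
       (fun z => (((1 - cabs z) `^ q)^-1)%R%:E) < +oo)%E.

Definition complementary_arcs (E : set (C R)) : set (set (C R)) :=
  connected_component (circle `\` E) @` (circle `\` E).

Definition beurling_carleson (alpha : R) (E : set (C R)) : Prop :=
  [/\ E `<=` circle, closed E, circle_length E = 0%E &
      (\esum_(J in complementary_arcs E) (circle_length J `^ alpha)%E < +oo)%E].

End Defs.

(* Main.v *)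
Require Import Defs.
From mathcomp Require Import all_boot all_order all_algebra.
From mathcomp Require Import complex.
From mathcomp Require Import all_classical all_reals all_analysis measurable_realfun.
From mathcomp Require Import ring lra zify.
Set Implicit Arguments.
Unset Strict Implicit.
Unset Printing Implicit Defensive.
Import Order.TTheory GRing.Theory Num.Theory.
Import numFieldNormedType.Exports.
Local Open Scope classical_set_scope.
Local Open Scope ring_scope.
Local Open Scope complex_scope.

(** Let [u] be the Poisson integral of [mu]. Then [|S_mu| = exp (- u)]
    ([cabs_singular_inner]), so that both implications are statements about the
    size of [u] on dyadic boxes of the disk.

    From the Hardy class to the area condition. Write [r_j = 1 - 2 ^ - j]. Up to a
    constant, [|S'| ^ p] satisfies the sub-mean value inequality ([submean]). Integrated
    over boxes of generation [j], it shows that the mean over the angle [t] of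
    [|S (r_(j+1) e^it) - S (r_j e^it)| ^ p] is [O(2 ^ - (j p))] ([increment_mean]). As
    [mu] is singular, [1 - |S|] tends to zero in the mean along the circles of radius
    [r_j] ([defect_pow_mean_small]); since [x ^ p] is subadditive, the increments can be
    summed, and the mean of [(1 - |S (r_j e^it)|) ^ p] is [O(2 ^ - (j p))] as well
    ([defect_pow_decay]). By Harnack's inequality [2 ^ k u (r_k e^it)] increases with
    [k] up to a constant factor. Hence [u (r_k e^it) >= c] forces
    [1 - |S (r_j e^it)| >= c' 2 ^ (k - j)] for every [j >= k]. At a fixed [j] the sum
    over all such [k <= j] of [2 ^ (k p)] is a geometric sum, bounded by a constant times
    [2 ^ (j p) (1 - |S (r_j e^it)|) ^ p]; integration in [t] bounds the sum over [k] of
    [2 ^ (k p)] times the length of the set where [u (r_k e^it) >= c]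
    ([superlevel_summable]). This sum dominates the area integral, because Harnack's
    inequality extends [|S z| < c] to a whole dyadic box around [z], with another
    constant ([area_condition_of_superlevel]).

    From the area condition to concentration. A dyadic arc of generation [n] is called
    heavy if its mass is at least [72 * 2 ^ - n]. Then [u >= 1] on a square of side
    comparable with [2 ^ - n] below the arc. These squares are disjoint, so that the
    area condition bounds the sum of [2 ^ - (n (1 - p))] over all heavy arcs
    ([heavy_count]). For every [N] the maximal light arcs of generation at least [N] are
    removed from the circle. The remaining set is closed, and the removed arcs are the
    components of its complement; past generation [N] their parents are heavy, so the
    sum of their lengths to the power [1 - p] is finite. Apart from countably many
    points the remaining set is covered by the heavy arcs of any one late generation,
    whose total length is small ([beurling_carleson_unstopped]). Finally, let [V] be a
    small open set of angles that covers a null set carrying [mu]. A point of this null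
    set that lies in none of the remaining sets is contained in light arcs of
    arbitrarily late generation, and so in one that stays inside [V]. The maximal arcs
    of this kind are disjoint and light, so their total mass is at most a constant times
    the length of [V] ([concentrated_unstopped]).

    Analyticity enters through locally uniform approximation by polynomials
    ([disk_analytic]), for which Cauchy's estimates follow from averages over roots of
    unity ([cauchy_coef]). The Herglotz integral has such approximations by the geometric
    series, and its exponential by [(1 + w / n) ^ n]. *)

(** * Complex numbers with a real-valued modulus *)

Section ComplexModulus.
Context {R : realType}.
Implicit Types (z w u : C R) (x y t : R).

Lemma normCE z : `|z| = (cabs z)%:C :> C R.
Proof. by rewrite /cabs normc_def. Qed.

Lemma cabsE z : cabs z = Num.sqrt ((complex.Re z) ^+ 2 + (complex.Im z) ^+ 2).
Proof. by rewrite /cabs normc_def. Qed.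

Lemma cabs_sqr z : cabs z ^+ 2 = (complex.Re z) ^+ 2 + (complex.Im z) ^+ 2.
Proof. by rewrite cabsE sqr_sqrtr// addr_ge0// sqr_ge0. Qed.

Lemma cabs_ge0 z : 0 <= cabs z.
Proof. by rewrite cabsE sqrtr_ge0. Qed.

Lemma cabsM z w : cabs (z * w) = cabs z * cabs w.
Proof.
have := normrM z w; rewrite !normCE => h.
by have := congr1 (@complex.Re R) h; rewrite /= mulr0 subr0.
Qed.

Lemma cabs0 : cabs (0 : C R) = 0.
Proof. by rewrite /cabs normr0. Qed.

Lemma cabs1 : cabs (1 : C R) = 1.
Proof. by rewrite /cabs normr1. Qed.

Lemma cabs_eq0 z : (cabs z == 0) = (z == 0).
Proof.
apply/eqP/eqP => [h|->]; last exact: cabs0.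
by apply/eqP; rewrite -normr_eq0 normCE h.
Qed.

Lemma cabsN z : cabs (- z) = cabs z.
Proof. by rewrite /cabs normrN. Qed.

Lemma cabsB z w : cabs (z - w) = cabs (w - z).
Proof. by rewrite /cabs distrC. Qed.

Lemma cabsX z n : cabs (z ^+ n) = cabs z ^+ n.
Proof.
by elim: n => [|n ih]; rewrite ?expr0 ?cabs1// !exprS cabsM ih.
Qed.

Lemma cabsV z : cabs z^-1 = (cabs z)^-1.
Proof.
have [->|z0] := eqVneq z 0; first by rewrite invr0 cabs0 invr0.
have cz0 : cabs z != 0 by rewrite cabs_eq0.
by apply: (mulfI cz0); rewrite -cabsM !divff// cabs1.
Qed.

Lemma cabsD z w : cabs (z + w) <= cabs z + cabs w.
Proof.
have := ler_normD z w; rewrite !normCE => h.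
by move: h; rewrite -rmorphD /= lecE /= => /andP[].
Qed.

Lemma cabs_dist z w u : cabs (z - w) <= cabs (z - u) + cabs (u - w).
Proof. by rewrite -[z - w](subrKA u) cabsD. Qed.

Lemma cabs_subr z w : cabs z - cabs w <= cabs (z - w).
Proof. by rewrite lerBlDr -{1}(subrK w z) cabsD. Qed.

Lemma cabs_sum (I : Type) (r : seq I) (P : pred I) (F : I -> C R) :
  cabs (\sum_(i <- r | P i) F i) <= \sum_(i <- r | P i) cabs (F i).
Proof.
elim/big_rec2: _ => [|i y1 y2 _ h]; first by rewrite cabs0.
by rewrite (le_trans (cabsD _ _))// lerD2l.
Qed.

Lemma cabs_real x : cabs (x%:C : C R) = `|x|.
Proof. by rewrite cabsE /= expr0n addr0 sqrtr_sqr. Qed.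

Lemma cabs_nat n : cabs (n%:R : C R) = n%:R.
Proof.
have -> : (n%:R : C R) = (n%:R : R)%:C by rewrite rmorph_nat.
by rewrite cabs_real normr_nat.
Qed.

Lemma ler_abs_Re z : `|complex.Re z| <= cabs z.
Proof. by rewrite cabsE -sqrtr_sqr ler_wsqrtr// lerDl sqr_ge0. Qed.

Lemma ler_abs_Im z : `|complex.Im z| <= cabs z.
Proof. by rewrite cabsE -sqrtr_sqr ler_wsqrtr// lerDr sqr_ge0. Qed.

Lemma cabs_le_ReIm z : cabs z <= `|complex.Re z| + `|complex.Im z|.
Proof.
rewrite -(@ler_pXn2r _ 2)// ?nnegrE ?cabs_ge0 ?addr_ge0//.
rewrite cabs_sqr sqrrD !real_normK ?num_real// lerD2r lerDl.
by rewrite mulrn_wge0// mulr_ge0.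
Qed.

Lemma cReD z w : complex.Re (z + w) = complex.Re z + complex.Re w.
Proof. by case: z w => a b [c d]. Qed.

Lemma cImD z w : complex.Im (z + w) = complex.Im z + complex.Im w.
Proof. by case: z w => a b [c d]. Qed.

Lemma cReM z w : complex.Re (z * w) =
  complex.Re z * complex.Re w - complex.Im z * complex.Im w.
Proof. by case: z w => a b [c d]. Qed.

Lemma cImM z w : complex.Im (z * w) =
  complex.Re z * complex.Im w + complex.Im z * complex.Re w.
Proof. by case: z w => a b [c d]. Qed.

Lemma complex_ext z w : complex.Re z = complex.Re w ->
  complex.Im z = complex.Im w -> z = w.
Proof. by case: z w => a b [c d] /= -> ->. Qed.

Lemma cReB z w : complex.Re (z - w) = complex.Re z - complex.Re w.
Proof. by case: z w => a b [c d]. Qed.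

Lemma cImB z w : complex.Im (z - w) = complex.Im z - complex.Im w.
Proof. by case: z w => a b [c d]. Qed.

Lemma cabs_cis t : cabs (cis t) = 1.
Proof. by rewrite cabsE /= cos2Dsin2 sqrtr1. Qed.

Lemma cisD x y : cis (x + y) = cis x * cis y.
Proof.
by apply: complex_ext; rewrite ?cReM ?cImM /= ?cosD ?sinD// addrC.
Qed.

Lemma cis0 : cis (0 : R) = 1.
Proof. by rewrite /cis cos0 sin0. Qed.

Lemma cisMn t n : cis (n%:R * t) = cis t ^+ n.
Proof.
elim: n => [|n ih]; first by rewrite mul0r cis0 expr0.
by rewrite exprS -ih -cisD -natr1 mulrDl mul1r addrC.
Qed.

Lemma cis_2pi : cis (2 * pi : R) = 1.
Proof. by rewrite /cis mulr_natl cos2pi sin2pi. Qed.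

Lemma cexpD z w : cexp (z + w) = cexp z * cexp w.
Proof.
rewrite /cexp cReD cImD expRD cosD sinD.
by apply: complex_ext; rewrite ?cReM ?cImM /=; ring.
Qed.

Lemma cexp0 : cexp (0 : C R) = 1.
Proof. by rewrite /cexp /= expR0 cos0 sin0 mulr1 mulr0. Qed.

Lemma cexpMn z n : cexp (n%:R * z) = cexp z ^+ n.
Proof.
elim: n => [|n ih]; first by rewrite mul0r cexp0 expr0.
by rewrite exprS -ih -cexpD -natr1 mulrDl mul1r addrC.
Qed.

Lemma cabs_cexp z : cabs (cexp z) = expR (complex.Re z).
Proof.
rewrite cabsE /cexp /= !exprMn -mulrDr cos2Dsin2 mulr1 sqrtr_sqr.
by rewrite ger0_norm// expR_ge0.
Qed.

End ComplexModulus.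

(** * Points of the unit circle *)

Section Circle.
Context {R : realType}.
Implicit Types (x y t : R).

Lemma ler_norm_sin x : `|sin x| <= `|x|.
Proof.
wlog x0 : x / 0 <= x => [hw|].
  have [/hw//|x0] := leP 0 x.
  by have := hw (- x); rewrite sinN !normrN oppr_ge0; apply; exact: ltW.
have [->|xn0] := eqVneq x 0; first by rewrite sin0.
have xp : 0 < x by rewrite lt_def xn0.
have [c _] := @MVT R sin cos 0 x xp (fun z _ => is_derive_sin z)
  (continuous_subspaceT (@continuous_sin R)).
rewrite sin0 !subr0 => ->; rewrite normrM ler_piMl//; exact: cos_max.
Qed.

Lemma cos_ge1Bsqr x : 1 - x ^+ 2 / 2 <= cos x.
Proof.
rewrite [x in cos x](_ : x = (x / 2) *+ 2) ?cos_mulr2n; last first.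
  by rewrite -mulr_natr divfK.
have : sin (x / 2) ^+ 2 <= (x / 2) ^+ 2.
  rewrite -real_normK ?num_real// -[leRHS]real_normK ?num_real//.
  by rewrite ler_pXn2r ?nnegrE// ler_norm_sin.
have := cos2Dsin2 (x / 2); rewrite expr_div_n -mulr_natr; lra.
Qed.

Lemma cabs_cisB1 x : cabs (cis x - 1) = 2 * `|sin (x / 2)|.
Proof.
apply/eqP; rewrite -(@eqrXn2 _ 2)// ?cabs_ge0// ?mulr_ge0//.
rewrite cabs_sqr cReB cImB /= subr0 exprMn real_normK ?num_real//.
rewrite [X in cos X](_ : x = (x / 2) *+ 2) ?[X in sin X](_ : x = (x / 2) *+ 2);
  do ?by rewrite -mulr_natr divfK.
rewrite cos_mulr2n sin_mulr2n.
have := cos2Dsin2 (x / 2); set c := cos _; set s := sin _ => h.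
have hc : c ^+ 2 = 1 - s ^+ 2 by rewrite -h addrK.
have -> : (c * s *+ 2) ^+ 2 = c ^+ 2 * s ^+ 2 * 4 by ring.
by apply/eqP; rewrite hc; ring.
Qed.

Lemma cabs_cisB x y : cabs (cis x - cis y) = 2 * `|sin ((x - y) / 2)|.
Proof.
rewrite -cabs_cisB1 -[cabs (cis (x - y) - 1)]mulr1 -(cabs_cis y) -cabsM.
by rewrite mulrBl mul1r -cisD subrK.
Qed.

Lemma cabs_cisB_le x y : cabs (cis x - cis y) <= `|x - y|.
Proof.
rewrite cabs_cisB; apply: (le_trans (ler_wpM2l _ (ler_norm_sin _))) => //.
by rewrite normrM [`|2^-1|]ger0_norm// mulrCA divff ?mulr1.
Qed.

(** A crude form of Jordan's inequality: up to [pi / 3] the derivative of [sin]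
    is at least [1 / 2], and beyond that point [sin] stays above [1 / 2]. *)
Lemma sin_lower_bound x : 0 <= x <= pi / 2 -> x / 4 <= sin x.
Proof.
move=> /andP[x0 xpi].
have pi2 : (pi : R) / 2 <= 2 by have [/andP[_]] := @pihalf_02_cos_pihalf R; lra.
have [x1|x1] := leP x 1.
  have [->|xn0] := eqVneq x 0; first by rewrite sin0 mul0r.
  have xp : 0 < x by rewrite lt_def xn0.
  have [c /[!in_itv]/= /andP[c0 c1]] :=
    @MVT R sin cos 0 x xp (fun z _ => is_derive_sin z)
    (continuous_subspaceT (@continuous_sin R)).
  rewrite sin0 !subr0 => ->; rewrite mulrC ler_pM2r//.
  have := cos_ge1Bsqr c; nra.
have : sin 1 <= sin x.
  rewrite leNgt ltr_sin ?in_itv/=; first by rewrite -leNgt ltW.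
    apply/andP; split; lra.
  apply/andP; split; lra.
suff : 1 / 2 <= sin (1 : R) by lra.
have [c /[!in_itv]/= /andP[c0 c1]] :=
    @MVT R sin cos 0 1 ltr01 (fun z _ => is_derive_sin z)
    (continuous_subspaceT (@continuous_sin R)).
rewrite sin0 !subr0 mulr1 => ->.
have := cos_ge1Bsqr c; nra.
Qed.

Lemma cabs_cisB_ge x y : `|x - y| <= pi -> `|x - y| / 4 <= cabs (cis x - cis y).
Proof.
move=> h; rewrite cabs_cisB.
wlog xy : x y h / y <= x => [hw|].
  have [xy|/ltW xy] := leP y x; first exact: hw.
  have -> : (x - y) / 2 = - ((y - x) / 2) by lra.
  by rewrite sinN normrN distrC; apply: hw => //; rewrite distrC.
have := h; rewrite ger0_norm ?subr_ge0// => h'.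
have := @sin_lower_bound ((x - y) / 2).
rewrite divr_ge0 ?subr_ge0//= ler_pM2r// => /(_ h') hs.
have := ler_norm (sin ((x - y) / 2)); lra.
Qed.

Lemma cis_inj x y : 0 <= x < 2 * pi -> 0 <= y < 2 * pi -> cis x = cis y -> x = y.
Proof.
wlog xy : x y / y <= x => [hw hx hy e|].
  have [xy|/ltW xy] := leP y x; first exact: hw.
  by apply/esym; apply: hw.
move=> /andP[x0 x1] /andP[y0 y1] e.
have := cabs_cisB x y; rewrite e subrr cabs0 => /esym/eqP.
rewrite mulf_eq0 pnatr_eq0/= normr_eq0 => /eqP s0.
apply/eqP; rewrite eq_le xy andbT leNgt; apply/negP => xy'.
have : 0 < sin ((x - y) / 2) by apply: sin_gt0_pi; apply/andP; split; lra.
by rewrite s0 ltxx.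
Qed.

Lemma cis_surj (z : C R) : cabs z = 1 -> exists2 t, 0 <= t < 2 * pi & z = cis t.
Proof.
move=> z1.
have h : complex.Re z ^+ 2 + complex.Im z ^+ 2 = 1 by rewrite -cabs_sqr z1 expr1n.
have hr : -1 <= complex.Re z <= 1 by rewrite -ler_norml -z1 ler_abs_Re.
have hi : `|complex.Im z| = Num.sqrt (1 - complex.Re z ^+ 2).
  by rewrite -h addrC addKr sqrtr_sqr.
have a0 := acos_ge0 hr; have a1 := acos_lepi hr.
have pi0 := @pi_gt0 R.
have [i0|i0] := leP 0 (complex.Im z).
  exists (acos (complex.Re z)); first by apply/andP; split; lra.
  apply: complex_ext; rewrite /= ?acosK ?in_itv//.
  by rewrite sin_acos// -hi ger0_norm.
exists (2 * pi - acos (complex.Re z)).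
  apply/andP; split; first lra.
  suff : 0 < acos (complex.Re z) by lra.
  rewrite acos_gt0//; case/andP: hr => -> /= hr.
  by rewrite lt_neqAle hr andbT; apply/eqP => e; move: h; rewrite e; nra.
apply: complex_ext; rewrite /cis /=.
  by rewrite mulr_natl addrC cosD2pi cosN acosK ?in_itv.
rewrite mulr_natl addrC sinD2pi sinN sin_acos// -hi.
by rewrite ltr0_norm// opprK.
Qed.

End Circle.

(** * Cauchy estimates for polynomials *)

Section CauchyPoly.
Context {R : realType}.
Implicit Types (z w : C R) (p q : {poly C R}) (d B rho t : R).

Definition unity_root (N : nat) : C R := cis (2 * pi / N%:R).

Lemma unity_rootXn N : (0 < N)%N -> unity_root N ^+ N = 1.
Proof.
move=> N0; rewrite -cisMn mulrC divfK ?cis_2pi//.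
by rewrite pnatr_eq0 -lt0n.
Qed.

Lemma unity_rootX_neq1 N j : (0 < j < N)%N -> unity_root N ^+ j != 1.
Proof.
move=> /andP[j0 jN]; rewrite -cisMn -cis0; apply/eqP => /cis_inj.
have N0 : 0 < N%:R :> R by rewrite ltr0n (leq_ltn_trans _ jN).
have pi0 := @pi_gt0 R.
have pi2 : 0 < 2 * pi / N%:R :> R by rewrite divr_gt0// mulr_gt0.
have jR : 0 < j%:R :> R by rewrite ltr0n.
move=> h; suff : j%:R * (2 * pi / N%:R) = 0 :> R by apply/eqP; rewrite gt_eqF// mulr_gt0.
apply: h; last by rewrite lexx mulr_gt0.
rewrite mulr_ge0 ?ltW//= mulrA ltr_pdivrMr// mulrC ltr_pM2l ?ltr_nat//.
by rewrite mulr_gt0.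
Qed.

Lemma sum_unity_root N m : (0 < N)%N -> unity_root N ^+ m != 1 ->
  \sum_(k < N) unity_root N ^+ (k * m) = 0.
Proof.
move=> N0 hm.
under eq_bigr => k _ do rewrite mulnC exprM.
have h0 : unity_root N ^+ m - 1 != 0 by rewrite subr_eq0.
apply: (mulfI h0); rewrite mulr0.
by rewrite -subrX1 -exprM mulnC exprM unity_rootXn// expr1n subrr.
Qed.

(** Averaging [p] over the [N]-th roots of unity against a character isolates
    one coefficient as soon as [N] exceeds the degree. *)
Lemma cauchy_coef p d B n : 0 <= d ->
  (forall w, cabs w <= d -> cabs p.[w] <= B) -> cabs p`_n * d ^+ n <= B.
Proof.
move=> d0 hB.
have B0 : 0 <= B by rewrite (le_trans (cabs_ge0 p.[0])) ?hB ?cabs0.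
pose N := (size p + n).+1.
pose om : C R := unity_root N.
have om1 k : cabs (om ^+ k) = 1 by rewrite cabsX cabs_cis expr1n.
have key : \sum_(k < N) p.[d%:C * om ^+ k] * om ^+ (k * (N - n)) =
           N%:R * (p`_n * d%:C ^+ n).
  under eq_bigr => k _.
    rewrite (@horner_coef_wide _ N); last by rewrite /N; lia.
    rewrite big_distrl/=; over.
  rewrite exchange_big/=.
  have nN : (n < N)%N by rewrite /N; lia.
  rewrite (bigD1 (Ordinal nN))//= [X in _ + X]big1 ?addr0.
    rewrite /=; transitivity (\sum_(k < N) p`_n * d%:C ^+ n).
      apply: eq_bigr => k _.
      have h1 : om ^+ k ^+ n * om ^+ (k * (N - n)) = 1.
        rewrite -exprM -exprD -mulnDr subnKC 1?ltnW// mulnC exprM.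
        by rewrite unity_rootXn// expr1n.
      by rewrite exprMn -!mulrA h1 mulr1.
    by rewrite sumr_const card_ord mulr_natl.
  move=> j /eqP jn.
  transitivity (p`_j * d%:C ^+ j * \sum_(k < N) om ^+ (k * (j + (N - n)))).
    rewrite big_distrr/=; apply: eq_bigr => k _.
    by rewrite exprMn -!mulrA -exprM -exprD -mulnDr.
  rewrite sum_unity_root ?mulr0//.
  have jn' : (j : nat) <> n by move=> e; apply: jn; apply: val_inj.
  have jN := ltn_ord j.
  have [jln|nlj] := ltnP j n.
    by apply: unity_rootX_neq1; apply/andP; split; lia.
  have -> : (j + (N - n) = N + (j - n))%N by lia.
  rewrite exprD unity_rootXn// mul1r.
  by apply: unity_rootX_neq1; apply/andP; split; lia.
have : cabs (N%:R * (p`_n * d%:C ^+ n)) <= \sum_(k < N) B.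
  rewrite -key (le_trans (cabs_sum _ _ _))// ler_sum// => k _.
  rewrite cabsM om1 mulr1 hB// cabsM om1 mulr1 cabs_real ger0_norm//.
rewrite sumr_const card_ord -[leRHS]mulr_natl !cabsM cabsX cabs_nat cabs_real.
by rewrite ger0_norm// ler_pM2l// ltr0n.
Qed.

Lemma geometric_sum_le2 t n : 0 <= t <= 1 / 2 -> \sum_(i < n) t ^+ i <= 2.
Proof.
move=> /andP[t0 t1].
suff : \sum_(i < n) t ^+ i <= 2 * (1 - t ^+ n).
  move=> /le_trans; apply; have := exprn_ge0 n t0; lra.
elim: n => [|n ih]; first by rewrite big_ord0 expr0 subrr mulr0.
rewrite big_ord_recr/= (le_trans (lerD ih (lexx _)))//.
have := exprn_ge0 n t0; rewrite exprS; nra.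
Qed.

(** By [cauchy_coef] the coefficients at [z0] are at most [B / d ^ n], so for
    [|w| <= d / 2] every tail of the expansion is at most twice the bound on its first
    term. *)
Lemma poly_taylor p z0 d B : 0 < d ->
  (forall w, cabs w <= d -> cabs p.[z0 + w] <= B) ->
  [/\ cabs p^`().[z0] <= B / d,
      forall w, cabs w <= d / 2 -> cabs (p.[z0 + w] - p.[z0]) <= 2 * B * (cabs w / d) &
      forall w, cabs w <= d / 2 ->
        cabs (p.[z0 + w] - p.[z0] - p^`().[z0] * w) <= 2 * B * (cabs w / d) ^+ 2].
Proof.
move=> d0 hB.
pose q := p \Po ('X + z0%:P).
have qE w : q.[w] = p.[z0 + w] by rewrite horner_comp !hornerE addrC.
have hq n : cabs q`_n <= B / d ^+ n.
  rewrite ler_pdivlMr ?exprn_gt0//; apply: cauchy_coef; first exact: ltW.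
  by move=> w wd; rewrite qE hB.
have q0 : q`_0 = p.[z0] by rewrite -horner_coef0 qE addr0.
have q1 : q`_1 = p^`().[z0].
  have := coef_deriv q 0; rewrite mulr1n => <-.
  rewrite -horner_coef0 /q deriv_comp derivD derivX derivC addr0 mulr1.
  by rewrite horner_comp !hornerE.
have tail k w : cabs w <= d / 2 ->
    cabs (\sum_(i < size q) q`_(i + k) * w ^+ (i + k)) <= 2 * B * (cabs w / d) ^+ k.
  move=> wd; rewrite (le_trans (cabs_sum _ _ _))//.
  have B0 : 0 <= B.
    by rewrite (le_trans (cabs_ge0 p.[z0 + 0])) ?hB// cabs0 ltW.
  set t := cabs w / d.
  have t0 : 0 <= t by rewrite divr_ge0 ?cabs_ge0// ltW.
  have t1 : t <= 1 / 2 by rewrite ler_pdivrMr// mulrAC mul1r.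
  apply: (@le_trans _ _ (\sum_(i < size q) (B * t ^+ k) * t ^+ i)).
    rewrite ler_sum// => i _; rewrite cabsM cabsX.
    apply: (le_trans (ler_wpM2r _ (hq _))); first by rewrite exprn_ge0 ?cabs_ge0.
    by rewrite -!mulrA -exprD addnC /t [in leRHS]expr_div_n mulrCA mulrC mulrA.
  rewrite -big_distrr/= [leRHS]mulrAC [leRHS]mulrAC -[leRHS]mulrA mulrC.
  by rewrite ler_wpM2r ?geometric_sum_le2 ?t0// mulr_ge0// exprn_ge0.
have ex k w : q.[w] = \sum_(i < k) q`_i * w ^+ i + \sum_(i < size q) q`_(i + k) * w ^+ (i + k).
  rewrite (@horner_coef_wide _ (k + size q)%N) ?leq_addl// big_split_ord/=.
  by congr (_ + _); apply: eq_bigr => i _; rewrite addnC.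
split.
- by have := hq 1%N; rewrite q1 expr1.
- move=> w wd; rewrite -qE (ex 1%N) big_ord1 expr0 mulr1 q0 addrAC subrr add0r.
  by have := tail 1%N w wd; rewrite expr1.
- move=> w wd; rewrite -qE (ex 2%N) big_ord_recr big_ord1/= expr0 expr1 mulr1 q0 q1.
  have -> : p.[z0] + p^`().[z0] * w + (\sum_(i < size q) q`_(i + 2) * w ^+ (i + 2)) -
    p.[z0] - p^`().[z0] * w = \sum_(i < size q) q`_(i + 2) * w ^+ (i + 2) by ring.
  exact: tail.
Qed.

End CauchyPoly.

(** * Locally uniform limits of polynomials on the disk *)

Section PolyApprox.
Context {R : realType}.
Implicit Types (z w : C R) (p q : {poly C R}) (d B rho e : R) (F : C R -> C R).

Definition poly_approx rho F := forall e, 0 < e ->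
  exists p, forall z, cabs z <= rho -> cabs (F z - p.[z]) <= e.

(** Working with limits of polynomials, rather than with complex
    differentiability, makes Cauchy's estimates available without path
    integrals. *)
Definition disk_analytic F := forall rho, rho < 1 -> poly_approx rho F.

Lemma poly_bounded p rho : exists B, forall z, cabs z <= rho -> cabs p.[z] <= B.
Proof.
exists (\sum_(i < size p) cabs p`_i * rho ^+ i) => z zr.
rewrite horner_coef (le_trans (cabs_sum _ _ _))// ler_sum// => i _.
rewrite cabsM cabsX ler_wpM2l ?cabs_ge0// lerXn2r// nnegrE ?cabs_ge0//.
by rewrite (le_trans (cabs_ge0 z)).
Qed.

Lemma poly_approx_bounded rho F : poly_approx rho F ->
  exists B, forall z, cabs z <= rho -> cabs (F z) <= B.
Proof.
move=> /(_ 1 ltr01)[p hp]; have [B hB] := poly_bounded p rho.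
exists (1 + B) => z zr; rewrite -(subrK p.[z] (F z)) (le_trans (cabsD _ _))//.
by rewrite lerD ?hp ?hB.
Qed.

Lemma le_of_approx (x y c : R) : (forall e, 0 < e -> x <= y + c * e) -> x <= y.
Proof.
move=> h; apply/ler_addgt0Pr => e e0.
have c1 : 0 < `|c| + 1 by rewrite ltr_wpDl.
rewrite (le_trans (h (e / (`|c| + 1)) _)) ?divr_gt0// lerD2l.
rewrite mulrA ler_pdivrMr// mulrC ler_pM2l//.
by rewrite (le_trans (ler_norm c))// lerDl.
Qed.

Lemma disk_bound z0 w d rho : cabs z0 + d <= rho -> cabs w <= d -> cabs (z0 + w) <= rho.
Proof. by move=> h wd; rewrite (le_trans (cabsD _ _))// (le_trans _ h)// lerD2l. Qed.

Lemma poly_approx_lipschitz F z0 d rho B : 0 < d -> cabs z0 + d <= rho ->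
  poly_approx rho F -> (forall w, cabs w <= d -> cabs (F (z0 + w)) <= B) ->
  forall w, cabs w <= d / 2 -> cabs (F (z0 + w) - F z0) <= 2 * B * (cabs w / d).
Proof.
move=> d0 zd hF hB w wd.
apply: (@le_of_approx _ _ (2 + 2 * (cabs w / d))) => e e0.
have [p hp] := hF e e0.
have wd' : cabs w <= d by lra.
have hz v : cabs v <= d -> cabs (z0 + v) <= rho by apply: disk_bound.
have hpB : forall v, cabs v <= d -> cabs p.[z0 + v] <= B + e.
  move=> v vd; rewrite -(subrK (F (z0 + v)) p.[_]) addrC (le_trans (cabsD _ _))//.
  by rewrite lerD ?hB// cabsB hp// hz.
have [_ /(_ w wd) h _] := poly_taylor d0 hpB.
have -> : F (z0 + w) - F z0 = (F (z0 + w) - p.[z0 + w]) + (p.[z0 + w] - p.[z0])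
   + (p.[z0] - F z0) by ring.
rewrite (le_trans (cabsD _ _))// (le_trans (lerD (cabsD _ _) (lexx _)))//.
have h1 : cabs (F (z0 + w) - p.[z0 + w]) <= e by rewrite hp// hz.
have h2 : cabs (p.[z0] - F z0) <= e.
  by rewrite cabsB hp// -[z0]addr0 hz// cabs0 ltW.
rewrite (le_trans (lerD (lerD h1 h) h2))//.
by rewrite le_eqVlt; apply/orP; left; apply/eqP; ring.
Qed.

Lemma real_cauchy_limit (a : nat -> R) (k : R) :
  (forall n m, `|a n - a m| <= k * (n.+1%:R^-1 + m.+1%:R^-1)) ->
  exists l, forall n, `|a n - l| <= k * n.+1%:R^-1.
Proof.
move=> h; pose A := [set a n - k * n.+1%:R^-1 | n in setT].
have ub m : ubound A (a m + k * m.+1%:R^-1).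
  move=> _ [n _ <-]; have := h n m; rewrite mulrDr ler_norml => /andP[_].
  set u := k * n.+1%:R^-1; set v := k * _; lra.
have sA : has_sup A.
  by split; [exists (a 0%N - k * 1%:R^-1); exists 0%N | exists (a 0%N + k * 1%:R^-1); exact: ub].
exists (sup A) => n; rewrite ler_norml; apply/andP; split.
  have := @ge_sup _ A (a n + k * n.+1%:R^-1) sA.1 (ub n).
  set u := k * n.+1%:R^-1; lra.
have : a n - k * n.+1%:R^-1 <= sup A by apply: sup_upper_bound => //; exists n.
set u := k * n.+1%:R^-1; lra.
Qed.

(** By Cauchy's estimate the derivatives at [z0] of polynomials that approximate [F]
    form a Cauchy sequence, and its limit inherits both estimates. *)
Lemma poly_approx_derivative F z0 d rho : 0 < d -> cabs z0 + d <= rho ->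
  poly_approx rho F -> exists L : C R,
  (forall p e, (forall z, cabs z <= rho -> cabs (F z - p.[z]) <= e) ->
     cabs (L - p^`().[z0]) <= e / d) /\
  (forall B, (forall w, cabs w <= d -> cabs (F (z0 + w)) <= B) ->
     forall w, cabs w <= d / 2 ->
     cabs (F (z0 + w) - F z0 - L * w) <= 2 * B * (cabs w / d) ^+ 2).
Proof.
move=> d0 zd hF.
have hz v : cabs v <= d -> cabs (z0 + v) <= rho by apply: disk_bound.
have /choice[P hP] : forall n : nat, exists p, forall z, cabs z <= rho ->
    cabs (F z - p.[z]) <= n.+1%:R^-1.
  by move=> n; apply: hF; rewrite invr_gt0.
have hpq p q e e' : (forall z, cabs z <= rho -> cabs (F z - p.[z]) <= e) ->
   (forall z, cabs z <= rho -> cabs (F z - q.[z]) <= e') ->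
   cabs (p^`().[z0] - q^`().[z0]) <= d^-1 * (e + e').
  move=> hp hq.
  have hpq' : forall v, cabs v <= d -> cabs (p - q).[z0 + v] <= e + e'.
    move=> v vd; rewrite !hornerE (le_trans (cabs_dist _ _ (F (z0 + v))))//.
    by rewrite lerD// ?hq ?hz// cabsB hp// hz.
  have [h _ _] := poly_taylor d0 hpq'.
  by move: h; rewrite derivB !hornerE mulrC.
have [x hx] := @real_cauchy_limit (fun n => complex.Re (P n)^`().[z0]) d^-1 (fun n m =>
   le_trans (eq_ind _ (fun t => t <= _) (ler_abs_Re _) _ (congr1 Num.norm (cReB _ _)))
     (hpq _ _ _ _ (hP n) (hP m))).
have [y hy] := @real_cauchy_limit (fun n => complex.Im (P n)^`().[z0]) d^-1 (fun n m =>
   le_trans (eq_ind _ (fun t => t <= _) (ler_abs_Im _) _ (congr1 Num.norm (cImB _ _)))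
     (hpq _ _ _ _ (hP n) (hP m))).
have hL n : cabs ((x +i* y : C R) - (P n)^`().[z0]) <= 2 * d^-1 * n.+1%:R^-1.
  rewrite cabsB (le_trans (cabs_le_ReIm _))// cReB cImB /=.
  have := hx n; have := hy n; rewrite -mulrA; set u := d^-1 * _; lra.
have n_small e : 0 < e -> exists n : nat, n.+1%:R^-1 <= e.
  move=> e0; exists (Num.truncn e^-1); rewrite -[leRHS]invrK.
  rewrite lef_pV2 ?posrE ?invr_gt0//; exact: ltW (truncnS_gt _).
exists (x +i* y); split=> [p e hp|B hB w wd].
  apply: (@le_of_approx _ _ (3 * d^-1)) => e' e'0; have [n ne'] := n_small e' e'0.
  rewrite (le_trans (cabs_dist _ _ (P n)^`().[z0]))//.
  have h1 := hL n; have h2 := hpq _ _ _ _ (hP n) hp.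
  have h3 : d^-1 * n.+1%:R^-1 <= d^-1 * e' by rewrite ler_pM2l// invr_gt0.
  rewrite (le_trans (lerD h1 h2))// mulrDr -mulrA (mulrC e).
  by move: h3; set u := d^-1 * _; lra.
apply: (@le_of_approx _ _ (2 + 2 * (cabs w / d) ^+ 2 + 2 * d^-1 * cabs w)) => e e0.
have [n ne] := n_small e e0; set p := P n.
have pe z : cabs z <= rho -> cabs (F z - p.[z]) <= e.
  by move=> zr; rewrite (le_trans (hP n z zr)).
have wd' : cabs w <= d by lra.
have hpB : forall v, cabs v <= d -> cabs p.[z0 + v] <= B + e.
  move=> v vd; rewrite -(subrK (F (z0 + v)) p.[_]) addrC (le_trans (cabsD _ _))//.
  by rewrite lerD ?hB// cabsB pe// hz.
have [_ _ /(_ w wd) h] := poly_taylor d0 hpB.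
set L := (x +i* y : C R).
have -> : F (z0 + w) - F z0 - L * w = (F (z0 + w) - p.[z0 + w]) +
   (p.[z0 + w] - p.[z0] - p^`().[z0] * w)
   + (p.[z0] - F z0) + (p^`().[z0] - L) * w by ring.
have h1 : cabs (F (z0 + w) - p.[z0 + w]) <= e by rewrite pe// hz.
have h2 : cabs (p.[z0] - F z0) <= e.
  by rewrite cabsB pe// -[z0]addr0 hz// cabs0 ltW.
have h3 : cabs ((p^`().[z0] - L) * w) <= 2 * d^-1 * e * cabs w.
  rewrite cabsM ler_wpM2r ?cabs_ge0// cabsB (le_trans (hL n))//.
  by rewrite ler_pM2l// mulr_gt0// invr_gt0.
rewrite (le_trans (cabsD _ _))// (le_trans (lerD (cabsD _ _) (lexx _)))//.
rewrite (le_trans (lerD (lerD (cabsD _ _) (lexx _)) (lexx _)))//.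
rewrite (le_trans (lerD (lerD (lerD h1 h) h2) h3))//.
by rewrite le_eqVlt; apply/orP; left; apply/eqP; ring.
Qed.

Lemma derive1_of_quadratic_remainder F z0 (L : C R) d k : 0 < d ->
  (forall w, cabs w <= d -> cabs (F (z0 + w) - F z0 - L * w) <= k * cabs w ^+ 2) ->
  derive1 F z0 = L.
Proof.
move=> d0 h; rewrite /derive1; apply/cvg_lim => //.
apply/cvgrPdist_le => e e0.
have k1 : 0 < `|k| + 1 by rewrite ltr_wpDl.
have eR : e = (complex.Re e)%:C.
  by case: e e0 => a b; rewrite ltcE /= => /andP[/eqP-> _].
have e'0 : 0 < complex.Re e by move: e0; rewrite ltcE /= => /andP[].
pose dl := Num.min d (complex.Re e / (`|k| + 1)).
have dl0 : 0 < dl by rewrite lt_min d0 divr_gt0.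
rewrite /dnbhs !near_withinE; near=> w => w0.
have wdl : cabs w < dl.
  near: w; apply/nbhs_ballP; exists (dl%:C) => /=; first by rewrite ltcR.
  by move=> w; rewrite /ball/= sub0r normrN normCE ltcR.
have [wd we] : cabs w <= d /\ (`|k| + 1) * cabs w <= complex.Re e.
  move: wdl; rewrite lt_min => /andP[/ltW-> /ltW]; split=> //.
  by rewrite mulrC -ler_pdivlMr.
rewrite normCE eR lecR.
have -> : L - w^-1 *: (F (w + z0) - F z0) = - (w^-1 * (F (z0 + w) - F z0 - L * w)).
  rewrite [w + z0]addrC scalerBr; apply/eqP; rewrite /GRing.scale/=.
  by apply/eqP; field.
rewrite cabsN cabsM cabsV mulrC ler_pdivrMr ?lt_def ?cabs_ge0 ?cabs_eq0 ?w0//.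
rewrite (le_trans (h w wd))// expr2 mulrA ler_wpM2r ?cabs_ge0// (le_trans _ we)//.
by rewrite ler_wpM2r ?cabs_ge0// (le_trans (ler_norm k))// lerDl.
Unshelve. all: by end_near. Qed.

Section Derivative.
Variables (F : C R -> C R).
Hypothesis hF : disk_analytic F.

Lemma derive1_approx z0 d rho p e : 0 < d -> cabs z0 + d <= rho -> rho < 1 ->
  (forall z, cabs z <= rho -> cabs (F z - p.[z]) <= e) ->
  cabs (derive1 F z0 - p^`().[z0]) <= e / d.
Proof.
move=> d0 zd r1 hp.
have [L [h1 h2]] := poly_approx_derivative d0 zd (hF r1).
have [B hB] := poly_approx_bounded (hF r1).
have /h2 {}h2 : forall w, cabs w <= d -> cabs (F (z0 + w)) <= B.
  by move=> w wd; apply: hB; apply: disk_bound wd.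
rewrite (@derive1_of_quadratic_remainder _ _ L (d / 2) (2 * B / d ^+ 2)) ?divr_gt0//.
  exact: h1.
by move=> w wd; rewrite (le_trans (h2 w wd))// expr_div_n mulrA mulrAC.
Qed.

Lemma disk_analytic_derive1 : disk_analytic (derive1 F).
Proof.
move=> rho r1 e e0.
have d0 : 0 < (1 - rho) / 2 by lra.
have r1' : (1 + rho) / 2 < 1 by lra.
have [p hp] := hF r1' (mulr_gt0 e0 d0).
exists p^`() => z zr.
have := @derive1_approx z ((1 - rho) / 2) ((1 + rho) / 2) p _ d0 _ r1' hp.
by rewrite mulfK ?gt_eqF//; apply; lra.
Qed.

Lemma quadratic_remainder z0 d rho B : 0 < d -> cabs z0 + d <= rho -> rho < 1 ->
  (forall z, cabs z <= rho -> cabs (F z) <= B) ->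
  forall w, cabs w <= d / 2 ->
  cabs (F (z0 + w) - F z0 - derive1 F z0 * w) <= 2 * B * (cabs w / d) ^+ 2.
Proof.
move=> d0 zd r1 hB.
have [L [h1 h2]] := poly_approx_derivative d0 zd (hF r1).
have /h2 {}h2 : forall w, cabs w <= d -> cabs (F (z0 + w)) <= B.
  by move=> w wd; apply: hB; apply: disk_bound wd.
rewrite (@derive1_of_quadratic_remainder _ _ L (d / 2) (2 * B / d ^+ 2)) ?divr_gt0//.
by move=> w wd; rewrite (le_trans (h2 w wd))// expr_div_n mulrA mulrAC.
Qed.

(** The mean value inequality: cutting the segment into [n] pieces makes the
    quadratic remainders add up to [O(1 / n)]. *)
Lemma mean_value_inequality (a b : C R) rho M : rho < 1 ->
  cabs a <= rho -> cabs b <= rho ->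
  (forall t : R, 0 <= t <= 1 -> cabs (derive1 F (a + t%:C * (b - a))) <= M) ->
  cabs (F b - F a) <= M * cabs (b - a).
Proof.
move=> r1 ar br hM.
pose r' := (1 + rho) / 2; pose d := (1 - rho) / 2.
have d0 : 0 < d by rewrite /d; lra.
have r'1 : r' < 1 by rewrite /r'; lra.
have [B hB] := poly_approx_bounded (hF r'1).
have B0 : 0 <= B.
  rewrite (le_trans (cabs_ge0 (F a)))// hB// /r'; lra.
set h := cabs (b - a); have h0 : 0 <= h := cabs_ge0 _.
pose K := 2 * B * (h / d) ^+ 2.
have K0 : 0 <= K.
  by apply: mulr_ge0; [exact: mulr_ge0|apply: exprn_ge0; apply: divr_ge0 => //; exact: ltW].
apply: (@le_of_approx _ _ K) => e e0.
pose n := (Num.truncn (Num.max e^-1 (2 * h / d))).+1.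
have n0 : 0 < n%:R :> R by rewrite ltr0n.
have [ne nh] : e^-1 <= n%:R /\ 2 * h / d <= n%:R.
  have /ltW := truncnS_gt (Num.max e^-1 (2 * h / d)).
  by rewrite -/n ge_max => /andP[].
pose g k := a + ((k%:R / n%:R)%:C : C R) * (b - a).
have gr k : (k <= n)%N -> cabs (g k) <= rho.
  move=> kn; have t1 : k%:R / n%:R <= 1 :> R by rewrite ler_pdivrMr// mul1r ler_nat.
  have t0 : 0 <= k%:R / n%:R :> R by rewrite divr_ge0.
  rewrite /g; set t := k%:R / n%:R in t1 t0 *.
  have -> : a + (t%:C : C R) * (b - a) = ((1 - t)%:C : C R) * a + (t%:C : C R) * b.
    by rewrite (rmorphB (real_complex R)) rmorph1; ring.
  rewrite (le_trans (cabsD _ _))// !cabsM !cabs_real ger0_norm ?subr_ge0// ger0_norm//.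
  nra.
have step k : (k < n)%N -> cabs (F (g k.+1) - F (g k)) <= (M * h + K * e) / n%:R.
  move=> kn.
  pose w : C R := (n%:R^-1)%:C * (b - a).
  have gS : g k.+1 = g k + w.
    rewrite /g /w -natr1 mulrDl mul1r (rmorphD (real_complex R)); ring.
  have cw : cabs w = h / n%:R.
    by rewrite cabsM cabs_real ger0_norm ?invr_ge0// mulrC.
  have wd : cabs w <= d / 2.
    by rewrite cw ler_pdivrMr//; move: nh; rewrite ler_pdivrMr//; lra.
  have gk := gr k (ltnW kn).
  have gkd : cabs (g k) + d <= r' by rewrite /d /r'; lra.
  have := quadratic_remainder d0 gkd r'1 hB wd.
  rewrite cw -gS => hq.
  have hg : cabs (derive1 F (g k)) <= M.
    by apply: hM; rewrite divr_ge0//= ler_pdivrMr// mul1r ler_nat ltnW.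
  rewrite -(subrK (derive1 F (g k) * w) (F (g k.+1) - F (g k))) (le_trans (cabsD _ _))//.
  rewrite (le_trans (lerD hq (lexx _)))// cabsM cw.
  have -> : 2 * B * (h / n%:R / d) ^+ 2 = K * n%:R^-1 / n%:R.
    by rewrite /K; field; rewrite !gt_eqF.
  rewrite mulrA -mulrDl ler_pM2r ?invr_gt0// addrC lerD ?ler_wpM2r//.
  by rewrite ler_wpM2l// -[leRHS]invrK lef_pV2 ?posrE ?invr_gt0.
have tele k : (k <= n)%N -> cabs (F (g k) - F (g 0%N)) <= k%:R * ((M * h + K * e) / n%:R).
  elim: k => [|k ih] kn; first by rewrite subrr cabs0 mul0r.
  rewrite (le_trans (cabs_dist _ _ (F (g k))))// -natr1 mulrDl mul1r addrC.
  by rewrite lerD ?step ?ih// ltnW.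
have g0 : g 0%N = a by rewrite /g !mul0r addr0.
have gn : g n = b by rewrite /g divff ?gt_eqF// mul1r addrC subrK.
by have := tele n (leqnn _); rewrite g0 gn [leRHS]mulrC divfK ?gt_eqF.
Qed.

End Derivative.
End PolyApprox.

(** * Measurable complex-valued functions *)

Section CMeasurable.
Context {R : realType} {d : measure_display} {T : measurableType d}.
Implicit Types (D : set T) (f g : T -> C R).

Definition Cmeasurable D f := measurable_fun D (fun x => complex.Re (f x)) /\
  measurable_fun D (fun x => complex.Im (f x)).

Lemma Cmeasurable_cst D (c : C R) : Cmeasurable D (fun=> c).
Proof. by split; exact: measurable_cst. Qed.

Lemma CmeasurableD D f g : Cmeasurable D f -> Cmeasurable D g ->
  Cmeasurable D (fun x => f x + g x).
Proof.
move=> [f1 f2] [g1 g2]; split.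
  by under eq_fun do rewrite cReD; exact: measurable_funD.
by under eq_fun do rewrite cImD; exact: measurable_funD.
Qed.

Lemma CmeasurableM D f g : Cmeasurable D f -> Cmeasurable D g ->
  Cmeasurable D (fun x => f x * g x).
Proof.
move=> [f1 f2] [g1 g2]; split.
  under eq_fun do rewrite cReM.
  by apply: measurable_funB; exact: measurable_funM.
under eq_fun do rewrite cImM.
by apply: measurable_funD; exact: measurable_funM.
Qed.

Lemma Cmeasurable_real D (u : T -> R) : measurable_fun D u ->
  Cmeasurable D (fun x => (u x)%:C).
Proof. by move=> mu; split=> //=; exact: measurable_cst. Qed.

Lemma Cmeasurable_horner D f (p : {poly C R}) : Cmeasurable D f ->
  Cmeasurable D (fun x => p.[f x]).
Proof.
move=> mf; elim/poly_ind: p => [|p c ih].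
  by under eq_fun do rewrite horner0; exact: Cmeasurable_cst.
under eq_fun do rewrite hornerMXaddC.
by apply: CmeasurableD; [exact: CmeasurableM|exact: Cmeasurable_cst].
Qed.

Lemma Cmeasurable_cabs D f : Cmeasurable D f -> measurable_fun D (fun x => cabs (f x)).
Proof.
move=> [f1 f2]; under eq_fun.
  move=> x; rewrite cabsE -powR12_sqrt ?addr_ge0 ?sqr_ge0//; over.
apply: (@measurableT_comp _ _ _ _ _ _ (@powR R ^~ 2^-1)) => //.
by apply: measurable_funD; exact: measurable_funX.
Qed.

Lemma inv_succ_small (e : R) : 0 < e -> \forall n \near \oo, n.+1%:R^-1 < e.
Proof.
move=> e0; near=> n; rewrite -[ltRHS]invrK ltf_pV2 ?posrE ?invr_gt0//.
rewrite (lt_le_trans (truncnS_gt _))// ler_nat ltnS.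
by near: n; exists (Num.truncn e^-1).
Unshelve. all: by end_near. Qed.

Lemma Cmeasurable_unif_approx D f :
  (forall e, 0 < e -> exists2 g, Cmeasurable D g &
     forall x, D x -> cabs (f x - g x) <= e) -> Cmeasurable D f.
Proof.
move=> h; have /choice[g hg] : forall n : nat, exists g, Cmeasurable D g /\
    forall x, D x -> cabs (f x - g x) <= n.+1%:R^-1.
  by move=> n; have [|g ? ?] := h n.+1%:R^-1; [rewrite invr_gt0|exists g].
split.
  apply: (@measurable_fun_cvg _ _ _ D (fun n x => complex.Re (g n x))).
    by move=> n; have [[]] := hg n.
  move=> x Dx; apply/cvgrPdist_lt => e e0; near=> n.
  rewrite -cReB (le_lt_trans (ler_abs_Re _))// (le_lt_trans ((hg n).2 x Dx))//.
  by near: n; exact: inv_succ_small.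
apply: (@measurable_fun_cvg _ _ _ D (fun n x => complex.Im (g n x))).
  by move=> n; have [[]] := hg n.
move=> x Dx; apply/cvgrPdist_lt => e e0; near=> n.
rewrite -cImB (le_lt_trans (ler_abs_Im _))// (le_lt_trans ((hg n).2 x Dx))//.
by near: n; exact: inv_succ_small.
Unshelve. all: by end_near. Qed.

(** Uniform limits of polynomials reduce measurability to sums and products. *)
Lemma Cmeasurable_analytic D f rho (F : C R -> C R) : poly_approx rho F ->
  Cmeasurable D f -> (forall x, D x -> cabs (f x) <= rho) ->
  Cmeasurable D (fun x => F (f x)).
Proof.
move=> hF mf fr; apply: Cmeasurable_unif_approx => e e0.
have [p hp] := hF e e0; exists (fun x => p.[f x]); first exact: Cmeasurable_horner.
by move=> x Dx; apply: hp; exact: fr.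
Qed.

End CMeasurable.

Section BorelPlane.
Context {R : realType}.
Implicit Types (A : set (C R)).

Lemma continuous_1lip (f : C R -> R) :
  (forall z w, `|f z - f w| <= cabs (z - w)) -> continuous f.
Proof.
move=> h z; apply/(@cvgrPdist_lt _ _ _ (nbhs z)) => e e0.
apply/nbhs_ballP; exists (e%:C) => /=; first by rewrite ltcR.
by move=> w; rewrite /ball/= normCE ltcR; exact: le_lt_trans.
Qed.

Lemma continuous_ReC : continuous (@complex.Re R : C R -> R).
Proof. by apply: continuous_1lip => z w; rewrite -cReB ler_abs_Re. Qed.

Lemma continuous_ImC : continuous (@complex.Im R : C R -> R).
Proof. by apply: continuous_1lip => z w; rewrite -cImB ler_abs_Im. Qed.

Lemma continuous_cabs : continuous (@cabs R).
Proof.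
apply: continuous_1lip => z w; rewrite ler_norml cabs_subr andbT.
by rewrite lerNl opprB (le_trans (cabs_subr _ _))// cabsB.
Qed.

Lemma measurable_openC A : open A -> measurable (A : set (borelC R)).
Proof. exact: sub_sigma_algebra. Qed.

Lemma measurable_closedC A : closed A -> measurable (A : set (borelC R)).
Proof.
by move=> /closed_openC/measurable_openC/measurableC; rewrite setCK.
Qed.

Lemma measurable_continuousC (f : C R -> R) : continuous f ->
  measurable_fun setT (f : borelC R -> R).
Proof.
move=> /continuousP cf; apply: (measurability _ (RGenOpens.measurableE R)).
move=> _ [_ [a [b ->] <-]]; rewrite setTI; apply: measurable_openC.
exact/cf/interval_open.
Qed.

Lemma Cmeasurable_id (D : set (borelC R)) : Cmeasurable D (fun z : borelC R => z : C R).
Proof.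
split; apply: (@measurable_funS _ _ _ _ setT) => //; apply: measurable_continuousC.
  exact: continuous_ReC.
exact: continuous_ImC.
Qed.

Lemma closed_circle : closed (@circle R).
Proof.
have -> : circle = @cabs R @^-1` [set 1] by [].
apply: closed_comp; first by move=> z _; exact: continuous_cabs.
exact: closed_eq.
Qed.

Lemma measurable_circle : measurable (@circle R : set (borelC R)).
Proof. by apply: measurable_closedC; exact: closed_circle. Qed.

Lemma continuous_cis : continuous (@cis R).
Proof.
move=> t; apply/cvgrPdist_lt => e e0.
have eR : e = (complex.Re e)%:C.
  by case: e e0 => a b; rewrite ltcE /= => /andP[/eqP-> _].
have e'0 : 0 < complex.Re e by move: e0; rewrite ltcE /= => /andP[].
rewrite eR; apply/nbhs_ballP; exists (complex.Re e) => //= s.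
rewrite /ball/= normCE ltcR; apply: le_lt_trans; exact: cabs_cisB_le.
Qed.

Lemma measurable_cis : measurable_fun setT (@cis R : R -> borelC R).
Proof.
apply: (@measurability _ _ _ (borelC R : measurableType _) setT (@cis R : R -> borelC R) (@open (C R))); first by [].
move=> _ [A oA <-]; rewrite setTI; apply: open_measurable.
by move/continuousP : continuous_cis; apply.
Qed.

Lemma Cmeasurable_cis (D : set R) : Cmeasurable D (@cis R).
Proof.
split => /=; apply: measurable_funS (@subsetT _ _) _ => //; apply: continuous_measurable_fun.
  exact: continuous_cos.
exact: continuous_sin.
Qed.

End BorelPlane.

(** * The Herglotz integral and the singular inner function *)

Section ComplexIntegral.
Context {R : realType}.
Variable mu : {finite_measure set (borelC R) -> \bar R}.
Implicit Types (D : set (borelC R)) (f g : C R -> C R).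

Lemma integrable_of_bounded D (g : C R -> R) (B : R) : measurable D ->
  measurable_fun D (g : borelC R -> R) -> (forall x, D x -> `|g x| <= B) ->
  mu.-integrable D (EFin \o g).
Proof.
move=> mD mg hB; apply: measurable_bounded_integrable => //.
  by rewrite ltey_eq fin_num_measure.
exists B; split; first exact: num_real.
by move=> x Bx y Ay; apply: le_trans (hB y Ay) _; exact: ltW.
Qed.

Definition bounded_Cmeasurable (D : set (borelC R)) (f : C R -> C R) :=
  Cmeasurable D (f : borelC R -> C R) /\ exists B, forall x, D x -> cabs (f x) <= B.

Lemma integrable_ReIm D f : measurable D -> bounded_Cmeasurable D f ->
  mu.-integrable D (fun x => (complex.Re (f x))%:E) /\
  mu.-integrable D (fun x => (complex.Im (f x))%:E).
Proof.
move=> mD [[m1 m2] [B hB]]; split; apply: (@integrable_of_bounded _ _ B) => // x Dx.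
  by rewrite (le_trans (ler_abs_Re _))// hB.
by rewrite (le_trans (ler_abs_Im _))// hB.
Qed.

Lemma bounded_CmeasurableD D f g : bounded_Cmeasurable D f -> bounded_Cmeasurable D g ->
  bounded_Cmeasurable D (fun x => f x + g x).
Proof.
move=> [mf [B hB]] [mg [B' hB']]; split; first exact: CmeasurableD.
by exists (B + B') => x Dx; rewrite (le_trans (cabsD _ _))// lerD ?hB ?hB'.
Qed.

Lemma bounded_CmeasurableZ D (c : C R) f : bounded_Cmeasurable D f ->
  bounded_Cmeasurable D (fun x => c * f x).
Proof.
move=> [mf [B hB]]; split; first exact: CmeasurableM (Cmeasurable_cst _ _) mf.
by exists (cabs c * B) => x Dx; rewrite cabsM ler_wpM2l ?cabs_ge0 ?hB.
Qed.

Lemma complex_integralD D f g : measurable D -> bounded_Cmeasurable D f ->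
  bounded_Cmeasurable D g ->
  complex_integral mu D (fun x => f x + g x) =
  complex_integral mu D f + complex_integral mu D g.
Proof.
move=> mD hf hg; have [f1 f2] := integrable_ReIm mD hf.
have [g1 g2] := integrable_ReIm mD hg.
apply: complex_ext; rewrite ?cReD ?cImD /complex_integral/=.
  by under eq_Rintegral do rewrite cReD; rewrite RintegralD.
by under eq_Rintegral do rewrite cImD; rewrite RintegralD.
Qed.

Lemma complex_integralZ D (c : C R) f : measurable D -> bounded_Cmeasurable D f ->
  complex_integral mu D (fun x => c * f x) = c * complex_integral mu D f.
Proof.
move=> mD hf; have [f1 f2] := integrable_ReIm mD hf.
have zl (k : R) (h : C R -> R) : mu.-integrable D (fun x => (h x)%:E) ->
    mu.-integrable D (fun x => (k * h x)%:E).
  move=> ih; under eq_fun do rewrite EFinM; exact: integrableZl.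
apply: complex_ext; rewrite ?cReM ?cImM /complex_integral/=.
  under eq_Rintegral do rewrite cReM.
  by rewrite RintegralB ?RintegralZl//; exact: zl.
under eq_Rintegral do rewrite cImM.
by rewrite RintegralD ?RintegralZl//; exact: zl.
Qed.

Lemma complex_integral_sum D n (f : nat -> C R -> C R) : measurable D ->
  (forall i, bounded_Cmeasurable D (f i)) ->
  bounded_Cmeasurable D (fun x => \sum_(i < n) f i x) /\
  complex_integral mu D (fun x => \sum_(i < n) f i x) =
  \sum_(i < n) complex_integral mu D (f i).
Proof.
move=> mD hf; elim: n => [|n [ih1 ih2]].
  split.
    under eq_fun do rewrite big_ord0; split; first exact: Cmeasurable_cst.
    by exists 0 => x _; rewrite cabs0.
  rewrite big_ord0 /complex_integral; under eq_Rintegral do rewrite big_ord0.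
  rewrite [X in _ +i* X]Rintegral_mkcond; under [X in _ +i* X]eq_Rintegral do rewrite /patch big_ord0 if_same.
  by rewrite Rintegral_cst ?mul0r// Rintegral_cst ?mul0r.
split.
  under eq_fun do rewrite big_ord_recr/=; exact: bounded_CmeasurableD.
rewrite big_ord_recr/= -ih2 -complex_integralD//.
by congr complex_integral; apply/funext => x; rewrite big_ord_recr.
Qed.

Lemma cabs_complex_integral D f B : measurable D ->
  bounded_Cmeasurable D f -> (forall x, D x -> cabs (f x) <= B) ->
  cabs (complex_integral mu D f) <= 2 * B * fine (mu D).
Proof.
move=> mD hf hB; have [f1 f2] := integrable_ReIm mD hf.
have h (g : C R -> R) : mu.-integrable D (fun x => (g x)%:E) ->
    (forall x, D x -> `|g x| <= B) -> `|\int[mu]_(x in D) g x| <= B * fine (mu D).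
  move=> ig gB; rewrite (le_trans (le_normr_Rintegral _ _))// -Rintegral_cst//.
  apply: le_Rintegral => //; first exact: integrable_norm.
  exact: finite_measure_integrable_cst.
rewrite (le_trans (cabs_le_ReIm _))//= -mulrA mulr_natl mulr2n.
rewrite lerD// h// => x Dx; last by rewrite (le_trans (ler_abs_Im _))// hB.
by rewrite (le_trans (ler_abs_Re _))// hB.
Qed.

End ComplexIntegral.

Section Herglotz.
Context {R : realType}.
Implicit Types (z w : C R).

Definition cayley w : C R := (1 + w) / (1 - w).

(** The geometric series. *)
Lemma cayley_analytic : disk_analytic cayley.
Proof.
move=> rho r1 e e0; wlog r0 : rho r1 / 0 <= rho.
  move=> hw; have [/hw|r0] := leP 0 rho; first exact.
  by exists 0 => z zr; have := cabs_ge0 z; move=> /le_trans/(_ zr); rewrite leNgt r0.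
have k0 : 0 < e * (1 - rho) / 2 by rewrite divr_gt0// mulr_gt0// subr_gt0.
have [n hn] : exists n : nat, rho ^+ n <= e * (1 - rho) / 2.
  have := @cvg_expr R rho; rewrite ger0_norm// => /(_ r1)/cvgrPdist_le/(_ _ k0)[n _ /(_ n)].
  by rewrite /= leqnn sub0r normrN ger0_norm ?exprn_ge0// => h; exists n; exact: h.
exists (2%:P * (\sum_(i < n) 'X^i) - 1) => z zr.
have z1 : 1 - z != 0.
  apply/eqP => /eqP; rewrite subr_eq0 => /eqP z1.
  by move: r1; rewrite ltNge (le_trans _ zr)// -z1 cabs1.
have -> : (2%:P * (\sum_(i < n) 'X^i) - 1).[z] = 2 * (\sum_(i < n) z ^+ i) - 1 :> C R.
  rewrite !hornerE horner_sum; congr (_ * _ - _); apply: eq_bigr => i _.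
  by rewrite hornerXn.
have -> : cayley z - (2 * (\sum_(i < n) z ^+ i) - 1) = 2 * z ^+ n / (1 - z).
  have := subrX1 z n; set s := \sum_(i < n) _ => hs.
  have -> : z ^+ n = 1 - (1 - z) * s by rewrite -[z - 1]opprB mulNr in hs; rewrite -[LHS](subrK 1) hs addrC.
  by rewrite /cayley; field.
rewrite !cabsM cabsV cabsX cabs_nat.
have h1 : 1 - rho <= cabs (1 - z).
  by rewrite (le_trans _ (cabs_subr _ _))// cabs1 lerD2l lerN2.
have h2 : cabs z ^+ n <= rho ^+ n by rewrite lerXn2r// nnegrE cabs_ge0.
rewrite ler_pdivrMr; last by rewrite (lt_le_trans _ h1)// subr_gt0.
rewrite (le_trans (ler_wpM2l _ (le_trans h2 hn)))//.
rewrite mulrCA divff// mulr1 ler_wpM2l// ltW//.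
Qed.

Lemma cabs_conjC z : cabs (conjc z) = cabs z.
Proof. by case: z => a b; rewrite !cabsE /= sqrrN. Qed.

Lemma circle_mul_conj z : circle z -> z * conjc z = 1.
Proof.
case: z => a b; rewrite /circle/= => h.
have : a ^+ 2 + b ^+ 2 = 1 by rewrite -(cabs_sqr (a +i* b : C R)) h expr1n.
move=> h'; apply: complex_ext; rewrite ?cReM ?cImM /=; nra.
Qed.

(** On the circle the Herglotz kernel is a function of [conjc zeta * z], so that
    expanding it in powers separates [zeta] from [z]. *)
Lemma herglotz_kernelE zeta z : circle zeta -> cabs z < 1 ->
  (zeta + z) / (zeta - z) = cayley (conjc zeta * z).
Proof.
move=> hz z1; rewrite /cayley.
have h1 : 1 = conjc zeta * zeta by rewrite mulrC circle_mul_conj.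
have c0 : conjc zeta != 0.
  by apply: contra_eq_neq h1 => ->; rewrite mul0r oner_neq0.
by rewrite {1 2}h1 -mulrDr -mulrBr invfM mulrACA divff// mul1r.
Qed.

Definition poisson (zeta z : C R) : R := (1 - cabs z ^+ 2) / cabs (zeta - z) ^+ 2.

Lemma cRe_div z w : complex.Re (z / w) =
  (complex.Re z * complex.Re w + complex.Im z * complex.Im w) / cabs w ^+ 2.
Proof.
have -> : w^-1 = (complex.Re w / cabs w ^+ 2) +i* (- (complex.Im w / cabs w ^+ 2)).
  by rewrite cabs_sqr; case: w.
by rewrite cReM /= mulrN opprK !mulrA -mulrDl.
Qed.

Lemma Re_herglotz zeta z : circle zeta -> cabs z < 1 ->
  complex.Re ((zeta + z) / (zeta - z)) = poisson zeta z.
Proof.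
move=> hz z1; rewrite /poisson; have := cabs_sqr zeta; rewrite hz => h.
have n0 : cabs (zeta - z) ^+ 2 != 0.
  rewrite expf_neq0// cabs_eq0 subr_eq0; apply: contraTneq z1 => <-.
  by rewrite hz ltxx.
rewrite cRe_div; apply/eqP; rewrite eqr_div//; apply/eqP; congr (_ * _).
move: h; rewrite expr1n cabs_sqr; case: zeta {hz n0} => a b; case: z {z1} => c d /= h.
by rewrite {1}h; ring.
Qed.

Variable mu : {finite_measure set (borelC R) -> \bar R}.

Definition herglotz (D : set (borelC R)) (z : C R) : C R :=
  complex_integral mu D (fun zeta => (zeta + z) / (zeta - z)).

Section OnCircle.
Variable D : set (borelC R).
Hypothesis mD : measurable D.
Hypothesis hD : D `<=` circle.

Let conj_bm k : bounded_Cmeasurable D (fun zeta : C R => conjc zeta ^+ k).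
Proof.
have mc : Cmeasurable D (fun z : borelC R => conjc (z : C R) : C R).
  have [m1 m2] := @Cmeasurable_id R D; split.
    by apply: eq_measurable_fun m1 => -[].
  by apply: eq_measurable_fun (measurable_funN m2) => -[].
split.
  by have := Cmeasurable_horner ('X^k) mc; under eq_fun do rewrite hornerXn.
by exists 1 => x /hD xc; rewrite cabsX cabs_conjC xc expr1n.
Qed.

Lemma herglotz_kernel_bm z : cabs z < 1 ->
  bounded_Cmeasurable D (fun zeta => (zeta + z) / (zeta - z)).
Proof.
move=> z1.
have hz zeta : D zeta -> cabs (conjc zeta * z) <= cabs z.
  by move=> /hD h; rewrite cabsM cabs_conjC h mul1r.
have [B hB] := poly_approx_bounded (cayley_analytic z1).
split; last first.
  by exists B => zeta Dz; rewrite herglotz_kernelE//; [exact/hB/hz|exact: hD].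
have := @Cmeasurable_analytic R _ (borelC R) D
  (fun zeta => conjc (zeta : C R) * z : C R) _ _ (cayley_analytic z1).
case => //.
  apply: CmeasurableM; last exact: Cmeasurable_cst.
  by have [+ _] := conj_bm 1; under eq_fun do rewrite expr1.
move=> m1 m2; split.
  by apply: eq_measurable_fun m1 => x /[!inE] Dx; rewrite herglotz_kernelE//; exact: hD.
by apply: eq_measurable_fun m2 => x /[!inE] Dx; rewrite herglotz_kernelE//; exact: hD.
Qed.

(** A polynomial approximation of the Cayley transform is integrated term by term. *)
Lemma herglotz_analytic : disk_analytic (herglotz D).
Proof.
move=> rho r1 e e0.
pose M := fine (mu D); have M0 : 0 <= M by rewrite fine_ge0.
have e'0 : 0 < e / (2 * M + 1) by rewrite divr_gt0// ltr_wpDl// mulr_ge0.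
have [q hq] := cayley_analytic r1 e'0.
exists (\poly_(i < size q) (q`_i * complex_integral mu D (fun zeta => conjc zeta ^+ i))) => z zr.
have z1 : cabs z < 1 := le_lt_trans zr r1.
pose f i (zeta : C R) : C R := (q`_i * z ^+ i) * conjc zeta ^+ i.
have bf i : bounded_Cmeasurable D (f i) by exact: bounded_CmeasurableZ.
have [bs es] := complex_integral_sum mu (size q) mD bf.
have -> : (\poly_(i < size q) (q`_i * complex_integral mu D (fun zeta => conjc zeta ^+ i))).[z]
    = complex_integral mu D (fun zeta => \sum_(i < size q) f i zeta).
  rewrite es horner_poly; apply: eq_bigr => i _.
  by rewrite complex_integralZ// mulrAC.
have bd := bounded_CmeasurableD (herglotz_kernel_bm z1) (bounded_CmeasurableZ (-1) bs).
have -> : herglotz D z - complex_integral mu D (fun zeta => \sum_(i < size q) f i zeta) =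
    complex_integral mu D (fun zeta => (zeta + z) / (zeta - z) + -1 * \sum_(i < size q) f i zeta).
  rewrite complex_integralD//; [|exact: herglotz_kernel_bm|exact: bounded_CmeasurableZ].
  by rewrite complex_integralZ// mulN1r.
rewrite (le_trans (@cabs_complex_integral _ _ _ _ (e / (2 * M + 1)) _ bd _))//.
  move=> zeta Dz; rewrite herglotz_kernelE//; last exact: hD.
  have -> : \sum_(i < size q) f i zeta = q.[conjc zeta * z].
    rewrite horner_coef; apply: eq_bigr => i _.
    by rewrite /f exprMn -mulrA [z ^+ _ * _]mulrC.
  rewrite mulN1r hq// cabsM cabs_conjC.
  by have -> : cabs zeta = 1 := hD Dz; rewrite mul1r.
rewrite -/M mulrAC mulrA ler_pdivrMr; first nra.
by rewrite ltr_wpDl// mulr_ge0.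
Qed.

Lemma herglotz0 : herglotz D 0 = (fine (mu D))%:C.
Proof.
rewrite /herglotz /complex_integral.
have h zeta : zeta \in D -> (zeta + 0) / (zeta - 0) = 1 :> C R.
  rewrite inE => /hD hz; rewrite addr0 subr0 divff// -cabs_eq0.
  by rewrite (_ : cabs zeta = 1) ?oner_neq0.
apply: complex_ext => /=.
  transitivity (\int[mu]_(x in D) (cst 1 x : R)); last by rewrite Rintegral_cst// mul1r.
  by apply: eq_Rintegral => x /h ->.
transitivity (\int[mu]_(x in D) (cst 0 x : R)); last by rewrite Rintegral_cst// mul0r.
by apply: eq_Rintegral => x /h ->.
Qed.

Lemma Re_herglotz_integral z : cabs z < 1 ->
  complex.Re (herglotz D z) = \int[mu]_(zeta in D) poisson zeta z.
Proof.
move=> z1; rewrite /herglotz /complex_integral /=; apply: eq_Rintegral => zeta.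
by rewrite inE => /hD hz; rewrite Re_herglotz.
Qed.

Lemma poisson_integrable z : cabs z < 1 ->
  mu.-integrable D (fun zeta => (poisson zeta z)%:E).
Proof.
move=> z1; have [+ _] := integrable_ReIm mu mD (herglotz_kernel_bm z1).
apply: eq_integrable => // zeta; rewrite inE => /hD hz.
by rewrite Re_herglotz.
Qed.

Lemma poisson_ge0 zeta z : cabs z < 1 -> 0 <= poisson zeta z.
Proof.
move=> z1; rewrite divr_ge0 ?sqr_ge0// subr_ge0 expr_le1// ?cabs_ge0//.
exact: ltW.
Qed.

Lemma Re_herglotz_ge0 z : cabs z < 1 -> 0 <= complex.Re (herglotz D z).
Proof.
by move=> z1; rewrite Re_herglotz_integral//; apply: Rintegral_ge0 => *; exact: poisson_ge0.
Qed.

Lemma Re_herglotz_le z w k : cabs z < 1 -> cabs w < 1 ->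
  (forall zeta, D zeta -> poisson zeta z <= k * poisson zeta w) ->
  complex.Re (herglotz D z) <= k * complex.Re (herglotz D w).
Proof.
move=> z1 w1 h; rewrite !Re_herglotz_integral//.
rewrite -RintegralZl//; last exact: poisson_integrable.
apply: le_Rintegral => //; first exact: poisson_integrable.
exact: (integrableZl mD k (poisson_integrable w1)).
Qed.

End OnCircle.
End Herglotz.

(** * Exponentials of locally uniform limits of polynomials *)

Section CexpAnalytic.
Context {R : realType}.
Implicit Types (z w a b : C R) (x y B : R).

Lemma expR_quadratic x : `|x| <= 1 / 2 -> `|expR x - 1 - x| <= 2 * x ^+ 2.
Proof.
rewrite ler_norml => /andP[x1 x2].
have h1 := expR_ge1Dx x; have h2 := expR_ge1Dx (- x).
have e0 := expR_gt0 x.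
have : expR x * (1 - x) <= 1 by rewrite -[leRHS](expRxMexpNx_1 x) ler_pM2l.
move=> h3; rewrite ler_norml; apply/andP; split; first nra.
rewrite leNgt; apply/negP => h4.
have : 0 < (expR x - 1 - x - 2 * x ^+ 2) * (1 - x) by apply: mulr_gt0; lra.
have := sqr_ge0 x; nra.
Qed.

Lemma sin_quadratic y : `|y| <= 1 -> `|sin y - y| <= y ^+ 2 / 2.
Proof.
wlog y0 : y / 0 <= y => [hw|].
  have [/hw//|y0] := leP 0 y.
  have := hw (- y); rewrite oppr_ge0 normrN sinN -opprD normrN sqrrN.
  by apply; exact: ltW.
rewrite ger0_norm// => y1.
have [->|yn0] := eqVneq y 0; first by rewrite sin0 subrr normr0 expr0n mul0r.
have yp : 0 < y by rewrite lt_def yn0.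
have [c /[!in_itv]/= /andP[c0 c1]] :=
  @MVT R sin cos 0 y yp (fun t _ => is_derive_sin t)
  (continuous_subspaceT (@continuous_sin R)).
rewrite sin0 !subr0 => ->.
have := cos_ge1Bsqr c; have := cos_le1 c => h1 h2.
have h3 : c ^+ 2 <= y by rewrite expr2; nra.
rewrite ler_norml; apply/andP; split; nra.
Qed.

Lemma cexp_quadratic w : cabs w <= 1 / 2 ->
  cabs (cexp w - (1 + w)) <= 4 * cabs w ^+ 2.
Proof.
move=> w1; have := ler_abs_Re w; have := ler_abs_Im w; rewrite cabs_sqr.
have := w1; case: w w1 => x y /= _ w1 hy hx.
have hx1 : `|x| <= 1 / 2 by exact: le_trans hx w1.
have hy1 : `|y| <= 1 by rewrite (le_trans hy)// (le_trans w1)//; lra.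
have e0 := expR_gt0 x.
have e1 := expR_quadratic hx1.
have s1 := sin_quadratic hy1.
have c1 := cos_ge1Bsqr y; have c2 := cos_le1 y.
rewrite (le_trans (cabs_le_ReIm _))// cReB cImB cReD cImD /cexp /=.
have hsin := ler_norm_sin y.
have e2 : expR x <= 2.
  move: e1 hx1; rewrite !ler_norml => /andP[_ e1] /andP[h1 h2]; nra.
have hRe : `|expR x * cos y - (1 + x)| <= y ^+ 2 + 2 * x ^+ 2.
  have -> : expR x * cos y - (1 + x) = expR x * (cos y - 1) + (expR x - 1 - x) by ring.
  rewrite (le_trans (ler_normD _ _))// lerD//.
  rewrite normrM (ger0_norm (ltW e0)) (_ : y ^+ 2 = 2 * (y ^+ 2 / 2)); last by field.
  have y2 := sqr_ge0 y; rewrite ler_pM// ler_norml; apply/andP; split; lra.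
have hIm : `|expR x * sin y - (0 + y)| <= 2 * `|x| * `|y| + y ^+ 2 / 2.
  have -> : expR x * sin y - (0 + y) = (expR x - 1) * sin y + (sin y - y) by ring.
  rewrite (le_trans (ler_normD _ _))// lerD// normrM ler_pM//.
  rewrite -(subrK x (expR x - 1)) (le_trans (ler_normD _ _))//.
  rewrite (le_trans (lerD e1 (lexx _)))// -(real_normK (num_real x)).
  have := normr_ge0 x; nra.
rewrite (le_trans (lerD hRe hIm))//.
have := real_normK (num_real x); have := real_normK (num_real y).
set X := `|x|; set Y := `|y| => hY hX.
rewrite -hY -hX; have := sqr_ge0 (X - Y); rewrite sqrrB; nra.
Qed.

Lemma cabs_subrXX a b (M : R) n : cabs a <= M -> cabs b <= M ->
  cabs (a ^+ n.+1 - b ^+ n.+1) <= n.+1%:R * M ^+ n * cabs (a - b).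
Proof.
move=> aM bM; rewrite subrXX cabsM mulrC ler_wpM2r ?cabs_ge0//.
rewrite (le_trans (cabs_sum _ _ _))//.
apply: (@le_trans _ _ (\sum_(i < n.+1) M ^+ n)); last first.
  by rewrite sumr_const card_ord mulr_natl.
apply: ler_sum => i _; rewrite cabsM !cabsX /=.
have hi : (i <= n)%N by rewrite -ltnS.
have M0 : 0 <= M := le_trans (cabs_ge0 a) aM.
rewrite -[in leRHS](subnK hi) exprD ler_pM ?exprn_ge0 ?cabs_ge0//.
  by rewrite lerXn2r// nnegrE cabs_ge0.
by rewrite lerXn2r// nnegrE cabs_ge0.
Qed.

Let step_bound w B n : cabs w <= B -> cabs (1 + w / n.+1%:R) <= expR (B / n.+1%:R).
Proof.
move=> wB; rewrite (le_trans (cabsD _ _))// cabs1 cabsM cabsV cabs_nat.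
by rewrite (le_trans _ (expR_ge1Dx _))// lerD2l ler_pM2r// invr_gt0.
Qed.

Let powM_le B n : 0 <= B -> expR (B / n.+1%:R) ^+ n <= expR B.
Proof.
move=> B0; rewrite -expRM_natr ler_expR -mulrA ler_piMr//.
by rewrite mulrC ler_pdivrMr ?ltr0n// mul1r ler_nat.
Qed.

(** Both terms are [n.+1]-th powers, of numbers that agree to second order. *)
Lemma cexp_approx w B n : cabs w <= B -> 2 * B <= n.+1%:R ->
  cabs (cexp w - (1 + w / n.+1%:R) ^+ n.+1) <= 4 * B ^+ 2 * expR B / n.+1%:R.
Proof.
move=> wB nB; have B0 := le_trans (cabs_ge0 w) wB.
have n0 : 0 < n.+1%:R :> R by rewrite ltr0n.
have nn0 : n.+1%:R != 0 :> C R by rewrite pnatr_eq0.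
have cw : cabs (w / n.+1%:R) = cabs w / n.+1%:R by rewrite cabsM cabsV cabs_nat.
have cwB : cabs (w / n.+1%:R) <= B / n.+1%:R by rewrite cw ler_pM2r ?invr_gt0.
rewrite -[in cexp w](divfK nn0 w) mulrC cexpMn.
rewrite (le_trans (@cabs_subrXX _ _ (expR (B / n.+1%:R)) _ _ _))//.
- rewrite cabs_cexp ler_expR (le_trans (ler_norm _))//.
  by rewrite (le_trans (ler_abs_Re _)).
- exact: step_bound.
have h : cabs (cexp (w / n.+1%:R) - (1 + w / n.+1%:R)) <= 4 * (B / n.+1%:R) ^+ 2.
  rewrite (le_trans (cexp_quadratic _))//.
    by rewrite (le_trans cwB)// ler_pdivrMr//; lra.
  by rewrite ler_pM2l// lerXn2r// nnegrE ?cabs_ge0// divr_ge0.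
apply: (@le_trans _ _ (n.+1%:R * expR B * (4 * (B / n.+1%:R) ^+ 2))).
  rewrite ler_pM ?cabs_ge0//.
  by rewrite ler_pM2l// powM_le.
by rewrite le_eqVlt; apply/orP; left; apply/eqP; field; rewrite gt_eqF.
Qed.

(** [(1 + q / n) ^ n] is a polynomial when [q] is one. *)
Lemma cexp_analytic (F : C R -> C R) : disk_analytic F ->
  disk_analytic (fun z => cexp (F z)).
Proof.
move=> hF rho r1 e e0.
have [B hB] := poly_approx_bounded (hF _ r1).
pose B1 := `|B| + 1.
have B1p : 0 < B1 by rewrite ltr_wpDl.
have E0 := expR_gt0 B1.
pose K := 4 * B1 ^+ 2 * expR B1.
have K0 : 0 <= K by rewrite !mulr_ge0 ?exprn_ge0 ?expR_ge0// ltW.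
pose n := Num.truncn (Num.max (2 * B1) (2 * K / e)).
have [n1 n2] : 2 * B1 <= n.+1%:R /\ 2 * K / e <= n.+1%:R.
  have /ltW := truncnS_gt (Num.max (2 * B1) (2 * K / e)).
  by rewrite -/n ge_max => /andP[].
have n0 : 0 < n.+1%:R :> R by rewrite ltr0n.
pose e' := Num.min 1 (e / (2 * expR B1)).
have e'0 : 0 < e' by rewrite lt_min ltr01 divr_gt0// mulr_gt0.
have [q hq] := hF _ r1 _ e'0.
exists ((1 + (n.+1%:R^-1)%:P * q) ^+ n.+1) => z zr.
have -> : ((1 + (n.+1%:R^-1)%:P * q) ^+ n.+1).[z] = (1 + q.[z] / n.+1%:R) ^+ n.+1 :> C R.
  by rewrite horner_exp !hornerE mulrC.
have FB : cabs (F z) <= B1 by rewrite (le_trans (hB z zr))// (le_trans (ler_norm B))// lerDl.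
have qF := hq z zr.
have qB : cabs q.[z] <= B1.
  rewrite -[q.[z]](subrK (F z)) (le_trans (cabsD _ _))// cabsB addrC lerD//.
    by rewrite (le_trans (hB z zr))// ler_norm.
  by rewrite (le_trans qF)// ge_min lexx.
rewrite (le_trans (cabs_dist _ _ ((1 + F z / n.+1%:R) ^+ n.+1)))//.
have -> : e = e / 2 + e / 2 by field.
apply: lerD.
  rewrite (le_trans (cexp_approx FB n1))// -/K ler_pdivrMr//.
  by move: n2; rewrite ler_pdivrMr//; lra.
rewrite (le_trans (cabs_subrXX _ (step_bound _ FB) (step_bound _ qB)))//.
have -> : 1 + F z / n.+1%:R - (1 + q.[z] / n.+1%:R) = (F z - q.[z]) / n.+1%:R :> C R by ring.
rewrite cabsM cabsV cabs_nat [leLHS]mulrC -!mulrA mulKf ?gt_eqF// mulrC.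
rewrite (le_trans (ler_pM _ _ (powM_le _ (ltW B1p)) qF)) ?cabs_ge0 ?exprn_ge0 ?expR_ge0//.
have : e' <= e / (2 * expR B1) by rewrite ge_min lexx orbT.
by rewrite ler_pdivlMr ?mulr_gt0//; lra.
Qed.

Lemma analyticN (F : C R -> C R) : disk_analytic F -> disk_analytic (fun z => - F z).
Proof.
move=> hF rho r1 e e0; have [q hq] := hF _ r1 _ e0; exists (- q) => z zr.
by rewrite hornerN -opprD cabsN hq.
Qed.

Variable mu : {finite_measure set (borelC R) -> \bar R}.

Lemma singular_inner_analytic : disk_analytic (singular_inner mu).
Proof.
by apply/cexp_analytic/analyticN; apply: herglotz_analytic => //; exact: measurable_circle.
Qed.

Definition poisson_integral (z : C R) : R := complex.Re (herglotz mu circle z).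

Lemma cabs_singular_inner z : cabs (singular_inner mu z) = expR (- poisson_integral z).
Proof. by rewrite cabs_cexp /poisson_integral /herglotz; case: complex_integral. Qed.

End CexpAnalytic.

(** * Size of the Poisson integral *)

Section Harnack.
Context {R : realType}.
Implicit Types (z w zeta : C R).

Lemma dist_circle zeta z : circle zeta -> 1 - cabs z <= cabs (zeta - z).
Proof. by move=> h; rewrite (le_trans _ (cabs_subr _ _))// h. Qed.

(** Moving [z] by a bounded multiple of its distance to the circle changes
    [|zeta - z|] by a bounded factor. *)
Lemma poisson_compare zeta z w A m : circle zeta -> cabs z < 1 -> cabs w < 1 ->
  0 <= A -> 0 <= m -> cabs (z - w) <= A * (1 - cabs z) ->
  1 - cabs z <= m * (1 - cabs w) ->
  poisson zeta z <= 2 * (1 + A) ^+ 2 * m * poisson zeta w.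
Proof.
move=> hz z1 w1 A0 m0 hA hm; rewrite /poisson.
have dz := dist_circle z hz; have dw := dist_circle w hz.
have z0 := cabs_ge0 z; have w0 := cabs_ge0 w.
have dz0 : 0 < cabs (zeta - z) by rewrite (lt_le_trans _ dz)// subr_gt0.
have dw0 : 0 < cabs (zeta - w) by rewrite (lt_le_trans _ dw)// subr_gt0.
rewrite ler_pdivrMr ?exprn_gt0// mulrAC mulrA ler_pdivlMr ?exprn_gt0//.
have h1 : 1 - cabs z ^+ 2 <= 2 * m * (1 - cabs w ^+ 2).
  have : 0 <= m * (1 - cabs w) * cabs w by rewrite mulr_ge0// mulr_ge0// subr_ge0 ltW.
  nra.
have h2 : cabs (zeta - w) ^+ 2 <= ((1 + A) * cabs (zeta - z)) ^+ 2.
  rewrite lerXn2r ?nnegrE ?mulr_ge0 ?addr_ge0 ?cabs_ge0//.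
  rewrite (le_trans (cabs_dist _ _ z))// mulrDl mul1r lerD2l (le_trans hA)//.
  by rewrite ler_wpM2l.
have -> : 2 * (1 + A) ^+ 2 * m * cabs (zeta - z) ^+ 2 * (1 - cabs w ^+ 2) =
  (2 * m * (1 - cabs w ^+ 2)) * ((1 + A) * cabs (zeta - z)) ^+ 2 by ring.
apply: ler_pM => //; rewrite ?exprn_ge0 ?cabs_ge0//.
by rewrite subr_ge0 expr_le1// ltW.
Qed.

Variable mu : {finite_measure set (borelC R) -> \bar R}.
Local Notation u := (poisson_integral mu).

Lemma poisson_integral_ge0 z : cabs z < 1 -> 0 <= u z.
Proof. by apply: Re_herglotz_ge0 => //; exact: measurable_circle. Qed.

Lemma harnack z w A m : cabs z < 1 -> cabs w < 1 ->
  0 <= A -> 0 <= m -> cabs (z - w) <= A * (1 - cabs z) ->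
  1 - cabs z <= m * (1 - cabs w) ->
  u z <= 2 * (1 + A) ^+ 2 * m * u w.
Proof.
move=> *; apply: Re_herglotz_le => //; first exact: measurable_circle.
by move=> zeta hz; exact: poisson_compare.
Qed.

Lemma poisson_integral_split (B : set (borelC R)) z : measurable B -> B `<=` circle ->
  cabs z < 1 ->
  u z = complex.Re (herglotz mu B z) + complex.Re (herglotz mu (circle `\` B) z).
Proof.
move=> mB Bc z1; have mcirc := @measurable_circle R.
have mBc : measurable (circle `\` B : set (borelC R)) by exact: measurableD.
rewrite /poisson_integral !Re_herglotz_integral//.
rewrite -Rintegral_setU//.
- by rewrite setDUK.
- by rewrite setDUK//; exact: poisson_integrable.
- by apply/disj_setPS => x [? []].
Qed.

Lemma poisson_integral_ge (B : set (borelC R)) z k : measurable B -> B `<=` circle ->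
  cabs z < 1 -> (forall zeta, B zeta -> k <= poisson zeta z) ->
  k * fine (mu B) <= u z.
Proof.
move=> mB Bc z1 hk; rewrite (poisson_integral_split mB Bc z1).
rewrite -[leLHS]addr0 lerD//; last first.
  exact: Re_herglotz_ge0.
rewrite Re_herglotz_integral// -Rintegral_cst//.
apply: le_Rintegral => //; first exact: finite_measure_integrable_cst.
exact: poisson_integrable.
Qed.

Lemma Re_herglotz_far (B : set (borelC R)) z k : measurable B -> B `<=` circle ->
  cabs z < 1 -> (forall zeta, B zeta -> poisson zeta z <= k) ->
  complex.Re (herglotz mu B z) <= k * fine (mu B).
Proof.
move=> mB Bc z1 hk; rewrite Re_herglotz_integral// -Rintegral_cst//.
apply: le_Rintegral => //; first exact: poisson_integrable.
exact: finite_measure_integrable_cst.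
Qed.

End Harnack.

(** * A sub-mean value inequality in polar coordinates *)

Section NonMeasurableMonotone.
Local Open Scope ereal_scope.
Context d (T : measurableType d) (R : realType) (m : {measure set T -> \bar R}).

(** Integrals of nonnegative functions are suprema over simple functions below,
    so that monotonicity holds without measurability. *)
Lemma le_integral_ge0 (D1 D2 : set T) (f g : T -> \bar R) :
  (forall x, D1 x -> 0 <= f x) -> (forall x, D2 x -> 0 <= g x) ->
  (forall x, D1 x -> 0 < f x -> D2 x /\ f x <= g x) ->
  \int[m]_(x in D1) f x <= \int[m]_(x in D2) g x.
Proof.
move=> f0 g0 fg; rewrite !ge0_integralE//.
have g0' x : 0 <= (g \_ D2) x by exact: erestrict_ge0.
apply: le_ereal_sup => _ [h /= hf <-]; exists h => //= x.
apply: le_trans (hf x) _; rewrite {1}/patch; case: ifPn => [|_]; last exact: g0'.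
rewrite inE => D1x; have [fx0|/(fg x D1x)[D2x fgx]] := leP (f x) 0.
  exact: le_trans fx0 (g0' x).
by rewrite /patch ifT ?inE.
Qed.

End NonMeasurableMonotone.

Lemma integral_cst_square (R : realType) (a b e v : R) : 0 <= e ->
  (\int[@lebesgue_measure R \x @lebesgue_measure R]_(w in
    `[a, (a + e)%R]%classic `*` `[b, (b + e)%R]%classic) (cst v%:E w) = (v * e ^+ 2)%R%:E)%E.
Proof.
move=> e0; rewrite integral_cst; last by apply: measurableX; exact: measurable_itv.
transitivity (v%:E * (@lebesgue_measure R `[a, (a + e)%R]%classic *
    @lebesgue_measure R `[b, (b + e)%R]%classic))%E.
  by congr (_ * _)%E; apply: product_measure1E; exact: measurable_itv.
have len (c : R) : @lebesgue_measure R `[c, (c + e)%R]%classic = e%:E.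
  rewrite lebesgue_measure_itv/= lte_fin ltrDl -EFinD addrAC subrr add0r.
  by case: ltgtP e0 => // <-.
by rewrite !len -!EFinM expr2.
Qed.

Section SubMean.
Context {R : realType}.
Implicit Types (z w : C R).

Lemma polar_form z : exists2 t : R, 0 <= t < 2 * pi & z = ((cabs z)%:C : C R) * cis t.
Proof.
have [->|z0] := eqVneq z 0.
  by exists 0; rewrite ?cabs0 ?mul0r// lexx mulr_gt0// pi_gt0.
have cz : cabs z != 0 by rewrite cabs_eq0.
have czC : (cabs z)%:C != 0 :> C R by apply: contra cz => /eqP[->].
have [|t t2 e] := @cis_surj R (z / (cabs z)%:C).
  by rewrite cabsM cabsV cabs_real ger0_norm ?cabs_ge0// divff.
by exists t => //; rewrite -e mulrCA divff// mulr1.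
Qed.

Definition polar (w : R * R) : C R := (w.1%:C : C R) * cis w.2.

Lemma polar_dist (r r' t t' : R) : 0 <= r' <= 1 ->
  cabs (polar (r, t) - polar (r', t')) <= `|r - r'| + `|t - t'|.
Proof.
move=> /andP[r0 r1]; rewrite (le_trans (cabs_dist _ _ (polar (r', t))))//.
rewrite /polar/= lerD//.
  by rewrite -mulrBl cabsM cabs_cis mulr1 -(rmorphB (real_complex R)) cabs_real.
rewrite -mulrBr cabsM cabs_real ger0_norm//.
rewrite (le_trans (ler_piMl _ r1)) ?cabs_ge0//; exact: cabs_cisB_le.
Qed.

Variable p : R.
Hypothesis p01 : 0 < p < 1.
Variable L : C R -> C R.
Hypothesis hL : disk_analytic L.

Let p0 : 0 < p. Proof. by case/andP: p01. Qed.

(** Chosen so that Cauchy's estimate with the bound [8 `^ p^-1 * |L z1|] on a half disk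
    gives an oscillation of at most [|L z1| / 2]. *)
Definition osc_radius : R := (8 * 8 `^ p^-1)^-1.

Let k8_ge1 : 1 <= (8 : R) `^ p^-1.
Proof. by rewrite -[leLHS](@powRr0 R 8) ler_powR// ?ler1n// invr_ge0 ltW. Qed.

Lemma osc_radius_gt0 : 0 < osc_radius.
Proof. by rewrite invr_gt0 mulr_gt0// powR_gt0. Qed.

Lemma osc_radius_le : osc_radius <= 1 / 8.
Proof.
rewrite /osc_radius div1r lef_pV2 ?posrE// ?mulr_gt0 ?powR_gt0//.
by rewrite ler_peMr.
Qed.

(** At a near-maximum of [(delta - |z - z0|)^2 |L z|^p] the modulus of [L] cannot
    be much larger nearby, so by Cauchy's estimate it cannot drop quickly. *)
Lemma near_maximum z0 (delta : R) : 0 < delta -> cabs z0 + delta < 1 ->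
  exists z1, let d1 := delta - cabs (z1 - z0) in
  [/\ 0 < d1, delta ^+ 2 * cabs (L z0) `^ p <= 2 * (d1 ^+ 2 * cabs (L z1) `^ p) &
      forall w, cabs w <= osc_radius * d1 -> cabs (L z1) / 2 <= cabs (L (z1 + w))].
Proof.
move=> d0 zd; have k0 := osc_radius_gt0; have k1 := osc_radius_le.
have [Lz0|Lz0] := eqVneq (cabs (L z0)) 0.
  exists z0 => /=; rewrite subrr cabs0 subr0 Lz0 powR0 ?gt_eqF// !mulr0 mul0r.
  by split=> // w _; exact: cabs_ge0.
have Lz0' : 0 < cabs (L z0) by rewrite lt_def Lz0 cabs_ge0.
have [B hB] := poly_approx_bounded (hL zd).
have hin z : cabs (z - z0) <= delta -> cabs z <= cabs z0 + delta.
  by move=> h; rewrite -[z](subrK z0) addrC (le_trans (cabsD _ _))// lerD2l.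
pose psi z := (delta - cabs (z - z0)) ^+ 2 * cabs (L z) `^ p.
pose A := [set psi z | z in [set z | cabs (z - z0) <= delta]].
have A0 : A (psi z0) by exists z0 => //=; rewrite subrr cabs0 ltW.
have sA : has_sup A.
  split; first by exists (psi z0).
  exists (delta ^+ 2 * B `^ p) => _ [z /= zz <-].
  apply: ler_pM; rewrite ?sqr_ge0 ?powR_ge0//.
    by rewrite lerXn2r ?nnegrE ?subr_ge0 ?(ltW d0)// lerBlDr lerDl cabs_ge0.
  by apply: ge0_ler_powR; rewrite ?nnegrE ?cabs_ge0 ?(ltW p0)//;
    rewrite ?(le_trans (cabs_ge0 (L z)))// hB// hin.
have psi0 : 0 < psi z0.
  by rewrite /psi subrr cabs0 subr0 mulr_gt0 ?exprn_gt0// powR_gt0.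
have M0 : 0 < sup A by rewrite (lt_le_trans psi0)// ub_le_sup//; exact: sA.2.
have [_ [z1 /= z1d <-] hz1] : exists2 x, A x & sup A / 2 < x.
  have := sup_adherent (divr_gt0 M0 (ltr0n _ 2)) sA.
  by case=> x Ax hx; exists x => //; move: hx; lra.
have hsup z : cabs (z - z0) <= delta -> psi z <= 2 * psi z1.
  move=> h; have : psi z <= sup A by rewrite ub_le_sup//; [exact: sA.2|exists z].
  by move: hz1; lra.
have psi1 : 0 < psi z1 by rewrite (le_lt_trans _ hz1)// divr_ge0// ltW.
set d1 := delta - cabs (z1 - z0).
have d10 : 0 < d1.
  rewrite lt_def subr_ge0 z1d andbT; apply: contraTneq psi1 => e.
  by rewrite /psi -/d1 e expr0n mul0r ltxx.
have Lz1 : 0 < cabs (L z1).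
  rewrite lt_def cabs_ge0 andbT; apply: contraTneq psi1 => e.
  by rewrite /psi e powR0 ?gt_eqF// mulr0 ltxx.
exists z1; split=> //.
  by have := hsup z0; rewrite /psi subrr cabs0 subr0; apply; exact: ltW.
pose B1 := 8 `^ p^-1 * cabs (L z1).
have hB1 w : cabs w <= d1 / 2 -> cabs (L (z1 + w)) <= B1.
  move=> wd; set y := cabs _.
  have hyd : d1 / 2 <= delta - cabs (z1 + w - z0).
    have := cabsD (z1 - z0) w; rewrite addrAC /d1.
    by move: wd; rewrite /d1; lra.
  have := hsup (z1 + w); rewrite /psi -/y -/d1 => /(_ _)h.
  have {}h : y `^ p <= 8 * cabs (L z1) `^ p.
    have h1 : (d1 / 2) ^+ 2 * y `^ p <= 2 * (d1 ^+ 2 * cabs (L z1) `^ p).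
      apply: le_trans (h _); last by move: hyd d10; lra.
      apply: ler_wpM2r; first exact: powR_ge0.
      by apply: lerXn2r => //; rewrite nnegrE; move: hyd d10; lra.
    have d2 : 0 < (d1 / 2) ^+ 2 by rewrite exprn_gt0// divr_gt0.
    rewrite -(ler_pM2l d2) (le_trans h1)// le_eqVlt; apply/orP; left; apply/eqP.
    by field.
  have y0 : 0 <= y := cabs_ge0 _.
  have -> : y = (y `^ p) `^ p^-1 by rewrite -powRrM divff ?gt_eqF// powRr1.
  have -> : B1 = (8 * cabs (L z1) `^ p) `^ p^-1.
    rewrite powRM ?powR_ge0// -powRrM divff ?gt_eqF// powRr1//; exact: ltW.
  by apply: ge0_ler_powR; rewrite ?nnegrE ?powR_ge0 ?invr_ge0 ?(ltW p0)// mulr_ge0// powR_ge0.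
move=> w wk.
have d12 : 0 < d1 / 2 by rewrite divr_gt0.
have hdom : cabs z1 + d1 / 2 <= cabs z0 + delta.
  have := cabsD (z1 - z0) z0; rewrite subrK; move: d10; rewrite /d1; lra.
have wd4 : cabs w <= d1 / 2 / 2.
  rewrite (le_trans wk)// (le_trans (ler_wpM2r (ltW d10) k1))//.
  by move: d10; lra.
have := poly_approx_lipschitz d12 hdom (hL zd) hB1 wd4.
have hkey : 2 * B1 * (cabs w / (d1 / 2)) <= cabs (L z1) / 2.
  have : cabs w / (d1 / 2) <= 2 * osc_radius.
    rewrite ler_pdivrMr// (_ : 2 * osc_radius * (d1 / 2) = osc_radius * d1)//.
    by field.
  move=> h; apply: (@le_trans _ _ (2 * B1 * (2 * osc_radius))).
    by rewrite ler_wpM2l// mulr_ge0// mulr_ge0 ?powR_ge0// ltW.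
  rewrite /B1 /osc_radius le_eqVlt; apply/orP; left; apply/eqP.
  by field; rewrite gt_eqF// powR_gt0.
move=> h; have := cabs_subr (L z1) (L (z1 + w)); rewrite cabsB.
by move: (le_trans h hkey); lra.
Qed.

Definition polar_box z0 (delta : R) : set (R * R) :=
  [set w | [/\ 0 <= w.1, 0 <= w.2 <= 2 * pi & cabs (polar w - z0) <= delta]].

Local Notation lam2 := (@lebesgue_measure R \x @lebesgue_measure R)%E.

Definition submean_const : R := 16 / osc_radius ^+ 2.

(** The integral over a polar box around a near-maximum is already large enough, since
    there [|L|] keeps half of its value. *)
Lemma submean z0 (delta : R) : 0 < delta -> cabs z0 + delta < 1 ->
  ((delta ^+ 2 * cabs (L z0) `^ p)%:E <=
   submean_const%:E * \int[lam2]_(w in polar_box z0 delta) (cabs (L (polar w)) `^ p)%:E)%E.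
Proof.
move=> d0 zd; have [z1 /= [d1_gt0 h1 h2]] := near_maximum d0 zd.
have k0 := osc_radius_gt0; have k1 := osc_radius_le.
have pi2 := @pi_ge2 R.
set d1 := delta - cabs (z1 - z0) in d1_gt0 h1 h2.
pose e := osc_radius * d1 / 2.
have e0 : 0 < e by rewrite divr_gt0// mulr_gt0.
have z10 := cabs_ge0 (z1 - z0); have z00 := cabs_ge0 z0; have z11 := cabs_ge0 z1.
have ed : 2 * e = osc_radius * d1 by rewrite /e; field.
have ed1 : 2 * e <= d1 / 8.
  by rewrite ed (le_trans (ler_wpM2r (ltW d1_gt0) k1))//; lra.
have z1_le1 : cabs z1 <= 1.
  have := cabsD (z1 - z0) z0; rewrite subrK; move: d1_gt0; rewrite /d1; lra.
have e1 : e <= 1 by move: ed1 z10 z00; rewrite /d1; lra.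
have [t1 /andP[t10 t12] z1E] := polar_form z1.
pose a := Num.min t1 (2 * pi - e).
have a0 : 0 <= a by rewrite le_min t10/=; lra.
have a1 : a <= t1 by rewrite ge_min lexx.
have a2 : a + e <= 2 * pi by rewrite -lerBrDr ge_min lexx orbT.
have a3 : t1 <= a + e.
  by rewrite /a; case: (leP t1 (2 * pi - e)) => _; lra.
pose Q : set (R * R) := `[cabs z1, cabs z1 + e] `*` `[a, a + e].
pose v := (cabs (L z1) / 2) `^ p.
have v0 : 0 <= v by exact: powR_ge0.
have mQ : measurable Q by apply: measurableX; exact: measurable_itv.
have QL (w : R * R) : Q w -> polar_box z0 delta w /\ v <= cabs (L (polar w)) `^ p.
  case: w => r t [/=]; rewrite !in_itv/= => /andP[r1 r2] /andP[ta te].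
  have hd : cabs (polar (r, t) - z1) <= osc_radius * d1.
    rewrite z1E -[_ * cis t1]/(polar (cabs z1, t1)).
    apply: (@le_trans _ _ (`|r - cabs z1| + `|t - t1|)).
      by apply: polar_dist; rewrite z1_le1 andbT cabs_ge0.
    rewrite -ed.
    have n1 : `|r - cabs z1| <= e by rewrite ler_norml; apply/andP; split; lra.
    have n2 : `|t - t1| <= e by rewrite ler_norml; apply/andP; split; lra.
    lra.
  split.
    split => /=; [lra|by apply/andP; split; lra|].
    have := cabs_dist (polar (r, t)) z0 z1.
    by move: hd ed1; rewrite -ed /d1; lra.
  have := h2 _ hd; rewrite addrC subrK => h.
  apply: ge0_ler_powR; rewrite ?nnegrE ?cabs_ge0 ?divr_ge0 ?cabs_ge0 ?(ltW p0)//.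
have key : ((v * e ^+ 2)%:E <=
    \int[lam2]_(w in polar_box z0 delta) (cabs (L (polar w)) `^ p)%:E)%E.
  have -> : ((v * e ^+ 2)%:E = \int[lam2]_(w in Q) (cst v%:E w))%E.
    by rewrite integral_cst_square// ltW.
  apply: le_integral_ge0 => w /=.
  - by move=> _; rewrite lee_fin.
  - by move=> _; rewrite lee_fin powR_ge0.
  - by move=> /QL[? ?] _; rewrite lee_fin.
apply: (@le_trans _ _ (submean_const%:E * (v * e ^+ 2)%:E)%E); last first.
  by rewrite lee_wpmul2l// lee_fin divr_ge0 ?sqr_ge0.
rewrite -EFinM lee_fin (le_trans h1)//.
have hv : cabs (L z1) `^ p <= 2 * v.
  rewrite /v powRM ?cabs_ge0 ?invr_ge0// mulrCA ler_peMr ?powR_ge0//.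
  have : (2^-1 : R) <= 2^-1 `^ p.
    by rewrite ger1_powR//; [apply/andP; split; lra|case/andP: p01 => _ /ltW].
  lra.
apply: (@le_trans _ _ (4 * d1 ^+ 2 * v)).
  have : 0 <= d1 ^+ 2 by exact: sqr_ge0.
  by move: hv; nra.
rewrite /submean_const /e le_eqVlt; apply/orP; left; apply/eqP.
by field; rewrite gt_eqF.
Qed.

End SubMean.

(** * Radial increments in [L^p] means *)

Section ArcLength.
Context {R : realType}.
Local Notation lam := (@lebesgue_measure R).

Lemma lebesgue_measure_itvcc (a b : R) : a <= b -> lam `[a, b]%classic = (b - a)%:E.
Proof.
move=> ab; rewrite lebesgue_measure_itv/= lte_fin -EFinB.
by case: ltgtP ab => // -> _; rewrite subrr.
Qed.

(** Three intervals are needed because [0] and [2 * pi] are the same point of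
    the circle. *)
Lemma chord_arc_measure (t s : R) : 0 <= t <= 2 * pi -> 0 <= s ->
  (lam [set t0 | (0 <= t0 <= 2 * pi)%R /\ (cabs (cis t - cis t0) <= s)%R] <=
     (16 * s)%:E)%E.
Proof.
move=> /andP[t0 t2] s0.
pose I1 := `[t - 4 * s, t + 4 * s]%classic.
pose I2 := `[0, 4 * s]%classic : set R.
pose I3 := `[2 * pi - 4 * s, 2 * pi]%classic : set R.
apply: (@le_trans _ _ (lam (I1 `|` I2 `|` I3))).
  apply: le_outer_measure => x /= [/andP[x0 x2] h].
  have [d1|d1] := leP `|t - x| pi.
    left; left; rewrite /I1/= in_itv/=.
    have := cabs_cisB_ge d1 => /le_trans/(_ h) h1.
    have : `|t - x| <= 4 * s by lra.
    by rewrite ler_norml => /andP[? ?]; apply/andP; split; lra.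
  have [xt|xt] := leP x t.
    left; right; rewrite /I2/= in_itv/= x0/=.
    have e : cis (x + 2 * pi) = cis x by rewrite cisD cis_2pi mulr1.
    move: d1; rewrite ger0_norm ?subr_ge0// => d1.
    have d2 : `|t - (x + 2 * pi)| <= pi by rewrite ler_norml; apply/andP; split; lra.
    have := cabs_cisB_ge d2; rewrite e => /le_trans/(_ h).
    have := ler_norm (- (t - (x + 2 * pi))); rewrite normrN; lra.
  right; rewrite /I3/= in_itv/= x2 andbT.
  have e : cis (t + 2 * pi) = cis t by rewrite cisD cis_2pi mulr1.
  move: d1; rewrite ltr0_norm ?subr_lt0// => d1.
  have d2 : `|t + 2 * pi - x| <= pi by rewrite ler_norml; apply/andP; split; lra.
  have := cabs_cisB_ge d2; rewrite e => /le_trans/(_ h).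
  have := ler_norm (t + 2 * pi - x); lra.
have mI1 : measurable I1 by exact: measurable_itv.
have mI2 : measurable I2 by exact: measurable_itv.
have mI3 : measurable I3 by exact: measurable_itv.
apply: (@le_trans _ _ (lam I1 + lam I2 + lam I3)%E).
  apply: (le_trans (measureU2 _ _ _)) => //; first exact: measurableU.
  by apply: leeD => //; exact: measureU2.
rewrite !lebesgue_measure_itvcc; [|lra..].
rewrite -!EFinD lee_fin; lra.
Qed.

End ArcLength.

Lemma polar_segment (R : realType) (x y s t : R) :
  polar (x, t) + s%:C * (polar (y, t) - polar (x, t)) = polar (x + s * (y - x), t) :> C R.
Proof.
rewrite /polar /cis.
by apply: complex_ext; rewrite ?(cReD, cImD, cReM, cImM, cReB, cImB) /=; ring.
Qed.

Section Increments.
Context {R : realType}.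
Local Notation lam := (@lebesgue_measure R).
Local Notation lam2 := (@lebesgue_measure R \x @lebesgue_measure R)%E.
Variable p : R.
Hypothesis p01 : 0 < p < 1.
Variables S : C R -> C R.
Hypothesis hS : disk_analytic S.
Local Notation L := (derive1 S).
Variable K : R.
Hypothesis hK : forall r : R, 0 <= r < 1 ->
  (\int[lam]_(t in `[0%R, (2 * pi)%R]) (cabs (L (polar (r, t))) `^ p)%:E <= K%:E)%E.

Definition dyadic_radius (k : nat) : R := 1 - (1 / 2) ^+ k.

Let p0 : 0 < p. Proof. by case/andP: p01. Qed.

Let hL : disk_analytic L := disk_analytic_derive1 hS.

Let half_pow_gt0 k : 0 < (1 / 2 : R) ^+ k.
Proof. by rewrite exprn_gt0// divr_gt0. Qed.

Lemma cabs_polar r t : 0 <= r -> cabs (polar (r, t) : C R) = r.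
Proof. by move=> r0; rewrite /polar/= cabsM cabs_cis mulr1 cabs_real ger0_norm. Qed.

Variable j : nat.
Hypothesis j1 : (0 < j)%N.
Let dl : R := (1 / 2) ^+ j.+2.
Let a : R := dyadic_radius j - dl.
Let b : R := dyadic_radius j.+1 + dl.
Let W : set (R * R) := `[a, b]%classic `*` `[0, 2 * pi]%classic.
Let F (w : R * R) : R := cabs (L (polar w)) `^ p.

Let dl0 : 0 < dl. Proof. exact: half_pow_gt0. Qed.
Let hj : (1 / 2) ^+ j = 4 * dl. Proof. by rewrite /dl !exprS; set x := _ ^+ j; lra. Qed.
Let hj1 : (1 / 2) ^+ j.+1 = 2 * dl. Proof. by rewrite /dl !exprS; set x := _ ^+ j; lra. Qed.
Let aE : a = 1 - 5 * dl. Proof. by rewrite /a /dyadic_radius hj; ring. Qed.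
Let bE : b = 1 - dl. Proof. by rewrite /b /dyadic_radius hj1; ring. Qed.
Let dl8 : dl <= 1 / 8.
Proof.
have : (1 / 2 : R) ^+ j <= (1 / 2) ^+ 1 by apply: ler_wiXn2l => //; lra.
rewrite expr1 hj; lra.
Qed.

Let mW : measurable W.
Proof. by apply: measurableX; exact: measurable_itv. Qed.

Let mFW : measurable_fun setT (F \_ W).
Proof.
apply/(measurable_restrictT _ mW).
have mpol : Cmeasurable W (fun w : R * R => polar w).
  apply: CmeasurableM.
    by apply: Cmeasurable_real; exact: measurable_funS measurable_fst.
  split; apply: (@measurable_funS _ _ _ _ setT) => //=;
    apply: (@measurableT_comp _ _ _ _ _ _ _ _ snd) => //;
    apply: continuous_measurable_fun; [exact: continuous_cos|exact: continuous_sin].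
have b1 : b < 1 by rewrite bE; have := dl0; lra.
have := Cmeasurable_analytic (hL b1) mpol.
have hb w : W w -> cabs (polar w : C R) <= b.
  case: w => r t [/=]; rewrite in_itv/= => /andP[ar rb] _.
  by rewrite cabs_polar//; move: ar; rewrite aE; have := dl8; lra.
move=> /(_ hb) /Cmeasurable_cabs mc.
exact: (@measurableT_comp _ _ _ _ _ _ (@powR R ^~ p)).
Qed.

Let K0 : 0 <= K.
Proof.
have h0 : 0 <= (0 : R) < 1 by rewrite lexx ltr01.
rewrite -lee_fin; apply: le_trans (hK h0).
by apply: integral_ge0 => t _; rewrite lee_fin powR_ge0.
Qed.

Let kK0 : 0 <= 128 * dl * K.
Proof. by apply: mulr_ge0; [apply: mulr_ge0 => //; exact: ltW|exact: K0]. Qed.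

Let FW0 w : 0 <= (F \_ W) w.
Proof. by rewrite /patch; case: ifP => // _; exact: powR_ge0. Qed.

Let A : set ((R * R) * R) := [set x | (cabs (cis x.2 - cis x.1.1) <= 8 * dl)%R /\
  (0 <= x.1.1 <= 2 * pi)%R].

Let m11 : measurable_fun setT (fun x : (R * R) * R => x.1.1).
Proof. by apply: (@measurableT_comp _ _ _ _ _ _ fst) => //; exact: measurable_fst. Qed.

Let m12 : measurable_fun setT (fun x : (R * R) * R => x.1.2).
Proof. by apply: (@measurableT_comp _ _ _ _ _ _ snd) => //; exact: measurable_snd. Qed.

Let m2 : measurable_fun setT (fun x : (R * R) * R => x.2).
Proof. exact: measurable_snd. Qed.

Let mA : measurable A.
Proof.
have mcis (f : (R * R) * R -> R) : measurable_fun setT f ->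
    Cmeasurable setT (fun x => cis (f x)).
  by move=> mf; split => /=; apply: (@measurableT_comp _ _ _ _ _ _ _ _ f) => //;
    apply: continuous_measurable_fun; [exact: continuous_cos|exact: continuous_sin].
have mc : measurable_fun setT (fun x : (R * R) * R => cabs (cis x.2 - cis x.1.1)).
  apply: Cmeasurable_cabs; apply: CmeasurableD; first exact: mcis.
  have := CmeasurableM (Cmeasurable_cst setT (-1)) (mcis _ m11).
  by under eq_fun do rewrite mulN1r.
have -> : A = (fun x : (R * R) * R => cabs (cis x.2 - cis x.1.1)) @^-1` `]-oo, (8 * dl)%R]
    `&` (fun x => x.1.1) @^-1` `[0%R, (2 * pi)%R].
  by apply/seteqP; split => x /=; rewrite !in_itv.
by apply: measurableI; rewrite -[X in measurable X]setTI; [apply: mc|apply: m11] => //;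
  exact: measurable_itv.
Qed.

(* [g ((t0, r), t)] is the density at [(r, t)] as seen from the radius of angle [t0]. *)
Let g (x : (R * R) * R) : \bar R := ((F \_ W) (x.1.2, x.2) * \1_A x)%:E.

Let g0 x : (0 <= g x)%E.
Proof. by rewrite lee_fin mulr_ge0// indicE. Qed.

Let mg : measurable_fun setT g.
Proof.
apply/measurable_EFinP; apply: measurable_funM; last exact: measurable_indic.
apply: (@measurableT_comp _ _ _ _ _ _ (F \_ W) _ (fun x : (R * R) * R => (x.1.2, x.2))) => //.
exact: measurable_fun_pair.
Qed.

Let arc_mass r t : 0 <= t <= 2 * pi ->
  (\int[lam]_t0 g ((t0, r), t) <= (128 * dl)%:E * ((F \_ W) (r, t))%:E)%E.
Proof.
move=> t2; pose At := [set t0 | (0 <= t0 <= 2 * pi)%R /\ (cabs (cis t - cis t0) <= 8 * dl)%R].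
have h (t0 : R) : g ((t0, r), t) = (((F \_ W) (r, t))%:E * (\1_At t0)%:E)%E.
  rewrite /g /= -EFinM; congr (_ * _)%:E; rewrite !indicE.
  have -> : (((t0, r), t) \in A) = (t0 \in At) by apply/idP/idP; rewrite !inE => -[? ?]; split.
  by [].
have mAt : measurable At.
  have -> : At = xsection ((fun x : R * R => ((x.2, r), x.1)) @^-1` A) t.
    by apply/seteqP; split => x; rewrite /xsection/= inE => -[].
  apply: measurable_xsection; rewrite -[X in measurable X]setTI.
  have mm : measurable_fun setT (fun x : R * R => ((x.2, r), x.1)).
    by apply: measurable_fun_pair => //; apply: measurable_fun_pair.
  exact: mm.
under eq_integral do rewrite h.
rewrite ge0_integralZl_EFin//; last exact/measurable_EFinP/measurable_indic.
rewrite integral_indic// setIT muleC lee_wpmul2r ?lee_fin//.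
have s0 : 0 <= 8 * dl by rewrite mulr_ge0// ltW.
apply: le_trans (chord_arc_measure t2 s0) _.
by rewrite lee_fin mulrA -natrM.
Qed.

Let slice_mass r : (\int[lam]_t0 \int[lam]_t g ((t0, r), t) <= (128 * dl * K)%:E)%E /\
  (r \notin `[a, b] -> \int[lam]_t0 \int[lam]_t g ((t0, r), t) = 0)%E.
Proof.
have ng : r \notin `[a, b] -> forall t0 t, g ((t0, r), t) = 0%E.
  move=> h t0 t; rewrite /g /patch/= ifF ?mul0r//.
  by apply/negbTE; rewrite notin_setE => -[rab' _]; case/negP: h.
have rout : (r \notin `[a, b] -> \int[lam]_t0 \int[lam]_t g ((t0, r), t) = 0)%E.
  move=> h; rewrite integral0_eq// => t0 _; rewrite integral0_eq// => t _; exact: ng.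
split=> //; have [rab|/rout->] := boolP (r \in `[a, b]); last first.
  by rewrite lee_fin; exact: kK0.
have -> : (\int[lam]_t0 \int[lam]_t g ((t0, r), t) =
    \int[lam]_t \int[lam]_t0 g ((t0, r), t))%E.
  apply: (@fubini_tonelli _ _ _ _ R lam lam (fun x => g ((x.1, r), x.2))) => //.
  apply: (@measurableT_comp _ _ _ _ _ _ g _ (fun x : R * R => ((x.1, r), x.2))) => //.
  by apply: measurable_fun_pair => //; apply: measurable_fun_pair.
have r01 : 0 <= r < 1.
  move: rab; rewrite in_itv/= aE bE => /andP[? ?].
  by have := dl8; have := dl0; move=> ? ?; apply/andP; split; lra.
apply: (@le_trans _ _ ((128 * dl)%:E *
    \int[lam]_(t in `[0%R, (2 * pi)%R]) (cabs (L (polar (r, t))) `^ p)%:E)%E); last first.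
  rewrite [leRHS]EFinM; apply: lee_wpmul2l; last exact: hK.
  by rewrite lee_fin mulr_ge0// ltW.
have mFr : measurable_fun `[0, (2 * pi)]%classic (fun t => (cabs (L (polar (r, t))) `^ p)%:E).
  apply/measurable_EFinP.
  have mp : measurable_fun setT (fun t : R => (F \_ W) (r, t)).
    apply: (@measurableT_comp _ _ _ _ _ _ (F \_ W) _ (fun t : R => (r, t))) => //.
    exact: measurable_fun_pair.
  have := measurable_funS measurableT (@subsetT _ `[0, (2 * pi)]%classic) mp.
  apply: eq_measurable_fun => t; rewrite inE /= => ht; rewrite /patch ifT// inE; split => //=.
rewrite -ge0_integralZl_EFin//; last 2 first.
- by move=> t _; rewrite lee_fin powR_ge0.
- by rewrite mulr_ge0// ltW.
apply: le_integral_ge0 => [t _|t _|t _ h].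
- exact: integral_ge0.
- by rewrite -EFinM lee_fin mulr_ge0 ?powR_ge0// mulr_ge0// ltW.
have ht : t \in `[0, 2 * pi].
  apply: contraPP h => /negP h; apply/negP; rewrite -leNgt.
  rewrite integral0_eq// => t0 _; rewrite /g /patch/= ifF ?mul0r//.
  by apply/negbTE; rewrite notin_setE => -[_ ht']; case/negP: h.
split; first exact: ht.
have := @arc_mass r t; rewrite in_itv in ht => /(_ ht)/le_trans; apply.
apply: lee_wpmul2l; first by rewrite lee_fin mulr_ge0// ltW.
by rewrite lee_fin /patch; case: ifP => // _; exact: powR_ge0.
Qed.

Let mass_g : (\int[lam]_t0 \int[lam2]_w g ((t0, w.1), w.2) <= (512 * dl ^+ 2 * K)%:E)%E.
Proof.
have e1 (t0 : R) : (\int[lam2]_w g ((t0, w.1), w.2) = \int[lam]_r \int[lam]_t g ((t0, r), t))%E.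
  apply: (@fubini_tonelli1 _ _ _ _ R lam lam (fun w => g ((t0, w.1), w.2))) => //.
  apply: (@measurableT_comp _ _ _ _ _ _ g _ (fun x : R * R => ((t0, x.1), x.2))) => //.
  by apply: measurable_fun_pair => //; apply: measurable_fun_pair.
under eq_integral do rewrite e1.
have -> : (\int[lam]_t0 \int[lam]_r \int[lam]_t g ((t0, r), t) =
    \int[lam]_r \int[lam]_t0 \int[lam]_t g ((t0, r), t))%E.
  apply: (@fubini_tonelli _ _ _ _ R lam lam (fun x => \int[lam]_t g (x, t))%E).
    exact: (@measurable_fun_fubini_tonelli_F _ _ _ _ R lam g mg g0).
  by move=> x; exact: integral_ge0.
have ab : a <= b by rewrite aE bE; have := dl0; lra.
apply: (@le_trans _ _ (\int[lam]_(r in `[a, b]) (cst (128 * dl * K)%:E r))%E); last first.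
  rewrite integral_cst//= lebesgue_measure_itvcc// -EFinM lee_fin aE bE.
  by rewrite le_eqVlt; apply/orP; left; apply/eqP; ring.
apply: le_integral_ge0 => [r _|r _|r _ h].
- by apply: integral_ge0 => t0 _; exact: integral_ge0.
- by rewrite lee_fin; exact: kK0.
have [s1 s2] := slice_mass r; split=> //.
by apply: contraPP h => /negP/s2 ->; apply/negP; rewrite ltxx.
Qed.

(** On each radius the increment is at most its length times the supremum of
    [|L|], and the sub-mean value inequality bounds the [p]-th power of that
    supremum by a plane integral. *)
Lemma increment_mean : (\int[lam]_(t in `[0%R, (2 * pi)%R])
   (cabs (S (polar (dyadic_radius j.+1, t)) - S (polar (dyadic_radius j, t))) `^ p)%:E <=
   (512 * submean_const p * K * ((1 / 2) ^+ j.+1) `^ p)%:E)%E.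
Proof.
pose G t0 := (\int[lam2]_w g ((t0, w.1), w.2))%E.
have C0 : 0 <= submean_const p.
  by rewrite divr_ge0// sqr_ge0.
pose k := submean_const p / dl ^+ 2 * (2 * dl) `^ p.
have k0 : 0 <= k.
  by rewrite mulr_ge0 ?powR_ge0// divr_ge0// sqr_ge0.
have r0 : 0 <= dyadic_radius j by rewrite /dyadic_radius hj; have := dl8; lra.
have r1 : 0 <= dyadic_radius j.+1 by rewrite /dyadic_radius hj1; have := dl8; lra.
have pt t : 0 <= t <= 2 * pi ->
   ((cabs (S (polar (dyadic_radius j.+1, t)) - S (polar (dyadic_radius j, t))) `^ p)%:E <= k%:E * G t)%E.
  move=> t2.
  have G0 : (0 <= G t)%E by exact: integral_ge0.
  have hz (z : C R) s : dyadic_radius j <= s <= dyadic_radius j.+1 -> z = polar (s, t) ->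
      ((dl ^+ 2 * cabs (L z) `^ p)%:E <= (submean_const p)%:E * G t)%E.
    move=> /andP[s1 s2] ze.
    have s3 : 1 - 4 * dl <= s by move: s1; rewrite /dyadic_radius hj.
    have s4 : s <= 1 - 2 * dl by move: s2; rewrite /dyadic_radius hj1.
    have s0 : 0 <= s by have := dl8; lra.
    have cz : cabs z = s by rewrite ze cabs_polar.
    have zd : cabs z + dl < 1 by rewrite cz; have := dl0; lra.
    apply: (le_trans (submean p01 hL dl0 zd)).
    apply: lee_wpmul2l; first by rewrite lee_fin.
    apply: le_integral_ge0 => [w _|//|[r t'] [/= r0' t'2 hw] _].
      by rewrite lee_fin powR_ge0.
    have cw : cabs (polar (r, t') : C R) = r by rewrite cabs_polar.
    have rs : `|r - s| <= dl.
      rewrite ler_norml; apply/andP; split.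
        have := cabs_subr z (polar (r, t')); rewrite cabsB cz cw; lra.
      have := cabs_subr (polar (r, t')) z; rewrite cz cw; lra.
    have [rs1 rs2] : s - dl <= r /\ r <= s + dl.
      by move: rs; rewrite ler_norml => /andP[? ?]; split; lra.
    split=> //.
    rewrite /g lee_fin /= indicE mem_set ?mulr1 /patch ?ifT//.
      rewrite inE /W; split => /=; rewrite in_itv//= aE bE.
      by apply/andP; split; lra.
    split => //=.
    (* the chord is at most [2 dl / r] and [r >= 1 / 4] *)
    have h1 : cabs ((r%:C : C R) * (cis t' - cis t)) <= 2 * dl.
      have -> : (r%:C : C R) * (cis t' - cis t) = (polar (r, t') - z) + (z - polar (r, t)).
        by rewrite subrKA /polar/= mulrBr.
      rewrite (le_trans (cabsD _ _))//.
      have -> : cabs (z - polar (r, t)) = `|r - s|.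
        rewrite ze /polar/= -mulrBl cabsM cabs_cis mulr1 -(rmorphB (real_complex R)).
        by rewrite cabs_real distrC.
      lra.
    move: h1; rewrite cabsM cabs_real ger0_norm// => h1.
    have r14 : 1 / 4 <= r by have := dl8; lra.
    have := cabs_ge0 (cis t' - cis t); nra.
  have [Gy|Gfin] := eqVneq (G t) +oo%E.
    have [kk|kk] := eqVneq k 0; last first.
      by rewrite Gy gt0_muley ?leey// lte_fin lt_def kk.
    have := kk; rewrite /k => /eqP; rewrite mulf_eq0 => /orP[|].
      by rewrite gt_eqF// divr_gt0 ?exprn_gt0// divr_gt0// exprn_gt0// osc_radius_gt0.
    by rewrite gt_eqF// powR_gt0// mulr_gt0.
  have Gf : G t \is a fin_num by rewrite ge0_fin_numE// lt_neqAle Gfin leey.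
  pose M := (submean_const p / dl ^+ 2 * fine (G t)) `^ p^-1.
  have M0 : 0 <= submean_const p / dl ^+ 2 * fine (G t).
    by rewrite mulr_ge0 ?fine_ge0// divr_ge0// sqr_ge0.
  have hM s : dyadic_radius j <= s <= dyadic_radius j.+1 -> cabs (L (polar (s, t))) <= M.
    move=> hs; have := hz _ _ hs erefl; rewrite -(fineK Gf) -EFinM lee_fin => h.
    have -> : cabs (L (polar (s, t))) = (cabs (L (polar (s, t))) `^ p) `^ p^-1.
      by rewrite -powRrM divff ?gt_eqF// powRr1// cabs_ge0.
    apply: ge0_ler_powR; rewrite ?nnegrE ?powR_ge0 ?invr_ge0 ?(ltW p0)//.
    by rewrite mulrAC ler_pdivlMr ?exprn_gt0// mulrC.
  have rr : dyadic_radius j <= dyadic_radius j.+1 by rewrite /dyadic_radius hj hj1; have := dl0; lra.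
  have rlt : dyadic_radius j.+1 < 1 by rewrite /dyadic_radius hj1; have := dl0; lra.
  have cb : cabs (polar (dyadic_radius j.+1, t) : C R) <= dyadic_radius j.+1 by rewrite cabs_polar.
  have ca : cabs (polar (dyadic_radius j, t) : C R) <= dyadic_radius j.+1 by rewrite cabs_polar.
  have d1 : cabs (polar (dyadic_radius j.+1, t) - polar (dyadic_radius j, t)) = 2 * dl.
    rewrite /polar/= -mulrBl cabsM cabs_cis mulr1 -(rmorphB (real_complex R)) cabs_real.
    rewrite ger0_norm ?subr_ge0// /dyadic_radius hj hj1; ring.
  have hseg (s : R) : 0 <= s <= 1 ->
      cabs (L (polar (dyadic_radius j, t) + s%:C * (polar (dyadic_radius j.+1, t) - polar (dyadic_radius j, t)))) <= M.
    move=> /andP[s0 s1].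
    have -> : polar (dyadic_radius j, t) + s%:C * (polar (dyadic_radius j.+1, t) - polar (dyadic_radius j, t)) =
        polar (dyadic_radius j + s * (dyadic_radius j.+1 - dyadic_radius j), t).
      exact: polar_segment.
    apply: hM; apply/andP; split; nra.
  have := mean_value_inequality hS rlt ca cb hseg; rewrite d1 => h.
  rewrite -(fineK Gf) -EFinM lee_fin.
  have := ge0_ler_powR (ltW p0); move=> /(_ _ _ (cabs_ge0 _) (le_trans (cabs_ge0 _) h) h).
  have Mp : M `^ p = submean_const p / dl ^+ 2 * fine (G t).
    by rewrite /M -powRrM mulVf ?gt_eqF// powRr1.
  rewrite powRM ?Mp; [|exact: powR_ge0|by rewrite mulr_ge0// ltW].
  by move=> /le_trans; apply; rewrite /k mulrAC.
apply: (@le_trans _ _ (\int[lam]_t (k%:E * G t))%E).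
  apply: le_integral_ge0 => [t _|t _|t t2 _].
  - by rewrite lee_fin powR_ge0.
  - by rewrite mule_ge0 ?lee_fin// integral_ge0.
  - by split => //; apply: pt; rewrite /= in_itv in t2.
have mG : measurable_fun setT G.
  have -> : G = fubini_F lam (fun x => \int[lam]_t g (x, t))%E.
    apply/funext => t0; rewrite /G /fubini_F.
    apply: (@fubini_tonelli1 _ _ _ _ R lam lam (fun w => g ((t0, w.1), w.2))) => //.
    apply: (@measurableT_comp _ _ _ _ _ _ g _ (fun x : R * R => ((t0, x.1), x.2))) => //.
    by apply: measurable_fun_pair => //; apply: measurable_fun_pair.
  apply: (@measurable_fun_fubini_tonelli_F _ _ _ _ R lam) => [|x].
    exact: (@measurable_fun_fubini_tonelli_F _ _ _ _ R lam g mg g0).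
  exact: integral_ge0.
rewrite ge0_integralZl_EFin//; last by move=> t _; exact: integral_ge0.
apply: (le_trans (lee_wpmul2l _ mass_g)); first by rewrite lee_fin.
rewrite -EFinM lee_fin hj1 /k le_eqVlt; apply/orP; left; apply/eqP.
by field; rewrite gt_eqF.
Qed.

End Increments.

(** * Circular means of the Herglotz integral *)

Section CircularMean.
Context {R : realType}.
Local Notation lam := (@lebesgue_measure R).
Local Notation circle_param := `[0%R, (2 * pi)%R]%classic.

Definition has_mean (f : R -> R) (v : R) :=
  lam.-integrable circle_param (EFin \o f) /\
  (\int[lam]_(t in circle_param) (f t)%:E = v%:E)%E.

Lemma has_meanD f g v w : has_mean f v -> has_mean g w ->
  has_mean (fun t => f t + g t) (v + w).
Proof.
move=> [f1 f2] [g1 g2]; split.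
  exact: (@integrableD _ _ _ lam _ (measurable_itv _) _ _ f1 g1).
by under eq_integral do rewrite EFinD; rewrite integralD// f2 g2.
Qed.

Lemma has_meanZ f v (c : R) : has_mean f v -> has_mean (fun t => c * f t) (c * v).
Proof.
move=> [f1 f2]; split.
  exact: (@integrableZl _ _ _ lam _ (measurable_itv _) c _ f1).
by under eq_integral do rewrite EFinM; rewrite integralZl// f2.
Qed.

Lemma has_mean_cst (c : R) : has_mean (fun=> c) (2 * pi * c).
Proof.
have pi0 := @pi_ge0 R.
have l : lam circle_param = (2 * pi)%:E.
  by rewrite lebesgue_measure_itvcc ?subr0// mulr_ge0.
split.
  apply: measurable_bounded_integrable => //.
    by have := ltry (2 * pi : R); rewrite -l.
  exact: bounded_cst.
by rewrite integral_cst//= l -EFinM mulrC.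
Qed.

Lemma has_mean_derivative (F f : R -> R) : (forall t : R, is_derive t 1 F (f t)) ->
  continuous f -> F 0 = F (2 * pi) -> has_mean f 0.
Proof.
move=> dF cf F02.
have pi0 : 0 < 2 * pi :> R by rewrite mulr_gt0// pi_gt0.
have cF : continuous F.
  move=> t; apply: differentiable_continuous; apply/derivable1_diffP.
  by have [] := dF t.
split.
  apply: continuous_compact_integrable; first exact: segment_compact.
  exact: continuous_subspaceT.
rewrite (@continuous_FTC2 _ f F 0 (2 * pi))//.
- by rewrite F02 -EFinB subrr.
- exact: continuous_subspaceT.
- split.
  + by move=> t _; have [] := dF t.
  + exact: cvg_at_right_filter (cF _).
  + exact: cvg_at_left_filter (cF _).
- by move=> t _; rewrite derive1E derive_val.
Qed.

Lemma has_mean_cos n : has_mean (fun t => cos (n.+1%:R * t)) 0.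
Proof.
apply: (@has_mean_derivative (fun t => n.+1%:R^-1 * sin (n.+1%:R * t))) => [t|t|].
- apply: is_derive_eq; rewrite /GRing.scale/=; field.
  by rewrite nat1r pnatr_eq0.
- by apply: differentiable_continuous; apply/derivable1_diffP; exact: ex_derive.
- rewrite mulr0 sin0; have /(congr1 (@complex.Im R)) := @cisMn R (2 * pi) n.+1.
  by rewrite cis_2pi expr1n /= => ->.
Qed.

Lemma has_mean_sin n : has_mean (fun t => sin (n.+1%:R * t)) 0.
Proof.
apply: (@has_mean_derivative (fun t => - n.+1%:R^-1 * cos (n.+1%:R * t))) => [t|t|].
- apply: is_derive_eq; rewrite /GRing.scale/=; field.
  by rewrite nat1r pnatr_eq0.
- by apply: differentiable_continuous; apply/derivable1_diffP; exact: ex_derive.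
- rewrite mulr0 cos0; have /(congr1 (@complex.Re R)) := @cisMn R (2 * pi) n.+1.
  by rewrite cis_2pi expr1n /= => ->.
Qed.

Lemma has_mean_ext f g v : f =1 g -> has_mean f v -> has_mean g v.
Proof. by move=> /funext ->. Qed.

(** The nonconstant powers have primitives of period [2 * pi] in the angle. *)
Lemma has_mean_poly (q : {poly C R}) (r : R) :
  has_mean (fun t => complex.Re q.[polar (r, t)]) (2 * pi * complex.Re q.[0]).
Proof.
have mono (c : C R) n : has_mean (fun t => complex.Re (c * polar (r, t) ^+ n.+1)) 0.
  pose A := complex.Re c * r ^+ n.+1; pose B := - complex.Im c * r ^+ n.+1.
  have := has_meanD (has_meanZ A (has_mean_cos n)) (has_meanZ B (has_mean_sin n)).
  rewrite !mulr0 addr0; apply: has_mean_ext => t.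
  rewrite /polar/= exprMn -cisMn.
  have -> : (r%:C ^+ n.+1 : C R) = (r ^+ n.+1)%:C by rewrite rmorphXn.
  by rewrite cReM cReM cImM /= /A /B; ring.
suff main m : has_mean (fun t => complex.Re (\sum_(i < m.+1) q`_i * polar (r, t) ^+ i))
    (2 * pi * complex.Re q`_0).
  rewrite horner_coef0; apply: has_mean_ext (main (size q)) => t.
  by rewrite (@horner_coef_wide _ (size q).+1).
elim: m => [|m ih].
  apply: has_mean_ext (has_mean_cst _) => t; by rewrite big_ord1 expr0 mulr1.
have := has_meanD ih (mono q`_m.+1 m); rewrite addr0; apply: has_mean_ext => t.
by rewrite [in RHS]big_ord_recr cReD.
Qed.

Let pi_neq0 : pi != 0 :> R. Proof. by rewrite gt_eqF// pi_gt0. Qed.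

Lemma mean_Re_le (H : C R -> C R) (r : R) : disk_analytic H -> 0 <= r < 1 ->
  (forall z, cabs z < 1 -> 0 <= complex.Re (H z)) ->
  (\int[lam]_(t in circle_param) (complex.Re (H (polar (r, t))))%:E <=
     (2 * pi * complex.Re (H 0))%:E)%E.
Proof.
move=> hH /andP[r0 r1] H0; have pi0 := @pi_ge0 R.
have cz t : cabs (polar (r, t) : C R) <= r by rewrite cabs_polar.
apply/lee_addgt0Pr => e e0.
have e'0 : 0 < e / (4 * pi) by rewrite divr_gt0// mulr_gt0// pi_gt0.
have [q hq] := hH _ r1 _ e'0.
have [qi qv] := has_meanD (has_mean_poly q r) (has_mean_cst (e / (4 * pi))).
apply: (@le_trans _ _ (2 * pi * complex.Re q.[0] + 2 * pi * (e / (4 * pi)))%:E).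
  rewrite -qv; apply: le_integral_ge0 => t ht.
  - by rewrite lee_fin H0// (le_lt_trans (cz t)).
  - rewrite lee_fin (le_trans (H0 (polar (r, t)) (le_lt_trans (cz t) r1)))//.
    have := le_trans (ler_abs_Re _) (hq _ (cz t)).
    by rewrite cReB ler_norml => /andP[_]; lra.
  - move=> _; split=> //; rewrite lee_fin.
    have := le_trans (ler_abs_Re _) (hq _ (cz t)).
    by rewrite cReB ler_norml => /andP[_]; lra.
rewrite -EFinD lee_fin.
have h0 : cabs (0 : C R) <= r by rewrite cabs0.
have := le_trans (ler_abs_Re _) (hq _ h0); rewrite cReB ler_norml => /andP[h _].
have h1 : complex.Re q.[0] <= complex.Re (H 0) + e / (4 * pi) by lra.
have halves (P x : R) : P != 0 -> x = 2 * P * (x / (4 * P)) + 2 * P * (x / (4 * P)).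
  by move=> P0; field.
rewrite [in leRHS](halves pi e pi_neq0).
have pi2 : 0 <= 2 * pi :> R by rewrite mulr_ge0.
by move: h1; set E := e / (4 * pi) => h1; have := ler_wpM2l pi2 h1; lra.
Qed.

End CircularMean.


(** * The modulus of a singular inner function tends to one in the mean *)

Section RadialLimit.
Context {R : realType}.
Local Notation lam := (@lebesgue_measure R).
Local Notation circle_param := `[0%R, (2 * pi)%R]%classic.
Variable mu : {finite_measure set (borelC R) -> \bar R}.
Hypothesis hsing : singular_wrt_length mu.
Local Notation S := (singular_inner mu).

Definition defect n t : R := 1 - cabs (S (polar (dyadic_radius n, t))).

Lemma radius01 n : 0 <= (dyadic_radius n : R) < 1.
Proof.
have h0 : 0 < (1 / 2 : R) ^+ n by rewrite exprn_gt0// divr_gt0.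
have h1 : (1 / 2 : R) ^+ n <= 1 by apply: exprn_ile1; lra.
by rewrite /dyadic_radius; apply/andP; split; lra.
Qed.

Let cpol n t : cabs (polar (dyadic_radius n, t) : C R) = dyadic_radius n.
Proof. by rewrite cabs_polar//; case/andP: (radius01 n). Qed.

Let cpol1 n t : cabs (polar (dyadic_radius n, t) : C R) < 1.
Proof. by rewrite cpol; case/andP: (radius01 n). Qed.

Lemma defect_bounds n t : 0 <= defect n t <= 1.
Proof.
rewrite /defect subr_ge0 lerBlDr lerDl cabs_ge0 andbT cabs_singular_inner.
by rewrite expR_le1 oppr_le0 poisson_integral_ge0.
Qed.

Lemma defect_le n t : defect n t <= poisson_integral mu (polar (dyadic_radius n, t)).
Proof.
rewrite /defect cabs_singular_inner.
have := expR_ge1Dx (- poisson_integral mu (polar (dyadic_radius n, t))); lra.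
Qed.

Lemma measurable_analytic_polar (F : C R -> C R) (r : R) (D : set R) : disk_analytic F ->
  0 <= r < 1 -> Cmeasurable D (fun t => F (polar (r, t))).
Proof.
move=> hF /andP[r0 r1]; apply: (Cmeasurable_analytic (hF _ r1)) => [|t _]; last by rewrite cabs_polar.
apply: (@CmeasurableM _ _ _ D (fun=> r%:C : C R) (@cis R)).
  exact: Cmeasurable_cst.
exact: Cmeasurable_cis.
Qed.

Lemma continuous_dist (a : C R) : continuous (fun z : C R => cabs (z - a)).
Proof.
apply: continuous_1lip => z w; rewrite ler_norml; apply/andP; split.
  have := cabsD (z - a) (w - z); rewrite addrC subrKA [cabs (w - z)]cabsB; lra.
have := cabsD (w - a) (z - w); rewrite addrC subrKA; lra.
Qed.

(** The angles [0] and [2 * pi] give the same point of the circle, so that [V] has to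
    contain neighbourhoods of both. *)
Let open_cover (eps : R) : 0 < eps -> exists V : set R, exists N : set (borelC R), exists2 eta : R, 0 < eta &
  [/\ open V, measurable N, mu (circle `\` N) = 0%E, (lam V <= eps%:E)%E &
   (forall t, 0 <= t < 2 * pi -> N (cis t) -> V t) /\
   (forall t, (t < eta -> -eta < t -> V t) /\ (2 * pi - eta < t -> t < 2 * pi + eta -> V t))].
Proof.
move=> e0; have [N [mN N0 muN]] := hsing.
pose N' : set R := `[0, 2 * pi[%classic `&` cis @^-1` N.
have mN' : measurable N'.
  apply: measurableI; first exact: measurable_itv.
  by rewrite -[X in measurable X]setTI; exact: measurable_cis.
have N'0 : lam N' = 0%E by exact: N0.
have e2 : 0 < eps / 2 by rewrite divr_gt0.
have [|U [oU N'U hU]] := lebesgue_regularity_outer mN' _ e2.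
  by apply: (@le_lt_trans _ _ 0%E); [rewrite -N'0|exact: ltry].
pose eta := eps / 8; have eta0 : 0 < eta by rewrite divr_gt0.
pose I1 := `](- eta), eta[%classic : set R.
pose I2 := `](2 * pi - eta), (2 * pi + eta)[%classic : set R.
exists (U `|` (I1 `|` I2)), N, eta => //; split => //.
- apply: openU => //; apply: openU; exact: interval_open.
- have mU : measurable U by exact: open_measurable.
  have mI1 : measurable I1 by exact: measurable_itv.
  have mI2 : measurable I2 by exact: measurable_itv.
  have l1 : lam I1 = (2 * eta)%:E.
    rewrite /I1 lebesgue_measure_itv/= lte_fin ifT; last by lra.
    by rewrite -EFinB opprK; congr _%:E; ring.
  have l2 : lam I2 = (2 * eta)%:E.
    rewrite /I2 lebesgue_measure_itv/= lte_fin ifT; last by lra.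
    by rewrite -EFinB; congr _%:E; ring.
  have lU : (lam U <= (eps / 2)%:E)%E.
    have -> : U = N' `|` (U `\` N') by rewrite setDUK.
    apply: (@le_trans _ _ (lam N' + lam (U `\` N'))%E).
      by apply: measureU2 => //; exact: measurableD.
    by rewrite N'0 add0e ltW.
  apply: (@le_trans _ _ (lam U + (lam I1 + lam I2))%E).
    apply: (@le_trans _ _ (lam U + lam (I1 `|` I2))%E).
      by apply: measureU2 => //; exact: measurableU.
    by apply: leeD => //; apply: measureU2.
  rewrite l1 l2 -EFinD; apply: (le_trans (leeD lU (lexx _))).
  rewrite -EFinD lee_fin /eta; lra.
- split.
    by move=> t t2 Nt; left; apply: N'U; split => //=; rewrite in_itv.
  move=> t; split => h1 h2; right; [left|right].
    by rewrite /I1/= in_itv/= h1 h2.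
  by rewrite /I2/= in_itv/= h1 h2.
Qed.

(** On a small open set [V] of angles that carries [mu] the defect is at most [1]. Off
    [V] the mass of [mu] far from the given angle contributes [O(2 ^ - n)], and the
    mass near the complement of [V] is small; its contribution is estimated in the
    mean. *)
Lemma defect_mean_small (eps : R) : 0 < eps -> exists n0 : nat, forall n, (n0 <= n)%N ->
  (\int[lam]_(t in circle_param) (defect n t)%:E <= eps%:E)%E.
Proof.
move=> e0; have pi0 := @pi_gt0 R.
have e3 : 0 < eps / 3 by rewrite divr_gt0.
have [V [N [eta eta0 [oV mN muN lV [VN Vend]]]]] := open_cover e3.
pose B n : set (borelC R) := circle `&`
  [set z | exists2 s, (0 <= s <= 2 * pi) /\ ~ V s & cabs (z - cis s) < n.+1%:R^-1].
have mcirc := @measurable_circle R.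
have mB n : measurable (B n).
  apply: measurableI => //; apply: measurable_openC.
  have -> : [set z | exists2 s, (0 <= s <= 2 * pi) /\ ~ V s & cabs (z - cis s) < n.+1%:R^-1] =
     \bigcup_(s in [set s : R | (0 <= s <= 2 * pi) /\ ~ V s])
       (fun z : C R => cabs (z - cis s)) @^-1` [set x | x < n.+1%:R^-1].
    by apply/seteqP; split => z [s hs hz]; exists s.
  apply: bigcup_open => s _; apply: open_comp; last exact: open_lt.
  by move=> z _; exact: continuous_dist.
have Bc n : B n `<=` circle by move=> z [].
have capB : \bigcap_n B n `<=` circle `\` N.
  move=> z hz; have zc : circle z := Bc 0%N z (hz 0%N I); split=> // Nz.
  have [t t2 zE] := cis_surj zc.
  have Vt : V t by apply: VN => //; rewrite -zE.
  have /nbhs_ballP[e /= e'0 he] := open_nbhs_nbhs (conj oV Vt).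
  have me : 0 < Num.min e eta / 4 by rewrite divr_gt0// lt_min e'0.
  have [n _ /(_ n (leqnn _)) hn] := inv_succ_small me.
  have [_ [s [/andP[s0 s2] nVs] hs]] := hz n I; apply: nVs.
  move: hs; rewrite zE => hs.
  have hs4 : cabs (cis t - cis s) * 4 < Num.min e eta.
    by rewrite -ltr_pdivlMr// (lt_trans hs).
  have {hs4}[he4 ht4] : cabs (cis t - cis s) * 4 < e /\ cabs (cis t - cis s) * 4 < eta.
    by move: hs4; rewrite lt_min => /andP[].
  case/andP: t2 => t0 t2.
  have [d1|d1] := leP `|t - s| pi.
    apply: he; rewrite /ball/=; have := cabs_cisB_ge d1; lra.
  have [st|st] := leP s t.
    move: d1; rewrite ger0_norm ?subr_ge0// => d1.
    have e1 : cis (s + 2 * pi) = cis s by rewrite cisD cis_2pi mulr1.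
    have d2 : `|t - (s + 2 * pi)| <= pi by rewrite ler_norml; apply/andP; split; lra.
    have := cabs_cisB_ge d2; rewrite e1 => h.
    have := ler_norm (- (t - (s + 2 * pi))); rewrite normrN => h'.
    by apply: (Vend s).1; lra.
  move: d1; rewrite ltr0_norm ?subr_lt0// => d1.
  have e1 : cis (t + 2 * pi) = cis t by rewrite cisD cis_2pi mulr1.
  have d2 : `|t + 2 * pi - s| <= pi by rewrite ler_norml; apply/andP; split; lra.
  have := cabs_cisB_ge d2; rewrite e1 => h.
  have := ler_norm (t + 2 * pi - s) => h'.
  by apply: (Vend s).2; lra.
have capB0 : mu (\bigcap_n B n) = 0%E.
  apply/eqP; rewrite eq_le measure_ge0 andbT -muN.
  apply: le_measure; rewrite ?inE//; last exact: measurableD.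
  exact: bigcapT_measurable.
have Bcvg : (mu \o B) n @[n --> \oo] --> 0%E.
  rewrite -capB0; apply: nonincreasing_cvg_mu => //.
  - by rewrite ltey_eq fin_num_measure.
  - exact: bigcapT_measurable.
  - move=> n m nm; apply/subsetPset => z [zc [s hs hz]]; split=> //; exists s => //.
    by rewrite (lt_le_trans hz)// lef_pV2 ?posrE// ler_nat ltnS.
have e6 : 0 < eps / 3 / (2 * pi) by rewrite divr_gt0// mulr_gt0.
have [m hm] : exists m, fine (mu (B m)) <= eps / 3 / (2 * pi).
  have /fine_cvgP[_ /cvgrPdist_le/(_ _ e6)[m _ /(_ m (leqnn _))]] := Bcvg.
  by rewrite /= sub0r normrN ger0_norm ?fine_ge0// => h; exists m.
pose c : R := m.+1%:R^-1.
have c0 : 0 < c by rewrite invr_gt0.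
pose M := fine (mu (circle `\` B m)).
have M0 : 0 <= M by rewrite fine_ge0.
pose k := 8 / c ^+ 2 * M.
have k0 : 0 <= k by rewrite mulr_ge0// divr_ge0// sqr_ge0.
have pt n t : (1 / 2) ^+ n <= c / 2 -> 0 <= t <= 2 * pi ->
    defect n t <= \1_V t + complex.Re (herglotz mu (B m) (polar (dyadic_radius n, t))) + k * (1 / 2) ^+ n.
  move=> hn t2; set z := polar (dyadic_radius n, t).
  have z1 : cabs z < 1 by exact: cpol1.
  have HB0 : 0 <= complex.Re (herglotz mu (B m) z) by apply: Re_herglotz_ge0.
  have kn0 : 0 <= k * (1 / 2) ^+ n by rewrite mulr_ge0// exprn_ge0// divr_ge0.
  have [Vt|nVt] := pselect (V t).
    have -> : \1_V t = 1 :> R by rewrite indicE mem_set.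
    have /andP[_] := defect_bounds n t.
    by move: kn0 HB0; set y := k * _; set x := complex.Re _; lra.
  rewrite indicE memNset// add0r (le_trans (defect_le n t))//.
  rewrite (@poisson_integral_split R mu (B m) z (mB m) (Bc m) z1) lerD2l.
  rewrite /k -/M mulrAC.
  apply: Re_herglotz_far => //; first exact: measurableD.
  move=> zeta [zc nB].
  have far : c <= cabs (zeta - cis t).
    by rewrite leNgt; apply/negP => h; apply: nB; split => //; exists t.
  have h1 : 1 - cabs z = (1 / 2) ^+ n by rewrite cpol /dyadic_radius; ring.
  have h2 : cabs (cis t - z) = (1 / 2) ^+ n.
    have -> : cis t - z = (((1 / 2) ^+ n)%:C : C R) * cis t.
      have e1 : (1 / 2) ^+ n = 1 - dyadic_radius n :> R by rewrite /dyadic_radius; ring.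
      rewrite e1 /z /polar/=; apply: complex_ext;
        rewrite ?(cReM, cImM, cReB, cImB)/=; ring.
    by rewrite cabsM cabs_cis mulr1 cabs_real ger0_norm// exprn_ge0// divr_ge0.
  have h3 : c / 2 <= cabs (zeta - z).
    have := cabs_dist zeta (cis t) z; rewrite [cabs (z - _)]cabsB h2.
    by move: hn far; set y := (1 / 2) ^+ n; set x := cabs _; set x' := cabs _; lra.
  rewrite /poisson.
  have c2 : 0 < cabs (zeta - z) by rewrite (lt_le_trans _ h3)// divr_gt0.
  rewrite ler_pdivrMr ?exprn_gt0//.
  have h4 : (c / 2) ^+ 2 <= cabs (zeta - z) ^+ 2.
    by rewrite lerXn2r ?nnegrE ?cabs_ge0// divr_ge0// ltW.
  have h5 : 1 - cabs z ^+ 2 <= 2 * (1 / 2) ^+ n.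
    by rewrite -h1; have := cabs_ge0 z; move: z1; set x := cabs z; nra.
  apply: (le_trans h5).
  have -> : 2 * (1 / 2) ^+ n = 8 / c ^+ 2 * (1 / 2) ^+ n * (c / 2) ^+ 2 :> R.
    by field; rewrite gt_eqF.
  apply: ler_wpM2l => //.
  by apply: mulr_ge0; [apply: divr_ge0 => //; exact: sqr_ge0|apply: exprn_ge0; exact: divr_ge0].
have e7 : 0 < Num.min (c / 2) (eps / 3 / (2 * pi * (k + 1))).
  rewrite lt_min divr_gt0//= divr_gt0// mulr_gt0// ?mulr_gt0//.
  by rewrite ltr_wpDl.
have [n0 hn0] : exists n0 : nat, forall n, (n0 <= n)%N ->
    (1 / 2) ^+ n <= Num.min (c / 2) (eps / 3 / (2 * pi * (k + 1))).
  have h2 : `|1 / 2 : R| < 1 by rewrite ger0_norm; lra.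
  have /cvgrPdist_le/(_ _ e7)[n0 _ hn0] := cvg_expr h2.
  exists n0 => n /hn0 /= h; apply: le_trans h; rewrite sub0r normrN.
  exact: ler_norm.
exists n0 => n /hn0; rewrite le_min => /andP[hc hk].
have mV : measurable V by exact: open_measurable.
have mI : measurable (circle_param : set R) by exact: measurable_itv.
have HB0 t : 0 <= complex.Re (herglotz mu (B m) (polar (dyadic_radius n, t))).
  by apply: Re_herglotz_ge0.
have kn0 : 0 <= k * (1 / 2) ^+ n by rewrite mulr_ge0// exprn_ge0// divr_ge0.
have hBan : disk_analytic (herglotz mu (B m)) by exact: herglotz_analytic.
apply: (@le_trans _ _ (\int[lam]_(t in circle_param) ((\1_V t)%:E +
   (complex.Re (herglotz mu (B m) (polar (dyadic_radius n, t))))%:E + (k * (1 / 2) ^+ n)%:E))%E).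
  apply: le_integral_ge0 => t ht.
  - by rewrite lee_fin; case/andP: (defect_bounds n t).
  - by rewrite -!EFinD lee_fin !addr_ge0// indicE.
  - move=> _; split=> //; rewrite -!EFinD lee_fin.
    have ht' : 0 <= t <= 2 * pi by move: ht; rewrite /= in_itv.
    exact: pt.
have m1 : measurable_fun circle_param (fun t => (\1_V t)%:E : \bar R).
  by apply/measurable_EFinP; apply: measurable_indic.
have m2 : measurable_fun circle_param
    (fun t => (complex.Re (herglotz mu (B m) (polar (dyadic_radius n, t))))%:E).
  by apply/measurable_EFinP; have [] := measurable_analytic_polar circle_param hBan (radius01 n).
have m12 := emeasurable_funD m1 m2.
have n1 t : circle_param t -> (0 <= (\1_V t)%:E :> \bar R)%E by rewrite lee_fin indicE.
have n2 t : circle_param t ->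
    (0 <= (complex.Re (herglotz mu (B m) (polar (dyadic_radius n, t))))%:E)%E.
  by rewrite lee_fin.
have n12 t : circle_param t -> (0 <= (\1_V t)%:E +
    (complex.Re (herglotz mu (B m) (polar (dyadic_radius n, t))))%:E)%E.
  by move=> ht; rewrite adde_ge0 ?n1 ?n2.
have n3 t : circle_param t -> (0 <= (k * (1 / 2) ^+ n)%:E)%E by rewrite lee_fin.
rewrite ge0_integralD// ge0_integralD//.
rewrite integral_indic// (has_mean_cst (k * (1 / 2) ^+ n)).2.
have -> : eps = eps / 3 + eps / 3 + eps / 3 by field.
rewrite !EFinD; apply: leeD; first apply: leeD.
- apply: le_trans lV; apply: le_measure; rewrite ?inE//; exact: measurableI.
- apply: (le_trans (mean_Re_le hBan (radius01 n) _)) => [z z1|]; first exact: Re_herglotz_ge0.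
  by rewrite herglotz0//= lee_fin mulrC -ler_pdivlMr// mulr_gt0.
- rewrite lee_fin.
  have hp : 0 < 2 * pi * (k + 1) by rewrite mulr_gt0 ?mulr_gt0// ltr_wpDl.
  move: hk; rewrite ler_pdivlMr//.
  have : 0 <= (1 / 2 : R) ^+ n by rewrite exprn_ge0// divr_ge0.
  nra.
Qed.

End RadialLimit.

Section PowerMean.
Context {R : realType}.
Local Notation lam := (@lebesgue_measure R).
Local Notation circle_param := `[0%R, (2 * pi)%R]%classic.
Variable mu : {finite_measure set (borelC R) -> \bar R}.
Hypothesis hsing : singular_wrt_length mu.
Local Notation defect := (defect mu).

Lemma defect_pow_mean_small (p eps : R) : 0 < p < 1 -> 0 < eps ->
  exists n0 : nat, forall n, (n0 <= n)%N ->
  (\int[lam]_(t in circle_param) (defect n t `^ p)%:E <= eps%:E)%E.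
Proof.
move=> /andP[p0 p1] e0; have pi0 := @pi_gt0 R.
have pp : 0 < 2 * pi :> R by rewrite mulr_gt0.
(* [g^p <= a^p + a^(p - 1) g], with [a^p] a small constant *)
have [a a0 ap] : exists2 a : R, 0 < a & a `^ p = eps / 2 / (2 * pi).
  exists ((eps / 2 / (2 * pi)) `^ p^-1); first by rewrite powR_gt0// divr_gt0// divr_gt0.
  by rewrite -powRrM mulVf ?gt_eqF// powRr1// divr_ge0 ?divr_ge0 ?ltW.
have b0 : 0 < a `^ (p - 1) by exact: powR_gt0.
have pt g : 0 <= g -> g `^ p <= a `^ p + a `^ (p - 1) * g.
  move=> g0; have [ga|ag] := leP g a.
    apply: (@le_trans _ _ (a `^ p)).
      by apply: ge0_ler_powR; rewrite ?nnegrE// ltW.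
    by rewrite lerDl mulr_ge0// ltW.
  apply: (@le_trans _ _ (a `^ (p - 1) * g)); last by rewrite lerDr powR_ge0.
  rewrite -mulr_powRB1// mulrC ler_wpM2r//.
  have gp : 0 < g by exact: lt_trans ag.
  have e1 : p - 1 = - (1 - p) by ring.
  rewrite e1 !powRN lef_pV2 ?posrE ?powR_gt0//.
  by apply: ge0_ler_powR; rewrite ?nnegrE ?subr_ge0 ?ltW.
have [b bE] : exists b : R, b = a `^ (p - 1) by exists (a `^ (p - 1)).
have [c cE] : exists c : R, c = a `^ p by exists (a `^ p).
have c0 : 0 <= c by rewrite cE powR_ge0.
rewrite -bE in b0 pt; rewrite -cE in ap pt.
have e2 : 0 < eps / 2 / b by rewrite divr_gt0// divr_gt0.
have [n0 hn0] := defect_mean_small hsing e2.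
exists n0 => n /hn0 h.
have mI : measurable (circle_param : set R) by exact: measurable_itv.
have d0 t : 0 <= defect n t by case/andP: (defect_bounds mu n t).
apply: (@le_trans _ _ (\int[lam]_(t in circle_param)
    (c%:E + b%:E * (defect n t)%:E))%E).
  apply: le_integral_ge0 => t ht.
  - by rewrite lee_fin powR_ge0.
  - by rewrite -EFinM -EFinD lee_fin addr_ge0// mulr_ge0// ltW.
  - by move=> _; split => //; rewrite -EFinM -EFinD lee_fin pt.
have md0 : measurable_fun circle_param (defect n).
  apply: measurable_funB => //.
  apply: Cmeasurable_cabs; apply: measurable_analytic_polar.
    exact: singular_inner_analytic.
  exact: radius01.
have md : measurable_fun circle_param (fun t => (defect n t)%:E).
  apply/measurable_EFinP. exact: md0.
have n1 t : circle_param t -> (0 <= c%:E)%E by rewrite lee_fin.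
have n2 t : circle_param t -> (0 <= b%:E * (defect n t)%:E)%E.
  by move=> _; rewrite -EFinM lee_fin mulr_ge0// ltW.
have m2 : measurable_fun circle_param (fun t => b%:E * (defect n t)%:E)%E.
  have md' : measurable_fun circle_param (fun t => b * defect n t).
    exact: measurable_funM.
  exact/measurable_EFinP.
rewrite ge0_integralD//.
rewrite ge0_integralZl_EFin//; [|by move=> t _; rewrite lee_fin|exact: ltW].
rewrite (has_mean_cst c).2 ap.
rewrite [in leRHS](_ : eps = eps / 2 + eps / 2); last by field.
rewrite EFinD; apply: leeD; first by rewrite lee_fin [2 * pi * _]mulrC divfK ?gt_eqF.
apply: (le_trans (lee_wpmul2l _ h)); first by rewrite lee_fin ltW.
by rewrite -EFinM lee_fin mulrC divfK// gt_eqF.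
Qed.

End PowerMean.

(** * Superlevel sets of the Poisson integral on dyadic circles *)

Section SuperLevel.
Context {R : realType}.
Local Notation lam := (@lebesgue_measure R).
Local Notation circle_param := `[0%R, (2 * pi)%R]%classic.

Let one_sub_cabs (a b : C R) : 1 - cabs a <= cabs (b - a) + (1 - cabs b).
Proof. by have := cabs_subr b a; lra. Qed.

(** [1 - exp (- v)] is at least half the minimum of [v] and [1]. *)
Lemma defect_lower (x y v c0 c1 : R) : 0 < x -> x <= y -> 0 < c0 ->
  2 * c1 <= c0 / 8 -> 2 * c1 <= 1 -> x * c0 <= 8 * y * v ->
  c1 * x <= y * (1 - expR (- v)).
Proof.
move=> x0 xy c00 c1a c1b hv; have y0 : 0 < y by exact: lt_le_trans xy.
have v0 : 0 <= v.
  rewrite leNgt; apply/negP => v0; have : 0 < x * c0 by rewrite mulr_gt0.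
  by have : y * v < 0 by [rewrite pmulr_rlt0]; lra.
have e1 := expR_ge1Dx v; have e2 := expRxMexpNx_1 v; have e3 := expR_gt0 (- v).
have xc1 : x * (2 * c1) <= x * (c0 / 8) by rewrite ler_pM2l.
have xc2 : x * (2 * c1) <= x * 1 by rewrite ler_pM2l.
have [v1|v1] := leP v 1.
  have : v / 2 <= 1 - expR (- v) by nra.
  by rewrite -(ler_pM2l y0); lra.
have : 1 / 2 <= 1 - expR (- v) by nra.
by rewrite -(ler_pM2l y0); lra.
Qed.

Lemma powR_expn (x p : R) n : 0 <= x -> (x ^+ n) `^ p = (x `^ p) ^+ n.
Proof. by move=> x0; rewrite -(powR_mulrn n x0) -(powR_mulrn n (powR_ge0 x p)) powRAC. Qed.

Lemma powR_subadd (x y p : R) : 0 < p < 1 -> 0 <= x -> 0 <= y ->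
  (x + y) `^ p <= x `^ p + y `^ p.
Proof.
move=> /andP[p0 p1] x0 y0.
have [s0|sn0] := eqVneq (x + y) 0.
  by rewrite s0 powR0 ?gt_eqF// addr_ge0 ?powR_ge0.
have sp : 0 < x + y by rewrite lt_def sn0 addr_ge0.
(* [a (x + y)^(p - 1) <= a^p] for [a <= x + y] *)
have h (a : R) : 0 <= a -> a <= x + y -> a * (x + y) `^ (p - 1) <= a `^ p.
  move=> a0 ax; have [->|an0] := eqVneq a 0; first by rewrite mul0r powR_ge0.
  have ap : 0 < a by rewrite lt_def an0.
  rewrite -[leRHS]mulr_powRB1// ler_pM2l//.
  have e1 : p - 1 = - (1 - p) by ring.
  rewrite e1 !powRN lef_pV2 ?posrE ?powR_gt0//.
  by apply: ge0_ler_powR; rewrite ?nnegrE ?subr_ge0// ltW.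
rewrite -(mulr_powRB1 (addr_ge0 x0 y0) p0) mulrDl.
by rewrite lerD// h// ?lerDl ?lerDr.
Qed.

(** The largest index at which [b] holds dominates the geometric sum. *)
Lemma lacunary_sum (Q X : R) (b : nat -> bool) J : 1 < Q ->
  (forall k, (k < J)%N -> b k -> Q ^+ k.+1 <= X) -> 0 <= X ->
  \sum_(k < J) (b k)%:R * Q ^+ k.+1 <= X * (Q / (Q - 1)).
Proof.
move=> Q1 hb X0; have Q0 : 0 < Q - 1 by rewrite subr_gt0.
have geo m : \sum_(k < m) Q ^+ k.+1 <= Q ^+ m * (Q / (Q - 1)).
  elim: m => [|m ih].
    by rewrite big_ord0 mulr_ge0// divr_ge0 ?ltW//; lra.
  rewrite big_ord_recr/= (le_trans (lerD ih (lexx _)))//.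
  rewrite le_eqVlt; apply/orP; left; apply/eqP; rewrite exprS; field.
  by rewrite gt_eqF.
have k0 : 0 <= Q / (Q - 1) by rewrite divr_ge0 ?ltW//; lra.
elim: J hb => [|J ih] hb; first by rewrite big_ord0 mulr_ge0.
have [bJ|bJ] := boolP (b J); last first.
  rewrite big_ord_recr/= (negbTE bJ) mul0r addr0 ih// => k kJ.
  by apply: hb; rewrite ltnS ltnW.
apply: (@le_trans _ _ (\sum_(k < J.+1) Q ^+ k.+1)).
  apply: ler_sum => k _; rewrite ler_piMl//; last by case: (b k).
  by rewrite exprn_ge0//; lra.
by rewrite (le_trans (geo _))// ler_wpM2r// hb.
Qed.

Variable mu : {finite_measure set (borelC R) -> \bar R}.
Hypothesis hsing : singular_wrt_length mu.
Local Notation S := (singular_inner mu).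
Local Notation u := (poisson_integral mu).
Variable p : R.
Hypothesis p01 : 0 < p < 1.
Variable K : R.
Hypothesis hK : forall r : R, 0 <= r < 1 ->
  (\int[lam]_(t in circle_param) (cabs (derive1 S (polar (r, t))) `^ p)%:E <= K%:E)%E.

Let p0 : 0 < p. Proof. by case/andP: p01. Qed.

Let q : R := (1 / 2) `^ p.

Let q01 : 0 < q < 1.
Proof.
have h : (0 : R) < 1 / 2 by rewrite divr_gt0.
rewrite /q powR_gt0//=; apply: (@lt_le_trans _ _ (1 `^ p)); last by rewrite powR1.
by apply: gt0_ltr_powR; rewrite ?nnegrE ?ltW//; lra.
Qed.

Let A : R := 512 * submean_const p * K.

Let K0 : 0 <= K.
Proof.
have h0 : 0 <= (0 : R) < 1 by rewrite lexx ltr01.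
rewrite -lee_fin; apply: le_trans (hK h0).
by apply: integral_ge0 => t _; rewrite lee_fin powR_ge0.
Qed.

Let A0 : 0 <= A.
Proof.
apply: mulr_ge0 K0; apply: mulr_ge0; first exact: ler0n.
by apply: divr_ge0 (sqr_ge0 _); exact: ler0n.
Qed.

Let d0 n t : 0 <= defect mu n t.
Proof. by case/andP: (defect_bounds mu n t). Qed.

Let measurable_defect_pow n (D : set R) :
  measurable_fun D (fun t => (defect mu n t `^ p)%:E).
Proof.
have md : measurable_fun D (defect mu n).
  apply: measurable_funB => //; apply: Cmeasurable_cabs.
  apply: measurable_analytic_polar; [exact: singular_inner_analytic|exact: radius01].
apply/measurable_EFinP.
exact: (@measurableT_comp _ _ _ _ _ _ (@powR R ^~ p)).
Qed.

Let measurable_increment_pow n (D : set R) : measurable_fun D (fun t =>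
  (cabs (S (polar (dyadic_radius n.+1, t)) - S (polar (dyadic_radius n, t))) `^ p)%:E).
Proof.
have mS m : Cmeasurable D (fun t => S (polar (dyadic_radius m, t))).
  by apply: measurable_analytic_polar; [exact: singular_inner_analytic|exact: radius01].
apply/measurable_EFinP.
apply: (@measurableT_comp _ _ _ _ _ _ (@powR R ^~ p)) => //.
apply: Cmeasurable_cabs; apply: CmeasurableD => //.
have := CmeasurableM (Cmeasurable_cst D (-1)) (mS n).
by under eq_fun do rewrite mulN1r.
Qed.

Let defect_step n : (0 < n)%N ->
  (\int[lam]_(t in circle_param) (defect mu n t `^ p)%:E <=
   (A * q ^+ n.+1)%:E + \int[lam]_(t in circle_param) (defect mu n.+1 t `^ p)%:E)%E.
Proof.
move=> n0; have := increment_mean p01 (singular_inner_analytic mu) hK n0.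
rewrite powR_expn; last lra; rewrite -/q -/A => h.
apply: (le_trans _ (leeD h (lexx _))).
rewrite -ge0_integralD//; last 4 first.
- by move=> t _; rewrite lee_fin powR_ge0.
- exact: measurable_increment_pow.
- by move=> t _; rewrite lee_fin powR_ge0.
- exact: measurable_defect_pow.
apply: le_integral_ge0 => t ht.
- by rewrite lee_fin powR_ge0.
- by rewrite -EFinD lee_fin addr_ge0 ?powR_ge0.
move=> _; split=> //; rewrite -EFinD lee_fin.
apply: le_trans (powR_subadd p01 (cabs_ge0 _) (d0 n.+1 t)).
apply: ge0_ler_powR; rewrite ?nnegrE; [exact: ltW|exact: d0| |exact: one_sub_cabs].
by apply: addr_ge0 (d0 _ _); exact: cabs_ge0.
Qed.

(** The increments from generation [n] on are summed; the remainder tends to zero by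
    the singularity of [mu]. *)
Lemma defect_pow_decay n : (0 < n)%N ->
  (\int[lam]_(t in circle_param) (defect mu n t `^ p)%:E <= (A / (1 - q) * q ^+ n)%:E)%E.
Proof.
move=> n0; case/andP: q01 => q0 q1; have q10 : 0 < 1 - q by rewrite subr_gt0.
apply/lee_addgt0Pr => e e0.
have [m0 hm0] := defect_pow_mean_small hsing p01 e0.
have iter m : (\int[lam]_(t in circle_param) (defect mu n t `^ p)%:E <=
  (A * q ^+ n.+1 * ((1 - q ^+ m) / (1 - q)))%:E +
  \int[lam]_(t in circle_param) (defect mu (n + m) t `^ p)%:E)%E.
  elim: m => [|m ih]; first by rewrite expr0 subrr mul0r mulr0 add0e addn0.
  have nm : (0 < n + m)%N by rewrite addn_gt0 n0.
  apply: (le_trans ih); apply: (le_trans (leeD (lexx _) (defect_step nm))).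
  rewrite addeA -EFinD addnS leeD// lee_fin le_eqVlt; apply/orP; left; apply/eqP.
  by rewrite -addSn exprD exprS [q ^+ m.+1]exprS; field; rewrite gt_eqF.
apply: (le_trans (iter m0)); apply: leeD; last by apply: hm0; rewrite leq_addl.
rewrite lee_fin exprS [A * _]mulrA -mulrA mulrC.
have -> : A / (1 - q) * q ^+ n = q ^+ n * (A / (1 - q)) by rewrite mulrC.
have h1 : 0 <= q ^+ n by rewrite exprn_ge0// ltW.
have h2 : 0 < q ^+ m0 by rewrite exprn_gt0.
have h3 : 0 <= A / (1 - q) by rewrite divr_ge0// ltW.
have -> : q ^+ n * ((1 - q ^+ m0) / (1 - q)) * (A * q) =
   q ^+ n * (A / (1 - q)) * (q * (1 - q ^+ m0)) by ring.
apply: ler_piMr; first exact: mulr_ge0.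
apply: mulr_ile1; rewrite ?subr_ge0 ?exprn_ile1 ?(ltW q0) ?(ltW q1)//.
by rewrite lerBlDr lerDl ltW.
Qed.

Definition superlevel (c0 : R) k : set R :=
  [set t | (0 <= t <= 2 * pi)%R /\ (c0 <= u (polar (dyadic_radius k, t)))%R].

Lemma poisson_measurable k (D : set R) :
  measurable_fun D (fun t => u (polar (dyadic_radius k, t))).
Proof.
have [] // := @measurable_analytic_polar R (herglotz mu circle) (dyadic_radius k) D _ (radius01 k).
by apply: herglotz_analytic => //; exact: measurable_circle.
Qed.

Lemma measurable_superlevel c0 k : measurable (superlevel c0 k).
Proof.
have -> : superlevel c0 k = circle_param `&`
    (fun t => u (polar (dyadic_radius k, t))) @^-1` `[c0, +oo[%classic.
  by apply/seteqP; split => t /=; rewrite !in_itv/= andbT.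
by apply: poisson_measurable; exact: measurable_itv.
Qed.

(** Harnack's inequality for two points of a radius. *)
Lemma poisson_radial_growth j k t : (k <= j)%N ->
  (1 / 2) ^+ j * u (polar (dyadic_radius k, t)) <=
  8 * (1 / 2) ^+ k * u (polar (dyadic_radius j, t)).
Proof.
move=> kj; set z := polar _; set w := polar _.
have cz m : cabs (polar (dyadic_radius m, t) : C R) = dyadic_radius m.
  by rewrite cabs_polar//; case/andP: (radius01 (R := R) m).
have z1 : cabs z < 1 by rewrite cz; case/andP: (radius01 (R := R) k).
have w1 : cabs w < 1 by rewrite cz; case/andP: (radius01 (R := R) j).
have rE m : 1 - dyadic_radius m = (1 / 2) ^+ m :> R by rewrite /dyadic_radius; ring.
have hp m : 0 < (1 / 2 : R) ^+ m by rewrite exprn_gt0//; lra.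
have hle : (1 / 2 : R) ^+ j <= (1 / 2) ^+ k by apply: ler_wiXn2l => //; lra.
have m0 : 0 <= (1 / 2 : R) ^+ k / (1 / 2) ^+ j by rewrite divr_ge0// ltW.
have := @harnack R mu z w 1 _ z1 w1 ler01 m0.
rewrite !cz !rE divfK ?gt_eqF// mul1r => /(_ _ (lexx _)) h.
have : cabs (z - w) <= (1 / 2) ^+ k.
  rewrite /z /w (le_trans (polar_dist _ _ _ _))//.
    by case/andP: (radius01 (R := R) j) => -> /ltW ->.
  rewrite subrr normr0 addr0 distrC.
  have -> : dyadic_radius j - dyadic_radius k = (1 / 2) ^+ k - (1 / 2) ^+ j :> R.
    by rewrite /dyadic_radius; ring.
  by rewrite ger0_norm ?subr_ge0// lerBlDr lerDl ltW.
move=> /h {}h.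
rewrite mulrC -ler_pdivlMr// (le_trans h)// le_eqVlt; apply/orP; left; apply/eqP.
by field; rewrite gt_eqF.
Qed.

Let Q : R := q^-1.

Let Q1 : 1 < Q.
Proof. by case/andP: q01 => q0 q1; rewrite /Q invf_gt1. Qed.

Let Q0 : 0 <= Q. Proof. exact: ltW (lt_trans ltr01 Q1). Qed.

(** On the superlevel set of generation [k] every later [2^j defect j] is at
    least a constant times [2^k]; so the sum over generations is dominated by its
    largest term. *)
Lemma superlevel_summable (c0 : R) : 0 < c0 -> exists B : R, forall J,
  (\sum_(k < J) (((1 / 2) `^ p)^-1 ^+ k.+1)%:E * lam (superlevel c0 k.+1) <= B%:E)%E.
Proof.
move=> c00; case/andP: q01 => q0 q1; have q10 : 0 < 1 - q by rewrite subr_gt0.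
have [c1 c10 [c1a c1b]] : exists2 c1 : R, 0 < c1 & 2 * c1 <= c0 / 8 /\ 2 * c1 <= 1.
  exists (Num.min (c0 / 8) 1 / 2); first by rewrite divr_gt0// lt_min ltr01 divr_gt0.
  by rewrite mulrC divfK// !ge_min !lexx orbT.
have hp m : 0 < (1 / 2 : R) ^+ m by rewrite exprn_gt0//; lra.
have Q10 : 0 < Q - 1 by rewrite subr_gt0.
have key J k t : (k <= J)%N -> superlevel c0 k t ->
    Q ^+ k <= (c1 `^ p)^-1 * (Q ^+ J * defect mu J t `^ p).
  move=> kJ [t2 hu].
  have h1 : c1 * (1 / 2) ^+ J <= (1 / 2) ^+ k * defect mu J t.
    have := poisson_radial_growth t kJ.
    rewrite /defect cabs_singular_inner => hv.
    apply: (defect_lower (hp J) _ c00 c1a c1b); first by apply: ler_wiXn2l => //; lra.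
    by apply: le_trans hv; rewrite ler_wpM2l// ltW.
  have := ge0_ler_powR (ltW p0); move=> /(_ _ _ _ _ h1).
  rewrite !nnegrE ?mulr_ge0 ?d0 ?(ltW c10) ?(ltW (hp _))// => /(_ isT isT).
  rewrite !powRM ?d0 ?(ltW c10) ?(ltW (hp _))// !powR_expn; try lra.
  rewrite -/q => h2.
  rewrite /Q !exprVn mulrA -invfM [leRHS]mulrC.
  by rewrite ler_pdivlMr ?ler_pdivrMl ?mulr_gt0 ?exprn_gt0 ?powR_gt0.
have C0 : 0 <= (c1 `^ p)^-1 * (Q / (Q - 1)).
  by apply: mulr_ge0; [rewrite invr_ge0 powR_ge0|exact: divr_ge0 Q0 (ltW Q10)].
exists ((c1 `^ p)^-1 * (Q / (Q - 1)) * (A / (1 - q))).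
case=> [|J0].
  by rewrite big_ord0 lee_fin; apply: mulr_ge0 C0 _; exact: divr_ge0 A0 (ltW q10).
set J := J0.+1; have J1 : (0 < J)%N by [].
have QX n : 0 <= Q ^+ n by exact: exprn_ge0.
apply: (@le_trans _ _ (\int[lam]_(t in circle_param) (\sum_(k < J)
    (Q ^+ k.+1)%:E * (\1_(superlevel c0 k.+1) t)%:E))%E).
  rewrite ge0_integral_sum//; last 2 first.
  - move=> k; have mk : measurable_fun circle_param (fun t => Q ^+ k.+1 * \1_(superlevel c0 k.+1) t).
      by apply: measurable_funM => //; apply: measurable_indic; exact: measurable_superlevel.
    exact/measurable_EFinP.
  - move=> k t _; rewrite -EFinM lee_fin mulr_ge0// indicE.
  apply: lee_sum => k _.
  rewrite ge0_integralZl_EFin//; last first.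
    by apply/measurable_EFinP; apply: measurable_indic; exact: measurable_superlevel.
  rewrite integral_indic//; last exact: measurable_superlevel.
  by rewrite setIidl// => t [t2 _]; rewrite /= in_itv.
apply: (@le_trans _ _ (\int[lam]_(t in circle_param)
    (((c1 `^ p)^-1 * (Q / (Q - 1)) * Q ^+ J)%:E * (defect mu J t `^ p)%:E))%E).
  apply: le_integral_ge0 => t ht.
  - by apply: sume_ge0 => k _; rewrite -EFinM lee_fin mulr_ge0// indicE.
  - by rewrite -EFinM lee_fin; apply: mulr_ge0 (powR_ge0 _ _); exact: mulr_ge0.
  move=> _; split=> //; rewrite -EFinM sumEFin lee_fin.
  have X0 : 0 <= (c1 `^ p)^-1 * (Q ^+ J * defect mu J t `^ p).
    by apply: mulr_ge0; [rewrite invr_ge0 powR_ge0|exact: mulr_ge0 (QX J) (powR_ge0 _ _)].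
  have := @lacunary_sum Q _ (fun k => `[< superlevel c0 k.+1 t >]) J Q1 _ X0.
  have hyp k : (k < J)%N -> `[< superlevel c0 k.+1 t >] ->
     Q ^+ k.+1 <= (c1 `^ p)^-1 * (Q ^+ J * defect mu J t `^ p).
    by move=> kJ /asboolP; exact: key.
  move=> /(_ hyp) h; apply: le_trans (le_trans h _).
    rewrite le_eqVlt; apply/orP; left; apply/eqP; apply: eq_bigr => k _.
    by rewrite mulrC indicE; congr (_%:R * _); congr nat_of_bool; rewrite unfold_in.
  by rewrite le_eqVlt; apply/orP; left; apply/eqP; ring.
rewrite ge0_integralZl_EFin//; last 3 first.
- by move=> t _; rewrite lee_fin powR_ge0.
- exact: measurable_defect_pow.
- exact: mulr_ge0.
apply: (le_trans (lee_wpmul2l _ (defect_pow_decay J1))).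
  by rewrite lee_fin; exact: mulr_ge0.
rewrite -EFinM lee_fin le_eqVlt; apply/orP; left; apply/eqP.
rewrite /Q exprVn; set z := c1 `^ p; have z0 : 0 < z by rewrite powR_gt0.
field; rewrite !gt_eqF//= ?exprn_gt0//.
Qed.

End SuperLevel.

(** * Dyadic arcs and the area condition *)

Section Dyadic.
Context {R : realType}.
Local Notation lam := (@lebesgue_measure R).

Definition dyadic_angle (k i : nat) : R := 2 * pi * (1 / 2) ^+ k * i%:R.

Definition dyadic_cell (k i : nat) : set R :=
  `[dyadic_angle k i, dyadic_angle k i.+1[%classic.

Let half_pow_gt0 k : 0 < (1 / 2 : R) ^+ k.
Proof. by rewrite exprn_gt0// divr_gt0. Qed.

Let half_mul k : (1 / 2 : R) ^+ k * (2 ^ k)%:R = 1.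
Proof. by rewrite natrX -exprMn divfK// expr1n. Qed.

Lemma dyadic_step_gt0 k : 0 < 2 * pi * (1 / 2 : R) ^+ k.
Proof. by rewrite mulr_gt0// mulr_gt0// pi_gt0. Qed.

Lemma dyadic_angleS k i : dyadic_angle k i.+1 = dyadic_angle k i + 2 * pi * (1 / 2) ^+ k.
Proof. by rewrite /dyadic_angle -[i.+1%:R]natr1 mulrDr mulr1. Qed.

Lemma dyadic_angle_ge0 k i : 0 <= dyadic_angle k i.
Proof. by rewrite mulr_ge0// ltW// dyadic_step_gt0. Qed.

Lemma dyadic_angle_le k i : (i <= 2 ^ k)%N -> dyadic_angle k i <= 2 * pi.
Proof.
move=> ik; rewrite /dyadic_angle -mulrA ler_piMr ?mulr_ge0 ?pi_ge0//.
by rewrite -[leRHS](half_mul k) ler_pM2l// ler_nat.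
Qed.

Lemma dyadic_index k t : 0 <= t < 2 * pi ->
  exists2 i, (i < 2 ^ k)%N & dyadic_cell k i t.
Proof.
move=> /andP[t0 t2]; have s0 := dyadic_step_gt0 k.
pose x := t / (2 * pi * (1 / 2) ^+ k).
have x0 : 0 <= x by rewrite divr_ge0// ltW.
have /andP[x1 x2] := truncn_itv x0.
exists (Num.truncn x).
  rewrite -(ltr_nat R) (le_lt_trans x1)// /x ltr_pdivrMr//.
  have -> : (2 ^ k)%:R * (2 * pi * (1 / 2) ^+ k) = 2 * pi :> R.
    by rewrite mulrC -[LHS]mulrA half_mul mulr1.
  by [].
rewrite /dyadic_cell/= in_itv/= /dyadic_angle; apply/andP; split.
  by rewrite mulrC -ler_pdivlMr.
by rewrite mulrC -ltr_pdivrMr.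
Qed.

Lemma dyadic_cell_disj k i j t : dyadic_cell k i t -> dyadic_cell k j t -> i = j.
Proof.
rewrite /dyadic_cell/= !in_itv/= /dyadic_angle => /andP[i1 i2] /andP[j1 j2].
have s0 := dyadic_step_gt0 k.
have := le_lt_trans i1 j2; have := le_lt_trans j1 i2.
by rewrite !ltr_pM2l// !ltr_nat; lia.
Qed.

Lemma dyadic_cell_trivIset k (P : nat -> Prop) :
  trivIset setT (fun i => if pselect (P i) then dyadic_cell k i else set0).
Proof.
apply/trivIsetP => i j _ _ ij; rewrite -subset0 => t [].
case: pselect => [? /= it|? []//]; case: pselect => [? /= jt|? []//].
by move/eqP : ij; apply; exact: dyadic_cell_disj it jt.
Qed.

Lemma lebesgue_dyadic_cell k i : lam (dyadic_cell k i) = (2 * pi * (1 / 2) ^+ k)%:E.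
Proof.
rewrite /dyadic_cell lebesgue_measure_itv/= lte_fin dyadic_angleS ltrDl dyadic_step_gt0.
by rewrite -EFinB addrAC subrr add0r.
Qed.

Lemma dyadic_count k (P : nat -> bool) (E : set R) : measurable E ->
  (forall i, (i < 2 ^ k)%N -> P i -> dyadic_cell k i `<=` E) ->
  ((\sum_(i < 2 ^ k) (P i)%:R * (2 * pi * (1 / 2) ^+ k))%:E <= lam E)%E.
Proof.
move=> mE hP.
pose P' i := ((i < 2 ^ k)%N && P i) : Prop.
pose F i := if pselect (P' i) then dyadic_cell k i else set0.
have mF i : measurable (F i).
  by rewrite /F; case: pselect => ? /=; [exact: measurable_itv|exact: measurable0].
have hF := measure_bigsetU lam mF (@dyadic_cell_trivIset k P') (2 ^ k)%N.
have -> : (\sum_(i < 2 ^ k) (P i)%:R * (2 * pi * (1 / 2) ^+ k))%:E =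
    lam (\big[setU/set0]_(i < 2 ^ k) F i).
  rewrite hF -sumEFin; apply: eq_bigr => i _.
  rewrite /F; case: pselect => [Pi|Pi] /=.
    case/andP: (Pi) => _ ->; rewrite [LHS]/= [_%:R * _]mul1r; exact: (esym (lebesgue_dyadic_cell k i)).
  move/negP: Pi; rewrite ltn_ord/= => /negbTE ->; rewrite mul0r; exact: (esym (measure0 lam)).
apply: le_measure; rewrite ?inE//.
  by apply: bigsetU_measurable => i _; exact: mF.
rewrite -bigcup_mkord => t [i /= ik]; rewrite /F; case: pselect => [Pi /= it|? []//]; case/andP: Pi => _ Pi.
exact: hP it.
Qed.

Definition plane_square (z : C R) (h : R) : set (R * R) :=
  `[complex.Re z - h, complex.Re z - h + 2 * h]%classic `*`
  `[complex.Im z - h, complex.Im z - h + 2 * h]%classic.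

Lemma measurable_plane_square z h : measurable (plane_square z h).
Proof. by apply: measurableX; exact: measurable_itv. Qed.

Lemma plane_squareP (z : C R) h x y : plane_square z h (x, y) <->
  `|x - complex.Re z| <= h /\ `|y - complex.Im z| <= h.
Proof.
rewrite /plane_square; split=> [[/=]|[]].
  rewrite !in_itv/= => /andP[? ?] /andP[? ?].
  by rewrite !ler_norml; split; apply/andP; split; lra.
rewrite !ler_norml => /andP[? ?] /andP[? ?].
by split => /=; rewrite in_itv/=; apply/andP; split; lra.
Qed.

End Dyadic.

Section AreaBound.
Context {R : realType}.
Local Notation lam := (@lebesgue_measure R).
Local Notation lam2 := (@lebesgue_measure R \x @lebesgue_measure R)%E.
Local Notation circle_param := `[0%R, (2 * pi)%R]%classic.
Variable mu : {finite_measure set (borelC R) -> \bar R}.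
Local Notation S := (singular_inner mu).
Local Notation u := (poisson_integral mu).
Variable p : R.
Hypothesis p01 : 0 < p < 1.

Let half_pow_gt0 k : 0 < (1 / 2 : R) ^+ k.
Proof. by rewrite exprn_gt0// divr_gt0. Qed.

Lemma dyadic_scale (x : R) : 0 < x <= 1 -> exists2 k, (0 < k)%N &
  (1 / 2) ^+ k < x <= 2 * (1 / 2) ^+ k.
Proof.
move=> /andP[x0 x1].
have ex : exists n, (1 / 2) ^+ n < x.
  have h2 : `|1 / 2 : R| < 1 by rewrite ger0_norm; lra.
  have /cvgrPdist_lt/(_ _ x0)[n _ /(_ n (leqnn _))] := cvg_expr h2.
  by rewrite /= sub0r normrN => h; exists n; rewrite (le_lt_trans (ler_norm _)).
case: (ex_minnP ex) => -[|k]; first by rewrite expr0 ltNge x1.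
move=> hk hmin; exists k.+1 => //; rewrite hk/= exprS.
have -> : 2 * (1 / 2 * (1 / 2) ^+ k) = (1 / 2) ^+ k :> R.
  by rewrite mulrA [2 * _]mulrC divfK ?pnatr_eq0// mul1r.
rewrite leNgt; apply/negP => hk'; by have := hmin _ hk'; rewrite ltnn.
Qed.

(** The two points are at distance at most [9 * 2 ^ - k], and their distances to the
    circle agree up to a factor [2]. *)
Lemma harnack_dyadic k i r t s : (0 < k)%N -> 0 <= r < 1 ->
  (1 / 2) ^+ k < 1 - r <= 2 * (1 / 2) ^+ k ->
  dyadic_cell k i t -> dyadic_cell k i s ->
  u (polar (r, t)) <= 1444 * u (polar (dyadic_radius k, s)).
Proof.
move=> k0 /andP[r0 r1] /andP[h1 h2] ht hs.
have /andP[q0 q1] := radius01 (R := R) k.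
have rE : 1 - dyadic_radius k = (1 / 2) ^+ k :> R by rewrite /dyadic_radius; ring.
have c1 : cabs (polar (r, t) : C R) < 1 by rewrite cabs_polar.
have c2 : cabs (polar (dyadic_radius k, s) : C R) < 1 by rewrite cabs_polar.
have := @harnack R mu _ _ 18 2 c1 c2 (ler0n _ _) (ler0n _ _).
rewrite !cabs_polar// rE => /(_ _ h2) h.
apply: le_trans (h _) _; last first.
  have -> : 2 * (1 + 18) ^+ 2 * 2 = 1444 :> R by ring.
  exact: lexx.
apply: (le_trans (polar_dist _ _ _ _)); first by rewrite q0 ltW.
have d1 : `|r - dyadic_radius k| <= (1 / 2) ^+ k.
  by rewrite ler_norml; move: rE h1 h2; set y := (1 / 2) ^+ k => rE h1 h2;
    apply/andP; split; lra.
have d2 : `|t - s| <= 2 * pi * (1 / 2) ^+ k.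
  move: ht hs; rewrite /dyadic_cell/= !in_itv/= dyadic_angleS => /andP[t1 t2] /andP[s1 s2].
  move: t1 t2 s1 s2; set y := 2 * pi * _; set z := dyadic_angle k i => t1 t2 s1 s2.
  by rewrite ler_norml; apply/andP; split; lra.
have pi4 : 2 * pi * (1 / 2) ^+ k <= 8 * (1 / 2) ^+ k :> R.
  by rewrite ler_pM2r//; have := @pihalf_lt2 R; lra.
apply: (le_trans (lerD d1 (le_trans d2 pi4))).
by move: h1; set y := (1 / 2) ^+ k => h1; lra.
Qed.

Let good (c0 : R) k i : bool := `[< dyadic_cell k i `<=` superlevel mu c0 k >].

Let weight k : R := (((1 / 2) ^+ k) `^ (1 + p))^-1.

Let center k i : C R := polar (dyadic_radius k, dyadic_angle k i).

Let G (c0 : R) k (w : R * R) : \bar R :=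
  (\sum_(i < 2 ^ k) ((good c0 k i)%:R * weight k *
     \1_(plane_square (center k i) (9 * (1 / 2) ^+ k)) w)%:E)%E.

Let weight_ge0 k : 0 <= weight k.
Proof. by rewrite invr_ge0 powR_ge0. Qed.

Let term_ge0 c0 k i w : (0 <= ((good c0 k i)%:R * weight k *
     \1_(plane_square (center k i) (9 * (1 / 2) ^+ k)) w)%:E)%E.
Proof. by rewrite lee_fin mulr_ge0 ?indicE// mulr_ge0. Qed.

Let G_ge0 c0 k w : (0 <= G c0 k w)%E.
Proof. by apply: sume_ge0 => i _; exact: term_ge0. Qed.

Let term_measurable c0 k i : measurable_fun setT (fun w => ((good c0 k i)%:R * weight k *
     \1_(plane_square (center k i) (9 * (1 / 2) ^+ k)) w)%:E).
Proof.
apply/measurable_EFinP; apply: measurable_funM => //.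
by apply: measurable_indic; exact: measurable_plane_square.
Qed.

Let G_measurable c0 k : measurable_fun setT (G c0 k).
Proof. by apply: emeasurable_sum => i; exact: term_measurable. Qed.

Let G_mass c0 k : (\int[lam2]_w G c0 k w <=
  324%:E * ((((1 / 2) `^ p)^-1 ^+ k)%:E * lam (superlevel mu c0 k)))%E.
Proof.
rewrite /G ge0_integral_sum//; last by move=> i; exact: term_measurable.
set h := (1 / 2 : R) ^+ k; have h0 : 0 < h := half_pow_gt0 k.
have sq i : (\int[lam2]_w ((good c0 k i)%:R * weight k *
     \1_(plane_square (center k i) (9 * h)) w)%:E =
     ((good c0 k i)%:R * weight k * (2 * (9 * h)) ^+ 2)%:E)%E.
  rewrite -(@integral_cst_square R (complex.Re (center k i) - 9 * h)
    (complex.Im (center k i) - 9 * h)); last by rewrite !mulr_ge0// ltW.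
  rewrite [RHS]integral_mkcond; apply: eq_integral => w _.
  rewrite indicE /patch.
  have [hw|hw] := pselect (plane_square (center k i) (9 * h) w).
    have e : (w \in plane_square (center k i) (9 * h)) = true := mem_set hw.
    by rewrite e mulr1.
  have e : (w \in plane_square (center k i) (9 * h)) = false := memNset hw.
  by rewrite e mulr0.
under eq_bigr do rewrite sq.
rewrite sumEFin.
have hc := @dyadic_count R k (good c0 k) _ (measurable_superlevel mu c0 k)
  (fun i _ hi => asboolW hi).
rewrite -/h in hc.
have pi1 : (1 : R) <= 2 * pi by have := @pi_ge2 R; lra.
have wh : weight k * h = ((1 / 2) `^ p)^-1 ^+ k.
  rewrite /weight -/h powRD; last by rewrite (gt_eqF h0) implybT.
  rewrite powRr1 ?ltW// invfM mulrAC mulVf ?gt_eqF// mul1r.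
  by rewrite /h powR_expn ?exprVn// !mul1r.
have v0 : 0 <= ((1 / 2 : R) `^ p)^-1 ^+ k by rewrite exprn_ge0// invr_ge0 powR_ge0.
apply: (@le_trans _ _ (324%:E * ((((1 / 2) `^ p)^-1 ^+ k)%:E *
   (\sum_(i < 2 ^ k) (good c0 k i)%:R * (2 * pi * h))%:E))%E); last first.
  by apply: lee_wpmul2l; [rewrite lee_fin ler0n|apply: lee_wpmul2l].
rewrite -!EFinM lee_fin -wh !big_distrr/=; apply: ler_sum => i _.
case: (good c0 k i); last by rewrite !mul0r !mulr0.
rewrite !mul1r.
have -> : weight k * (2 * (9 * h)) ^+ 2 = 324 * (weight k * h) * h by ring.
rewrite [leRHS]mulrA; apply: ler_wpM2l; last by rewrite ler_peMl// ltW.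
by rewrite mulr_ge0 ?ler0n// mulr_ge0// ltW.
Qed.

(** If [|S z| < c] then by Harnack's inequality a whole dyadic cell of angles lies in a
    superlevel set, and [z] lies in the square attached to this cell. The squares of
    generation [k] have total area at most a constant times [2 ^ - k] times the length
    of the superlevel set. *)
Lemma area_condition_of_superlevel :
  (forall c0 : R, 0 < c0 -> exists B : R, forall J,
     (\sum_(k < J) (((1 / 2) `^ p)^-1 ^+ k.+1)%:E * lam (superlevel mu c0 k.+1) <= B%:E)%E) ->
  area_condition (1 + p) S.
Proof.
move=> hB c /andP[c0 c1].
have l0 : 0 < - ln c by rewrite oppr_gt0 ln_lt0// c0.
have l1 : 0 < - ln c / 1444 by apply: divr_gt0 => [//|]; rewrite ltr0n.
have [B hb] := hB _ l1.
set a := - ln c / 1444 in hb l1.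
apply: (@le_lt_trans _ _ (\int[lam2]_w (\sum_(k <oo) G a k.+1 w))%E).
  apply: le_integral_ge0.
  - by move=> w _; rewrite lee_fin invr_ge0 powR_ge0.
  - by move=> w _; apply: nneseries_ge0 => k _ _; exact: G_ge0.
  move=> [x y] /= [z1 zc] _; split=> //.
  set z : C R := x +i* y in z1 zc *.
  have [t t2 zE] := polar_form z.
  have r0 := cabs_ge0 z.
  have x01 : 0 < 1 - cabs z <= 1 by rewrite subr_gt0 z1 lerBlDr lerDl.
  have [k k0 hk] := dyadic_scale x01.
  have [i ik hi] := dyadic_index k t2.
  have hu : - ln c < u z.
    move: zc; rewrite cabs_singular_inner -[in X in _ < X](lnK c0) ltr_expR.
    by rewrite ltrNl.
  have gd : good a k i.
    apply/asboolP => s hs; split.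
      move: hs; rewrite /dyadic_cell/= in_itv/= => /andP[s1 s2].
      rewrite (le_trans (dyadic_angle_ge0 _ _) s1)/= (le_trans (ltW s2))//.
      exact: dyadic_angle_le.
    have rz : 0 <= cabs z < 1 by rewrite r0.
    have := harnack_dyadic k0 rz hk hi hs; rewrite -[polar (cabs z, t)]zE => h.
    rewrite /a ler_pdivrMr ?ltr0n// mulrC; exact: le_trans (ltW hu) h.
  have insq : plane_square (center k i) (9 * (1 / 2) ^+ k) (x, y).
    have dz : cabs (z - center k i) <= 9 * (1 / 2) ^+ k.
      have /andP[q0 q1] := radius01 (R := R) k.
      have q01 : 0 <= (dyadic_radius k : R) <= 1 by rewrite q0 ltW.
      rewrite {1}zE; apply: (le_trans (polar_dist _ _ _ q01)).
      have d1 : `|cabs z - dyadic_radius k| <= (1 / 2) ^+ k.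
        case/andP: hk; rewrite /dyadic_radius; set v := (1 / 2) ^+ k => h1 h2.
        by rewrite ler_norml; apply/andP; split; lra.
      have d2 : `|t - dyadic_angle k i| <= 8 * (1 / 2) ^+ k.
        move: hi; rewrite /dyadic_cell/= in_itv/= dyadic_angleS => /andP[t1 t3].
        have pi4 : 2 * pi * (1 / 2) ^+ k <= 8 * (1 / 2) ^+ k :> R.
          by rewrite ler_pM2r//; have := @pihalf_lt2 R; lra.
        move: t1 t3 pi4; set v := 2 * pi * _; set v' := dyadic_angle k i; set v'' := 8 * _.
        by move=> t1 t3 pi4; rewrite ler_norml; apply/andP; split; lra.
      by apply: (le_trans (lerD d1 d2)); rewrite le_eqVlt; apply/orP; left; apply/eqP; ring.
    apply/plane_squareP; split; apply: le_trans dz.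
      by have := ler_abs_Re (z - center k i); rewrite cReB.
    by have := ler_abs_Im (z - center k i); rewrite cImB.
  have hw : (((1 - cabs z) `^ (1 + p))^-1%:E <= G a k (x, y))%E.
    rewrite /G (bigD1 (Ordinal ik))//=.
    rewrite gd indicE mem_set// mulr1 (mul1r (weight k)) -[leLHS]adde0.
    apply: leeD; last by apply: sume_ge0 => j _; exact: term_ge0.
    case/andP: hk => h1 h2; case/andP: x01 => x0 _.
    rewrite lee_fin /weight lef_pV2 ?posrE ?powR_gt0//.
    have p1 : 0 <= 1 + p by case/andP: p01 => p0 _; rewrite addr_ge0// ltW.
    by apply: ge0_ler_powR => //; rewrite ?nnegrE; apply: ltW.
  apply: (le_trans hw).
  have := @nneseries_lim_ge R (fun n => G a n.+1 (x, y)) xpredT 0%N k.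
  move=> /(_ (fun n _ _ => G_ge0 _ _ _)); apply: le_trans.
  rewrite big_mkord; case: k k0 {hk hi ik gd insq} hw => // k _ hw.
  rewrite big_ord_recr/= -[leLHS]add0e leeD//.
  by apply: sume_ge0 => j _; exact: G_ge0.
rewrite integral_nneseries//; last by move=> n; exact: G_measurable.
apply: (@le_lt_trans _ _ (324 * B)%:E); last exact: ltry.
apply: lime_le.
  by apply: is_cvg_nneseries => n _ _; apply: integral_ge0 => w _; exact: G_ge0.
apply: nearW => n; rewrite big_mkord.
apply: (@le_trans _ _ (\sum_(k < n) (324%:E * ((((1 / 2) `^ p)^-1 ^+ k.+1)%:E *
   lam (superlevel mu a k.+1))))%E).
  by apply: lee_sum => k _; exact: G_mass.
rewrite -ge0_sume_distrr; last first.
  move=> k _; apply: mule_ge0 => //; rewrite lee_fin exprn_ge0// invr_ge0 powR_ge0//.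
by rewrite EFinM; apply: lee_wpmul2l; [rewrite lee_fin ler0n|exact: hb].
Qed.

End AreaBound.

(** * From the Hardy class to the area condition *)

Section HardyArea.
Context {R : realType}.

Lemma area_condition_of_hardy (mu : {finite_measure set (borelC R) -> \bar R}) (p : R) :
  0 < p < 1 / 2 -> singular_wrt_length mu ->
  hardy p (derive1 (singular_inner mu)) -> area_condition (1 + p) (singular_inner mu).
Proof.
move=> /andP[p0 p1] hsing [_ hH].
have p01 : 0 < p < 1 by rewrite p0/= (lt_trans p1)// ltr_pdivrMr// mul1r ltr1n.
pose f (r : R) : \bar R := (\int[@lebesgue_measure R]_(t in `[0%R, (2 * pi)%R])
  (cabs (derive1 (singular_inner mu) (polar (r, t))) `^ p)%:E)%E.
have [s hs hsup] : exists2 s : \bar R, (s < +oo)%E & forall r, 0 <= r < 1 -> (f r <= s)%E.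
  eexists; first exact: hH.
  by move=> r hr; apply: ereal_sup_ubound; exists r => //=; rewrite in_itv.
have s0 : (0 <= s)%E.
  apply: (@le_trans _ _ (f 0)); last by apply: hsup; rewrite lexx ltr01.
  by apply: integral_ge0 => t _; rewrite lee_fin powR_ge0.
have sK : s = (fine s)%:E by rewrite fineK// ge0_fin_numE.
apply: (area_condition_of_superlevel p01) => c0 c00.
apply: (superlevel_summable hsing p01 (K := fine s)) c00 => r hr.
by rewrite -sK; exact: hsup.
Qed.

End HardyArea.

(** * Dyadic arcs of the circle *)

(** A connected subset of the union meets only one of the pieces, since its trace on
    that piece is relatively open and has a relatively open complement. *)
Lemma connected_component_open_pieces (T : topologicalType) (I : Type) (L : set I)
    (A O : I -> set T) (U : set T) :
  U = \bigcup_(l in L) A l -> (forall l, L l -> open (O l)) ->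
  (forall l, L l -> A l = U `&` O l) -> (forall l, L l -> connected (A l)) ->
  (forall l l' x, L l -> L l' -> A l x -> A l' x -> l = l') ->
  forall l x, L l -> A l x -> connected_component U x = A l.
Proof.
move=> UE oO AE cA dA l x Ll Ax; apply/seteqP; split=> y.
  move=> [K [Kx KU cK] Ky].
  have KE : K `&` O l = K.
    apply: cK.
    - by exists x; split=> //; move: Ax; rewrite AE// => -[].
    - by exists (O l); [exact: oO|].
    exists (~` \bigcup_(l' in [set l' | L l' /\ l' <> l]) O l').
      apply: open_closedC; apply: bigcup_open => l' [Ll' _]; exact: oO.
    apply/seteqP; split=> z [Kz Oz]; split=> //.
      move=> [l' [Ll' ll'] Oz']; apply: ll'; apply: (dA _ _ z) => //.
        by rewrite AE//; split=> //; exact: KU.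
      by rewrite AE//; split=> //; exact: KU.
    have := KU _ Kz; rewrite UE => -[l' Ll' Az'].
    have [<-|ll'] := pselect (l' = l); first by move: Az'; rewrite AE// => -[].
    by exfalso; apply: Oz; exists l' => //; move: Az'; rewrite AE// => -[].
  by rewrite AE//; split; [exact: KU|move: Ky; rewrite -KE => -[]].
move=> Ay; apply: (@connected_component_max _ U (A l) x) => //; last exact: cA.
by move=> z Az; rewrite UE; exists l.
Qed.

Section Arcs.
Context {R : realType}.

Lemma closed_cis_segment (a b : R) : closed (cis @` `[a, b]).
Proof.
apply: compact_closed; first exact: (@norm_hausdorff (C R) (C R)).
apply: continuous_compact; last exact: segment_compact.
by apply: continuous_subspaceT; exact: continuous_cis.
Qed.

Lemma cisB2pi (t : R) : cis (t - 2 * pi) = cis t.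
Proof. by rewrite -[in RHS](subrK (2 * pi) t) [RHS]cisD cis_2pi mulr1. Qed.

(** An arc is open in the circle because its complement is a compact arc. *)
Lemma cis_open_itv (a b : R) : 0 <= a -> a < b -> b <= 2 * pi ->
  cis @` `]a, b[ = circle `&` ~` (cis @` `[b, a + 2 * pi]).
Proof.
move=> a0 ab b2; have pi0 := pi_gt0 R.
apply/seteqP; split=> z.
  move=> [t /=]; rewrite in_itv/= => /andP[t1 t2] <-; split; first exact: cabs_cis.
  move=> [s /=]; rewrite in_itv/= => /andP[s1 s2] e.
  have ht : 0 <= t < 2 * pi by apply/andP; split; lra.
  have [s3|s3] := ltP s (2 * pi).
    have st := cis_inj _ ht e; have : 0 <= s < 2 * pi by apply/andP; split; lra.
    by move/st => ?; lra.
  rewrite -cisB2pi in e; have st := cis_inj _ ht e.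
  have : 0 <= s - 2 * pi < 2 * pi by apply/andP; split; lra.
  by move/st => ?; lra.
move=> [/cis_surj[t /andP[t1 t2] ->] hz].
have [ta|ta] := leP t a.
  exfalso; apply: hz; exists (t + 2 * pi); last by rewrite -cisB2pi addrK.
  by rewrite /= in_itv/=; apply/andP; split; lra.
have [tb|tb] := leP b t; last by exists t => //=; rewrite in_itv/= ta.
by exfalso; apply: hz; exists t => //=; rewrite in_itv/=; apply/andP; split; lra.
Qed.

Lemma connected_cis_open_itv (a b : R) : connected (cis @` `]a, b[).
Proof.
apply: connected_continuous_connected.
  by apply/connected_intervalP; exact: interval_is_interval.
by apply: continuous_subspaceT; exact: continuous_cis.
Qed.

Lemma circle_length_cis_open_itv (a b : R) : 0 <= a -> a < b -> b <= 2 * pi ->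
  circle_length (cis @` `]a, b[) = (b - a)%:E.
Proof.
move=> a0 ab b2; rewrite /circle_length.
have -> : `[0%R, 2 * pi[%classic `&` cis @^-1` (cis @` `]a, b[) = `]a, b[%classic.
  apply/seteqP; split=> t /=; rewrite !in_itv/=.
    move=> [t2 [s]]; rewrite in_itv/= => /andP[s1 s2] e.
    have hs : 0 <= s < 2 * pi by apply/andP; split; lra.
    by rewrite -(cis_inj hs t2 e) s1.
  move=> /andP[t1 t2]; split; first by apply/andP; split; lra.
  by exists t => //=; rewrite in_itv/= t1.
by rewrite lebesgue_measure_itv/= lte_fin ab.
Qed.

Definition open_arc n i : set (C R) :=
  cis @` `]dyadic_angle n i, dyadic_angle n i.+1[.

Definition closed_arc n i : set (C R) :=
  cis @` `[dyadic_angle n i, dyadic_angle n i.+1].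

Lemma dyadic_angle_mono n i j : (i <= j)%N -> dyadic_angle n i <= dyadic_angle n j :> R.
Proof. by move=> ij; rewrite ler_pM2l ?dyadic_step_gt0// ler_nat. Qed.

Lemma dyadic_angle_lt n i : dyadic_angle n i < dyadic_angle n i.+1 :> R.
Proof. by rewrite dyadic_angleS ltrDl dyadic_step_gt0. Qed.

Lemma dyadic_angle_scale m n i : (m <= n)%N ->
  dyadic_angle n (i * 2 ^ (n - m)) = dyadic_angle m i :> R.
Proof.
move=> mn; rewrite /dyadic_angle -[in (1 / 2) ^+ n](subnKC mn) exprD.
have h : (1 / 2 : R) ^+ (n - m) * (2 ^ (n - m))%:R = 1.
  by rewrite natrX -exprMn divfK// expr1n.
rewrite natrM; set x := (1 / 2 : R) ^+ (n - m) in h *; set y := (2 ^ _)%:R in h *.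
by rewrite [i%:R * y]mulrC !mulrA -[_ * x * y]mulrA h mulr1.
Qed.

Lemma dyadic_nest m n i : (m <= n)%N ->
  dyadic_angle m (i %/ 2 ^ (n - m)) <= dyadic_angle n i :> R /\
  dyadic_angle n i.+1 <= dyadic_angle m (i %/ 2 ^ (n - m)).+1 :> R.
Proof.
move=> mn; rewrite -!(dyadic_angle_scale _ mn); split; apply: dyadic_angle_mono.
  exact: leq_divM.
by apply: ltn_ceil; rewrite expn_gt0.
Qed.

Lemma dyadic_ancestor_lt m n i : (m <= n)%N -> (i < 2 ^ n)%N ->
  (i %/ 2 ^ (n - m) < 2 ^ m)%N.
Proof. by move=> mn ?; rewrite ltn_divLR ?expn_gt0// -expnD subnKC. Qed.

Lemma measurable_closed_arc n i : measurable (closed_arc n i : set (borelC R)).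
Proof. by apply: measurable_closedC; exact: closed_cis_segment. Qed.

Lemma closed_arc_circle n i : closed_arc n i `<=` circle.
Proof. by move=> z [t _ <-]; exact: cabs_cis. Qed.

End Arcs.

(** * Heavy arcs *)

Section Squares.
Context {R : realType}.

Let half_pow_gt0 k : 0 < (1 / 2 : R) ^+ k.
Proof. by rewrite exprn_gt0// divr_gt0. Qed.

Definition mid_angle n i : R := dyadic_angle n i + pi * (1 / 2) ^+ n.

Definition arc_center n i : C R := polar (dyadic_radius n, mid_angle n i).

(** The side is comparable with the distance to the circle, and small enough for the
    squares of distinct arcs to be disjoint. *)
Definition arc_square n i : set (R * R) :=
  plane_square (arc_center n i) ((1 / 2) ^+ n / 16).

Lemma arc_square_dist n i x y : arc_square n i (x, y) ->
  cabs (((x +i* y)%C : C R) - arc_center n i) <= (1 / 2) ^+ n / 8.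
Proof.
move=> /plane_squareP[h1 h2]; apply: (le_trans (cabs_le_ReIm _)).
rewrite cReB cImB; apply: (le_trans (lerD h1 h2)).
by set h := _ ^+ n; lra.
Qed.

Lemma arc_square_modulus n i x y : arc_square n i (x, y) ->
  7 / 8 * (1 / 2) ^+ n <= 1 - cabs ((x +i* y)%C : C R) <= 9 / 8 * (1 / 2) ^+ n.
Proof.
move=> /arc_square_dist hd; have /andP[q0 _] := radius01 (R := R) n.
have cz : cabs (arc_center n i) = 1 - (1 / 2) ^+ n by rewrite /arc_center cabs_polar.
have h1 := le_trans (cabs_subr _ _) hd.
have h2 : cabs (arc_center n i) - cabs ((x +i* y)%C : C R) <= (1 / 2) ^+ n / 8.
  by apply: (le_trans (cabs_subr _ _)); rewrite cabsB.
move: h1 h2; rewrite cz; set h := _ ^+ n; set a := cabs _ => h1 h2.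
by apply/andP; split; lra.
Qed.

Lemma arc_square_level m n i j w : arc_square m i w -> arc_square n j w -> m = n.
Proof.
have key m' n' (a : R) : (m' < n')%N -> 7 / 8 * (1 / 2) ^+ m' <= a ->
    a <= 9 / 8 * (1 / 2) ^+ n' -> False.
  move=> mn h1 h2.
  have : (1 / 2 : R) ^+ n' <= (1 / 2) ^+ m'.+1.
    by apply: ler_wiXn2l mn; [rewrite divr_ge0|rewrite ler_pdivrMr// mul1r ler1n].
  rewrite exprS; have := half_pow_gt0 m'; move: h1 h2.
  by set b := _ ^+ m'; set c := _ ^+ n' => *; lra.
case: w => x y /arc_square_modulus/andP[h1 h2] /arc_square_modulus/andP[h3 h4].
case: (ltngtP m n) => // mn; exfalso; first exact: key mn h1 h4.
exact: key mn h3 h2.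
Qed.

Lemma cabs_cisB_ge_half (x y d : R) : 0 <= d -> d <= x - y -> x - y <= 2 * pi - d ->
  d / 4 <= cabs (cis x - cis y).
Proof.
move=> d0 h1 h2; have pi0 := pi_gt0 R.
have [h|h] := leP (x - y) pi.
  apply: (@le_trans _ _ (`|x - y| / 4)); first by rewrite ger0_norm; lra.
  by apply: cabs_cisB_ge; rewrite ger0_norm//; lra.
rewrite -(cisB2pi x).
have e : `|x - 2 * pi - y| = 2 * pi - (x - y) by rewrite ler0_norm; lra.
apply: (@le_trans _ _ (`|x - 2 * pi - y| / 4)); first by rewrite e; lra.
by apply: cabs_cisB_ge; rewrite e; lra.
Qed.

Lemma arc_square_disj n i j w : (0 < n)%N -> (i < 2 ^ n)%N -> (j < 2 ^ n)%N ->
  arc_square n i w -> arc_square n j w -> i = j.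
Proof.
move=> n0; have pi2 := @pi_ge2 R.
have h0 := half_pow_gt0 n.
have h1 : (1 / 2 : R) ^+ n <= 1 / 2.
  rewrite -[leRHS]expr1; apply: ler_wiXn2l n0; first by rewrite divr_ge0.
  by rewrite ler_pdivrMr// mul1r ler1n.
have key i' j' : (j' < i')%N -> (i' < 2 ^ n)%N ->
    arc_square n i' w -> arc_square n j' w -> False.
  case: w => x y ji i2 /arc_square_dist wi /arc_square_dist wj.
  have hd : cabs (arc_center n i' - arc_center n j') <= (1 / 2) ^+ n / 4.
    apply: (le_trans (cabs_dist _ _ (x +i* y)%C)); rewrite [in X in X + _]cabsB.
    by apply: (le_trans (lerD wi wj)); set h := _ ^+ n; lra.
  move: hd; rewrite /arc_center/polar/= -mulrBr cabsM cabs_real.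
  have /andP[q0 _] := radius01 (R := R) n; rewrite ger0_norm// => hd.
  have hs := dyadic_step_gt0 (R := R) n.
  have l1 : 2 * pi * (1 / 2) ^+ n <= mid_angle n i' - mid_angle n j'.
    rewrite /mid_angle opprD addrACA subrr addr0 lerBrDl -dyadic_angleS.
    exact: dyadic_angle_mono.
  have l2 : mid_angle n i' - mid_angle n j' <= 2 * pi - 2 * pi * (1 / 2) ^+ n.
    rewrite /mid_angle opprD addrACA subrr addr0 lerBrDr.
    have := dyadic_angle_ge0 (R := R) n j'; have := dyadic_angle_le (R := R) i2.
    rewrite dyadic_angleS; set a := dyadic_angle n i'; set b := dyadic_angle n j'.
    by set c := 2 * pi * _ => *; lra.
  have := cabs_cisB_ge_half (ltW hs) l1 l2.
  move: hd; rewrite /dyadic_radius; set c := cabs _ => hd hc.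
  have h2 : (1 / 2) ^+ n <= c.
    apply: le_trans hc; move: h0 pi2; set h := _ ^+ n; set q := pi => *; nra.
  have h3 : 1 / 2 * c <= (1 - (1 / 2) ^+ n) * c.
    apply: ler_wpM2r; first exact: le_trans (ltW h0) h2.
    by move: h1; set h := _ ^+ n; lra.
  by move: h0 h2 (le_trans h3 hd); set h := _ ^+ n => *; lra.
move=> i2 j2 wi wj; case: (ltngtP i j) => // ij; exfalso.
  exact: key ij j2 wj wi.
exact: key ij i2 wi wj.
Qed.

End Squares.

Section Heavy.
Context {R : realType}.
Local Notation lam2 := (@lebesgue_measure R \x @lebesgue_measure R)%E.
Variable mu : {finite_measure set (borelC R) -> \bar R}.
Local Notation S := (singular_inner mu).
Local Notation u := (poisson_integral mu).

Let half_pow_gt0 k : 0 < (1 / 2 : R) ^+ k.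
Proof. by rewrite exprn_gt0// divr_gt0. Qed.

(** From a point [z] of [arc_square n i] the arc is seen at distance at most
    [6 * 2 ^ - n] while [1 - |z| ^ 2 >= 2 ^ - n / 2]; hence the threshold [72]. *)
Definition heavy n i : bool := 72 * (1 / 2) ^+ n <= fine (mu (closed_arc n i)).

(** Below a heavy arc the Poisson integral is at least [1]: the arc is seen from a
    distance comparable with its length. *)
Lemma singular_inner_heavy n i x y : heavy n i -> arc_square n i (x, y) ->
  cabs (S ((x +i* y)%C : C R)) < 1 / 2.
Proof.
set z : C R := (x +i* y)%C.
move=> hv hw; have h0 := half_pow_gt0 n.
have /andP[m1 m2] := arc_square_modulus hw; rewrite -/z in m1 m2.
have z1 : cabs z < 1.
  by move: h0 m1; set h := _ ^+ n => *; lra.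
have hp zeta : closed_arc n i zeta -> (72 * (1 / 2) ^+ n)^-1 <= poisson zeta z.
  move=> [t /=]; rewrite in_itv/= dyadic_angleS => /andP[t1 t2] <-.
  have d0 : cabs (cis t - z) <= 6 * (1 / 2) ^+ n.
    have d1 : cabs (cis t - cis (mid_angle n i)) <= 4 * (1 / 2) ^+ n.
      apply: (le_trans (cabs_cisB_le _ _)); rewrite /mid_angle.
      apply: (@le_trans _ _ (pi * (1 / 2) ^+ n)); last first.
        by rewrite ler_pM2r//; have := @pihalf_lt2 R; lra.
      move: t1 t2; rewrite -[2 * pi * _]mulrA; set a := pi * _; set b := dyadic_angle n i.
      by move=> t1 t2; rewrite ler_norml; apply/andP; split; lra.
    have d2 : cabs (cis (mid_angle n i) - arc_center n i) <= (1 / 2 : R) ^+ n.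
      have pE : polar (1 : R, mid_angle n i : R) = cis (mid_angle n i) := mul1r _.
      have /andP[q0 q1] := radius01 (R := R) n.
      have q01 : 0 <= (dyadic_radius n : R) <= 1 by rewrite q0 ltW.
      have pd := polar_dist 1 (mid_angle n i) (mid_angle n i) q01; rewrite pE in pd.
      apply: (le_trans pd); rewrite subrr normr0 addr0.
      by rewrite /dyadic_radius opprB addrCA subrr addr0 ger0_norm// ltW.
    have d3 := arc_square_dist hw; rewrite -/z cabsB in d3.
    apply: (le_trans (cabs_dist _ _ (arc_center n i))).
    apply: (le_trans (lerD (cabs_dist _ _ (cis (mid_angle n i))) d3)).
    by move: h0 d1 d2; set h := _ ^+ n; set a := cabs _; set b := cabs _ => *; lra.
  have ci : circle (cis t : C R) by exact: cabs_cis.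
  have dpos : 0 < cabs (cis t - z).
    by apply: lt_le_trans (dist_circle z ci); rewrite subr_gt0.
  rewrite /poisson; have z0 := cabs_ge0 z.
  have n1 : 7 / 8 * (1 / 2) ^+ n <= 1 - cabs z ^+ 2.
    apply: (le_trans m1); rewrite lerD2l lerN2 expr2.
    by rewrite -[leRHS]mul1r ler_wpM2r// ltW.
  have n2 : cabs (cis t - z) ^+ 2 <= 36 * (1 / 2) ^+ n ^+ 2.
    have -> : 36 * (1 / 2) ^+ n ^+ 2 = (6 * (1 / 2) ^+ n) ^+ 2 :> R by ring.
    by rewrite ler_sqr ?nnegrE ?cabs_ge0// mulr_ge0 ?ler0n// ltW.
  rewrite ler_pdivlMr ?exprn_gt0// ler_pdivrMl ?mulr_gt0 ?ltr0n//.
  apply: (le_trans n2); apply: (@le_trans _ _ (72 * (1 / 2) ^+ n * (7 / 8 * (1 / 2) ^+ n))).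
    by move: h0; set h := _ ^+ n => h0; nra.
  by apply: ler_wpM2l => //; rewrite mulr_ge0 ?ler0n// ltW.
have := poisson_integral_ge mu (measurable_closed_arc n i) (@closed_arc_circle R n i) z1 hp.
have h72 : 0 < 72 * (1 / 2 : R) ^+ n by rewrite mulr_gt0 ?ltr0n.
move=> hu; have u1 : 1 <= u z.
  by apply: le_trans hu; rewrite ler_pdivlMl// mulr1.
rewrite cabs_singular_inner; apply: (@le_lt_trans _ _ (expR (- 1))).
  by rewrite ler_expR lerN2.
rewrite expRN div1r ltf_pV2 ?posrE ?expR_gt0//.
by have := @expR_gt1Dx R 1 (oner_neq0 _).
Qed.

Variable p : R.
Hypothesis p01 : 0 < p < 1.

Let weight k : R := ((2 * (1 / 2) ^+ k) `^ (1 + p))^-1.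

Let weight_ge0 k : 0 <= weight k.
Proof. by rewrite invr_ge0 powR_ge0. Qed.

Let term (k i : nat) (w : R * R) : \bar R :=
  ((heavy k.+1 i)%:R * weight k.+1 * \1_(arc_square k.+1 i) w)%:E.

Let term_ge0 k i w : (0 <= term k i w)%E.
Proof. by rewrite lee_fin mulr_ge0 ?indicE// mulr_ge0. Qed.

Let term_measurable k i : measurable_fun setT (term k i).
Proof.
apply/measurable_EFinP; apply: measurable_funM => //.
by apply: measurable_indic; exact: measurable_plane_square.
Qed.

Let G M (w : R * R) : \bar R := (\sum_(k < M) \sum_(i < 2 ^ k.+1) term k i w)%E.

Let term_out k i w : ~ (heavy k.+1 i /\ arc_square k.+1 i w) -> term k i w = 0%E.
Proof.
move=> h; rewrite /term; case hv : (heavy _ _) h => h; last by rewrite !mul0r.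
by rewrite indicE memNset ?mulr0// => hw; apply: h.
Qed.

Let G_le M k i w : (i < 2 ^ k.+1)%N -> arc_square k.+1 i w ->
  (G M w <= (weight k.+1)%:E)%E.
Proof.
move=> ik hw.
have out (k' : nat) (i' : 'I_(2 ^ k'.+1)) : (k', nat_of_ord i') != (k, i) -> term k' i' w = 0%E.
  move=> ne; apply: term_out => -[_ hw'].
  have [kk] : k'.+1 = k.+1 := arc_square_level hw' hw.
  move/eqP: ne; apply; move: i' hw'; rewrite kk => i' hw'.
  by rewrite (arc_square_disj (ltn0Sn k) (ltn_ord i') ik hw' hw).
have single : (term k i w <= (weight k.+1)%:E)%E.
  rewrite lee_fin -[leRHS]mulr1; apply: ler_pM.
  - by rewrite mulr_ge0.
  - by rewrite indicE.
  - by rewrite -[leRHS]mul1r ler_wpM2r//; case: (heavy _ _).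
  - by rewrite indicE; case: (_ \in _).
have w0 : (0 <= (weight k.+1)%:E)%E by rewrite lee_fin.
have [kM|kM] := ltnP k M; last first.
  rewrite /G big1// => k' _; apply: big1 => i' _; apply: out.
  by apply/eqP => -[e _]; move: (ltn_ord k'); rewrite e ltnNge kM.
rewrite /G (bigD1 (Ordinal kM))//= (bigD1 (Ordinal ik))//=.
rewrite !big1 ?adde0//.
  move=> k' kk'; apply: big1 => i' _; apply: out; apply/eqP => -[e _].
  by move/eqP: kk'; apply; exact: val_inj.
by move=> i' ii'; apply: out; apply/eqP => -[e]; move/eqP: ii'; apply; exact: val_inj.
Qed.

(** The squares of heavy arcs are disjoint and contained in a sublevel set of [|S|];
    each contributes a constant times [2 ^ - (n (1 - p))] to the area integral. *)
Lemma heavy_count : area_condition (1 + p) S -> exists B : R, forall M,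
  \sum_(k < M) \sum_(i < 2 ^ k.+1) (heavy k.+1 i)%:R * ((1 / 2) ^+ k.+1) `^ (1 - p) <= B.
Proof.
have [d0 d1] : (0 : R) < 1 / 2 /\ (1 / 2 : R) < 1 by split; lra.
have c01 : 0 < (1 / 2 : R) < 1 by rewrite d0 d1.
move=> /(_ _ c01) hA.
set I := area_integral _ _ in hA.
have hI M : (\int[lam2]_w G M w <= I)%E.
  rewrite /I /area_integral; apply: le_integral_ge0.
  - by move=> w _; apply: sume_ge0 => k _; apply: sume_ge0 => i _; exact: term_ge0.
  - by move=> w _; rewrite lee_fin invr_ge0 powR_ge0.
  move=> [x y] _ G0.
  have [[k [i [hv hw]]]|none] := pselect (exists (k : 'I_M) (i : 'I_(2 ^ k.+1)),
      heavy k.+1 i /\ arc_square k.+1 i (x, y)); last first.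
    exfalso; move: G0; rewrite /G big1 ?ltxx// => k _; apply: big1 => i _.
    by apply: term_out => h; apply: none; exists k, i.
  have hS := singular_inner_heavy hv hw.
  have /andP[m1 m2] := arc_square_modulus hw.
  have h0 := half_pow_gt0 k.+1.
  have z1 : 0 < 1 - cabs ((x +i* y)%C : C R).
    by apply: lt_le_trans m1; rewrite mulr_gt0// divr_gt0 ?ltr0n.
  split; first by split=> //; move: z1; rewrite subr_gt0.
  apply: (le_trans (G_le M (ltn_ord i) hw)).
  rewrite lee_fin lef_pV2 ?posrE ?powR_gt0 ?mulr_gt0 ?ltr0n//.
  have p1 : 0 <= 1 + p by case/andP: p01 => p0 _; rewrite addr_ge0// ltW.
  apply: ge0_ler_powR => //; rewrite ?nnegrE; first exact: ltW.
    by rewrite mulr_ge0// ltW.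
  by apply: (le_trans m2); move: h0; set h := _ ^+ k.+1 => h0; lra.
pose c : R := (2 `^ (1 + p))^-1 / 64.
have c0 : 0 < c by rewrite divr_gt0 ?ltr0n// invr_gt0 powR_gt0.
exists (fine I / c) => M.
have I0 : (0 <= I)%E.
  by apply: integral_ge0 => w _; rewrite lee_fin invr_ge0 powR_ge0.
have IE : I = (fine I)%:E by rewrite fineK// ge0_fin_numE.
rewrite ler_pdivlMr// -lee_fin -IE; apply: le_trans (hI M).
rewrite /G ge0_integral_sum//; last 2 first.
- by move=> k; apply: emeasurable_sum => i; exact: term_measurable.
- by move=> k w _; apply: sume_ge0 => i _; exact: term_ge0.
rewrite mulr_suml -sumEFin; apply: lee_sum => k _.
rewrite ge0_integral_sum//; last by move=> i; exact: term_measurable.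
rewrite mulr_suml -sumEFin; apply: lee_sum => i _.
set h := (1 / 2 : R) ^+ k.+1; have h0 : 0 < h := half_pow_gt0 k.+1.
have e0 : 0 <= 2 * (h / 16) by rewrite mulr_ge0 ?divr_ge0 ?ler0n// ltW.
have := @integral_cst_square R (complex.Re (arc_center k.+1 i) - h / 16)
  (complex.Im (arc_center k.+1 i) - h / 16) _ ((heavy k.+1 i)%:R * weight k.+1) e0.
rewrite [X in X = _ -> _]integral_mkcond => hE.
rewrite le_eqVlt; apply/orP; left; apply/eqP.
transitivity (((heavy k.+1 i)%:R * weight k.+1 * (2 * (h / 16)) ^+ 2)%:E); last first.
  rewrite -hE; apply: eq_integral => w _; rewrite /term indicE /patch.
  have [hw|hw] := pselect (arc_square k.+1 i w).
    have e : (w \in arc_square k.+1 i) = true := mem_set hw.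
    by rewrite e mulr1.
  have e : (w \in arc_square k.+1 i) = false := memNset hw.
  by rewrite e mulr0.
congr EFin; rewrite -[LHS]mulrA -[RHS]mulrA; congr (_ * _).
have two0 : (0 : R) <= 2 by rewrite ler0n.
rewrite /weight -/h /c powRM ?ltW//.
have hh : h `^ (1 - p) = h ^+ 2 * (h `^ (1 + p))^-1.
  apply: (mulIf (x := h `^ (1 + p))); first by rewrite gt_eqF// powR_gt0.
  rewrite -powRD; last by rewrite (gt_eqF h0) implybT.
  rewrite mulfVK ?gt_eqF ?powR_gt0// -powR_mulrn ?ltW//; congr (_ `^ _); ring.
rewrite hh invfM; set a := (h `^ _)^-1; set b := (2 `^ _)^-1.
have -> : (2 * (h / 16)) ^+ 2 = h ^+ 2 / 64 by field.
ring.
Qed.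

End Heavy.

(** * Stopped arcs and Beurling-Carleson sets *)

(** A finite set of dyadic arcs involves finitely many generations. *)
Lemma esum_dyadic_le (R : realType) (L : nat * nat -> bool) (w : nat -> R) (B : R) :
  (forall n, 0 <= w n) -> (forall l, L l -> (l.2 < 2 ^ l.1)%N) ->
  (forall M, \sum_(n < M) \sum_(i < 2 ^ n) (L (val n, val i))%:R * w n <= B) ->
  (\esum_(l in [set l | L l]) (w l.1)%:E <= B%:E)%E.
Proof.
move=> w0 hL hB; apply: ge_ereal_sup => _ [X [finX XL] <-].
rewrite fsbig_finite//= sumEFin lee_fin; set s : seq (nat * nat) := finmap.enum_fset (fset_set X).
pose M := (\max_(l <- s) l.1).+1.
apply: le_trans (hB M).
pose s' := [seq (n, i) | n <- index_iota 0 M, i <- index_iota 0 (2 ^ n)].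
have -> : \sum_(n < M) \sum_(i < 2 ^ n) (L (val n, val i))%:R * w n =
    \sum_(l <- s') (L l)%:R * w l.1.
  rewrite /s' big_allpairs_dep big_mkord; apply: eq_bigr => n _.
  by rewrite big_mkord.
have us' : uniq s'.
  apply: allpairs_uniq_dep; first exact: iota_uniq.
    by move=> n _; exact: iota_uniq.
  by move=> [a b] [c d] _ _ /= [-> ->].
have ss' l : l \in s -> (l \in s') && L l.
  move=> ls; have lX : X l by apply/set_mem; rewrite -(in_fset_set finX).
  have Ll : L l := XL _ lX.
  rewrite Ll andbT; apply/allpairsPdep; exists l.1, l.2; split=> //; last by case: (l).
    by rewrite mem_index_iota/= /M ltnS; apply: leq_bigmax_seq.
  by rewrite mem_index_iota/= hL.
have ps : perm_eq s [seq l <- s' | l \in s].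
  apply: uniq_perm; [exact: finmap.fset_uniq|exact: filter_uniq|].
  move=> l; rewrite mem_filter; case hl : (l \in s) => //=.
  by case/andP: (ss' _ hl) => ->.
rewrite (perm_big _ ps) big_filter big_mkcond/=; apply: ler_sum => l _.
case: ifP => [/ss'/andP[_ ->]|_]; first by rewrite mul1r.
by rewrite mulr_ge0.
Qed.

Lemma sum_half (R : realType) (F : nat -> R) m :
  \sum_(i < m.*2) F (i %/ 2)%N = 2 * \sum_(j < m) F j.
Proof.
elim: m => [|m IH]; first by rewrite !big_ord0 mulr0.
rewrite doubleS !big_ord_recr/= IH mulrDr -addrA; congr (_ + _).
have -> : (m.*2 %/ 2 = m)%N by rewrite divn2 doubleK.
have -> : (m.*2.+1 %/ 2 = m)%N by rewrite divn2 /= uphalf_double.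
by rewrite mulr_natl mulr2n.
Qed.

Section Stopped.
Context {R : realType}.
Local Notation lam := (@lebesgue_measure R).
Variable mu : {finite_measure set (borelC R) -> \bar R}.

Let half_pow_gt0 k : 0 < (1 / 2 : R) ^+ k.
Proof. by rewrite exprn_gt0// divr_gt0. Qed.

(** A descent through heavy arcs that begins at generation [N] stops at such an arc. *)
Definition stopped N (l : nat * nat) : bool :=
  [&& (N <= l.1)%N, (l.2 < 2 ^ l.1)%N, ~~ heavy mu l.1 l.2 &
      [forall m : 'I_l.1, (N <= m)%N ==> heavy mu m (l.2 %/ 2 ^ (l.1 - m))]].

Definition unstopped_set N : set (C R) :=
  circle `\` \bigcup_(l in [set l | stopped N l]) open_arc l.1 l.2.

Lemma stopped_heavy N n i m : stopped N (n, i) -> (N <= m < n)%N ->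
  heavy mu m (i %/ 2 ^ (n - m)).
Proof.
by move=> /and4P[_ _ _ /forallP h] /andP[Nm mn]; have := h (Ordinal mn); rewrite /= Nm.
Qed.

Lemma open_arc_angle n i (z : C R) : (i < 2 ^ n)%N -> open_arc n i z ->
  exists t : R, [/\ 0 <= t < 2 * pi, z = cis t &
    dyadic_angle n i < t < dyadic_angle n i.+1].
Proof.
move=> ni [t /=]; rewrite in_itv/= => /andP[t1 t2] <-; exists t; split=> //.
  by rewrite (le_trans (dyadic_angle_ge0 _ _) (ltW t1)) (lt_le_trans t2)// dyadic_angle_le.
by rewrite t1.
Qed.

Lemma stopped_disj N l l' z : stopped N l -> stopped N l' ->
  open_arc l.1 l.2 z -> open_arc l'.1 l'.2 (z : C R) -> l = l'.
Proof.
have key n i n' i' : (n <= n')%N -> stopped N (n, i) -> stopped N (n', i') ->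
    open_arc n i z -> open_arc n' i' z -> (n, i) = (n', i').
  move=> nn h h'; have /and4P[/= Nn i2 li _] := h; have /and4P[/= _ i2' _ _] := h'.
  move=> /(open_arc_angle i2)[t [t2 -> /andP[ti1 ti2]]].
  move=> /(open_arc_angle i2')[t' [t2' e /andP[tj1 tj2]]].
  move: tj1 tj2; rewrite -(cis_inj t2 t2' e) => tj1 tj2.
  have [a1 a2] := dyadic_nest (R := R) i' nn.
  have ii : i = (i' %/ 2 ^ (n' - n))%N.
    have d1 : dyadic_cell n i t by rewrite /dyadic_cell/= in_itv/= (ltW ti1).
    apply: dyadic_cell_disj d1 _.
    by rewrite /dyadic_cell/= in_itv/= (le_trans a1 (ltW tj1)) (lt_le_trans tj2 a2).
  move: nn; rewrite leq_eqVlt => /predU1P[nn|nn].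
    by move: ii; rewrite nn subnn divn1 => ->.
  by have := stopped_heavy h' (introT andP (conj Nn nn)); rewrite -ii (negbTE li).
case: l l' => n i [n' i'] h h' /= zl zl'.
by case: (leqP n n') => [nn|/ltnW nn]; [|apply/esym]; apply: key.
Qed.

(** Among the ancestors of a light arc, the first light one is stopped. *)
Lemma first_stopped N n i (t : R) : (N <= n)%N -> (i < 2 ^ n)%N -> ~~ heavy mu n i ->
  dyadic_angle n i < t < dyadic_angle n i.+1 ->
  exists2 l, stopped N l & open_arc l.1 l.2 (cis t).
Proof.
move=> Nn i2 li /andP[t1 t2].
have ex : exists m, [&& (N <= m)%N, (m <= n)%N & ~~ heavy mu m (i %/ 2 ^ (n - m))].
  by exists n; rewrite Nn leqnn subnn divn1.
case: (ex_minnP ex) => m /and3P[Nm mn lm] hmin.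
exists (m, (i %/ 2 ^ (n - m))%N).
  apply/and4P; split=> //=; first exact: dyadic_ancestor_lt.
  apply/forallP => k; apply/implyP => Nk; apply/negPn/negP.
  rewrite -divnMA -expnD => hk.
  have km := ltn_ord k.
  have e : (n - m + (m - k) = n - k)%N by rewrite addnBA 1?ltnW// subnK.
  have := hmin k; rewrite Nk (leq_trans (ltnW km) mn) -e hk => /(_ isT).
  by rewrite leqNgt km.
have [a1 a2] := dyadic_nest (R := R) i mn.
by exists t => //=; rewrite in_itv/= (le_lt_trans a1 t1) (lt_le_trans t2 a2).
Qed.

Let arc_compl n i : set (C R) :=
  ~` (cis @` `[dyadic_angle n i.+1, dyadic_angle n i + 2 * pi]).

Let open_arcE n i : (i < 2 ^ n)%N -> open_arc n i = circle `&` arc_compl n i.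
Proof.
move=> i2; apply: cis_open_itv; [exact: dyadic_angle_ge0|exact: dyadic_angle_lt|].
exact: dyadic_angle_le.
Qed.

Let open_arc_compl n i : open (arc_compl n i).
Proof. by apply: closed_openC; exact: closed_cis_segment. Qed.

Lemma closed_unstopped_set N : closed (unstopped_set N).
Proof.
have -> : unstopped_set N =
    circle `&` ~` (\bigcup_(l in [set l | stopped N l]) arc_compl l.1 l.2).
  apply/seteqP; split=> z [cz hz]; split=> // -[l hl zl]; apply: hz; exists l => //.
    have /and4P[_ i2 _ _] := hl; by rewrite open_arcE.
  by have /and4P[_ i2 _ _] := hl; move: zl; rewrite open_arcE// => -[].
apply: closedI; first exact: closed_circle.
by apply: open_closedC; apply: bigcup_open => l _; exact: open_arc_compl.
Qed.

Let complE N : circle `\` unstopped_set N =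
  \bigcup_(l in [set l | stopped N l]) (open_arc l.1 l.2 : set (C R)).
Proof.
rewrite /unstopped_set setDD; apply/seteqP; split=> z; first by case.
move=> [l hl zl]; split; last by exists l.
by have /and4P[_ i2 _ _] := hl; move: zl; rewrite open_arcE// => -[].
Qed.

(** The stopped arcs are disjoint, connected and open in the circle. *)
Lemma complementary_arcs_unstopped N :
  set_bij [set l | stopped N l] (complementary_arcs (unstopped_set N))
    (fun l => open_arc l.1 l.2).
Proof.
have cc l z : stopped N l -> open_arc l.1 l.2 z ->
    connected_component (circle `\` unstopped_set N) z = open_arc l.1 l.2.
  apply: (@connected_component_open_pieces _ _ [set l | stopped N l]
    (fun l => open_arc l.1 l.2) (fun l => arc_compl l.1 l.2)).
  - exact: complE.
  - by move=> ? _; exact: open_arc_compl.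
  - move=> l' hl'; have /and4P[_ i2 _ _] := hl'.
    rewrite complE; apply/seteqP; split=> y.
      by move=> yl; split; [exists l'|move: yl; rewrite open_arcE// => -[]].
    move=> [[l2 hl2 yl2] yc]; rewrite open_arcE//; split=> //.
    by have /and4P[_ i2' _ _] := hl2; move: yl2; rewrite open_arcE// => -[].
  - by move=> ? _; exact: connected_cis_open_itv.
  - by move=> ? ? ? h1 h2; exact: stopped_disj h1 h2.
have inhab n i : exists z : C R, open_arc n i z.
  have h := dyadic_angle_lt (R := R) n i.
  exists (cis ((dyadic_angle n i + dyadic_angle n i.+1) / 2)).
  exists ((dyadic_angle n i + dyadic_angle n i.+1) / 2) => //=.
  by rewrite in_itv/= !midf_lt.
split.
- move=> l hl; have [z zl] := inhab l.1 l.2.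
  exists z; last exact: cc.
  by rewrite complE; exists l.
- move=> l l' /set_mem hl /set_mem hl' e; have [z zl] := inhab l.1 l.2.
  by apply: (stopped_disj hl hl' zl); rewrite -e.
- move=> _ [z + <-]; rewrite complE => -[l hl zl]; exists l => //.
  by rewrite -complE; apply/esym; exact: cc.
Qed.

Variables (p B : R).
Hypothesis p01 : 0 < p < 1.
Hypothesis hB : forall M,
  \sum_(k < M) \sum_(i < 2 ^ k.+1) (heavy mu k.+1 i)%:R * ((1 / 2) ^+ k.+1) `^ (1 - p) <= B.

Let w n : R := ((1 / 2) ^+ n) `^ (1 - p).

Let w_ge0 n : 0 <= w n. Proof. exact: powR_ge0. Qed.

Let b n : R := \sum_(i < 2 ^ n) (heavy mu n i)%:R * w n.

Let b_ge0 n : 0 <= b n.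
Proof. by apply: sumr_ge0 => i _; rewrite mulr_ge0. Qed.

Let a N n : R := \sum_(i < 2 ^ n) (stopped N (n, val i))%:R * w n.

Let a_ge0 N n : 0 <= a N n.
Proof. by apply: sumr_ge0 => i _; rewrite mulr_ge0. Qed.

(** Every stopped arc past the first generation has a heavy parent, and a parent has
    two children. *)
Let a_le N n : (N <= n)%N -> a N n.+1 <= 2 * b n.
Proof.
move=> Nn; rewrite /b -(sum_half (fun j => (heavy mu n j)%:R * w n)) /a expnS mul2n.
apply: ler_sum => i _.
have ww : w n.+1 <= w n.
  apply: ge0_ler_powR; rewrite ?nnegrE ?(ltW (half_pow_gt0 _))//.
    by rewrite subr_ge0; case/andP: p01 => _ /ltW.
  rewrite exprS; have := half_pow_gt0 n; set h := _ ^+ n => h0; lra.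
have [h|_] := boolP (stopped _ _); last by rewrite mul0r mulr_ge0.
have /(_ n) := stopped_heavy h; rewrite Nn ltnSn => /(_ isT).
by rewrite subSnn expn1 => ->; rewrite !mul1r.
Qed.

(** The generations up to [N.+1] are finitely many; later ones are controlled by the
    heavy arcs of the preceding generation. *)
Lemma stopped_sum N : exists D, forall M, \sum_(n < M) a N.+1 n <= D.
Proof.
exists (\sum_(n < N.+2) a N.+1 n + 2 * B) => M.
apply: (@le_trans _ _ (\sum_(n < N.+2 + M) a N.+1 n)).
  rewrite [in leRHS]addnC big_split_ord/= lerDl.
  by apply: sumr_ge0 => i _; exact: a_ge0.
have key j : \sum_(n < N.+2 + j) a N.+1 n <=
    \sum_(n < N.+2) a N.+1 n + 2 * \sum_(k < N + j) b k.+1.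
  elim: j => [|j IH].
    by rewrite addn0 lerDl mulr_ge0// sumr_ge0.
  have aS m : \sum_(n < m.+1) a N.+1 n = \sum_(n < m) a N.+1 n + a N.+1 m.
    by rewrite big_ord_recr.
  have bS m : \sum_(k < m.+1) b k.+1 = \sum_(k < m) b k.+1 + b m.+1.
    by rewrite big_ord_recr.
  rewrite !addnS (aS (N.+2 + j)%N) (bS (N + j)%N) mulrDr addrA; apply: lerD => //.
  by apply: (@a_le N.+1 (N + j).+1); rewrite ltnS leq_addr.
apply: (le_trans (key M)); rewrite lerD2l ler_wpM2l//.
Qed.

Lemma arc_sum_unstopped N :
  (\esum_(J in complementary_arcs (unstopped_set N.+1))
    (circle_length J `^ (1 - p))%E < +oo)%E.
Proof.
rewrite (reindex_esum _ _ _ _ (complementary_arcs_unstopped N.+1)).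
have [D hD] := stopped_sum N.
pose c : R := (2 * pi) `^ (1 - p); have c0 : 0 <= c by exact: powR_ge0.
apply: (@le_lt_trans _ _ (\esum_(l in [set l | stopped N.+1 l]) ((c * w l.1)%:E))%E).
  apply: le_esum => -[n i] hl; have /and4P[_ /= i2 _ _] := hl.
  rewrite circle_length_cis_open_itv ?dyadic_angle_ge0 ?dyadic_angle_lt ?dyadic_angle_le//.
  rewrite dyadic_angleS addrAC subrr add0r poweR_EFin lee_fin powRM//.
    by rewrite mulr_ge0// pi_ge0.
apply: (@le_lt_trans _ _ (c * D)%:E); last exact: ltry.
apply: (esum_dyadic_le (w := fun n => c * w n)); first by move=> n; rewrite mulr_ge0.
  by move=> l /and4P[].
move=> M; apply: le_trans (ler_wpM2l c0 (hD M)).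
rewrite big_distrr/=; apply: ler_sum => n _; rewrite big_distrr/=.
by apply: ler_sum => i _; rewrite mulrCA.
Qed.

Lemma measurable_unstopped_set N : measurable (unstopped_set N : set (borelC R)).
Proof. by apply: measurable_closedC; exact: closed_unstopped_set. Qed.

Let angles : set R := (fun l : nat * nat => dyadic_angle l.1 l.2) @` setT.

Let angles_null : lam angles = 0%E.
Proof.
apply: countable_lebesgue_measure0; apply: (sub_countable (card_image_le _ _)).
exact: countableP.
Qed.

Let measurable_angles : measurable angles.
Proof.
apply: countable_measurable; first by move=> *; exact: measurable_set1.
apply: (sub_countable (card_image_le _ _)); exact: countableP.
Qed.

(** Off the dyadic angles, a point of the set lies in a heavy arc of every generation,
    and the heavy arcs of a late generation are few. *)
Lemma circle_length_unstopped N : circle_length (unstopped_set N.+1) = 0%E.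
Proof.
rewrite /circle_length; set A := _ `&` _.
have mA : measurable A.
  apply: measurableI; first exact: measurable_itv.
  rewrite -[X in measurable X]setTI; apply: measurable_cis => //.
  exact: measurable_unstopped_set.
have hA k : (N <= k)%N -> (lam A <= (2 * pi * B * ((1 / 2) `^ p) ^+ k.+1)%:E)%E.
  move=> Nk.
  pose F i := if heavy mu k.+1 i then (dyadic_cell k.+1 i : set R) else set0.
  have mF i : measurable (F i).
    by rewrite /F; case: ifP => _; [exact: measurable_itv|exact: measurable0].
  have mFF : measurable (\big[setU/set0]_(i < 2 ^ k.+1) F i).
    by apply: bigsetU_measurable => i _; exact: mF.
  have AF : A `<=` angles `|` \big[setU/set0]_(i < 2 ^ k.+1) F i.
    move=> t [/=]; rewrite in_itv/= => t2 [_ ht].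
    have [i i2 hi] := dyadic_index k.+1 t2.
    have [hv|li] := boolP (heavy mu k.+1 i).
      by right; rewrite -bigcup_mkord; exists i => //; rewrite /F hv.
    left; apply: contrapT => na; apply: ht.
    have [l hl tl] : exists2 l, stopped N.+1 l & open_arc l.1 l.2 (cis t).
      apply: (first_stopped (n := k.+1)) i2 li _ => //.
      move: hi; rewrite /dyadic_cell/= in_itv/= => /andP[t1 ->]; rewrite andbT.
      rewrite lt_neqAle t1 andbT; apply/eqP => e; apply: na.
      by exists (k.+1, i).
    by exists l.
  apply: (@le_trans _ _ (lam (angles `|` \big[setU/set0]_(i < 2 ^ k.+1) F i))).
    by apply: le_measure => //; rewrite inE//; exact: measurableU.
  have h1 := @measureU2 _ _ _ lam _ _ measurable_angles mFF.
  apply: (le_trans h1); rewrite [X in (X + _)%E]angles_null add0e.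
  apply: (le_trans (Boole_inequality lam (n := 2 ^ k.+1) (fun i _ => mF i))).
  apply: (@le_trans _ _ (\sum_(i < 2 ^ k.+1)
      ((heavy mu k.+1 i)%:R * (2 * pi * (1 / 2) ^+ k.+1))%:E)%E).
    apply: lee_sum => i _; rewrite /F; case: ifP => _.
      by rewrite (mul1r (2 * pi * _)) [leLHS]lebesgue_dyadic_cell.
    by rewrite mul0r [leLHS]measure0.
  rewrite sumEFin lee_fin.
  have bB : b k.+1 <= B.
    apply: le_trans (hB k.+1); rewrite big_ord_recr/= lerDr.
    by apply: sumr_ge0 => j _; exact: b_ge0.
  set h := (1 / 2 : R) ^+ k.+1; have h0 : 0 < h := half_pow_gt0 k.+1.
  have hh : h = w k.+1 * ((1 / 2) `^ p) ^+ k.+1.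
    rewrite -powR_expn ?divr_ge0// /w -/h -powRD; last by rewrite (gt_eqF h0) implybT.
    by rewrite subrK powRr1// ltW.
  have tp : 0 <= 2 * pi :> R by rewrite mulr_ge0// pi_ge0.
  have q0 : 0 <= ((1 / 2 : R) `^ p) ^+ k.+1 by rewrite exprn_ge0// powR_ge0.
  rewrite -[leRHS]mulrA; apply: le_trans (ler_wpM2l tp (ler_wpM2r q0 bB)).
  rewrite /b big_distrl/= big_distrr/=; apply: ler_sum => i _.
  by rewrite {1}hh mulrCA (mulrA (_%:R)).
apply/eqP; rewrite eq_le measure_ge0 andbT; apply/lee_addgt0Pr => e e0; rewrite add0e.
have q1 : `|(1 / 2 : R) `^ p| < 1.
  have [p0 _] := andP p01; rewrite ger0_norm ?powR_ge0//.
  have h : (0 : R) < 1 / 2 by rewrite divr_gt0.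
  apply: (@lt_le_trans _ _ (1 `^ p)); last by rewrite powR1.
  by apply: gt0_ltr_powR; rewrite ?nnegrE ?ltW//; lra.
have cv : (fun k => 2 * pi * B * ((1 / 2) `^ p) ^+ k) @ \oo --> 2 * pi * B * 0.
  by apply: cvgM; [exact: cvg_cst|exact: cvg_expr].
have /cvgrPdist_lt/(_ _ e0)[n _ hn] := cv.
have := hn (maxn n N).+1 (leqW (leq_maxl _ _)).
rewrite /= mulr0 sub0r normrN => he.
apply: (le_trans (hA (maxn n N) (leq_maxr _ _))).
by rewrite lee_fin; exact: le_trans (ler_norm _) (ltW he).
Qed.

Lemma beurling_carleson_unstopped N : beurling_carleson (1 - p) (unstopped_set N.+1).
Proof.
split; [by move=> z []|exact: closed_unstopped_set|exact: circle_length_unstopped|].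
exact: arc_sum_unstopped.
Qed.

End Stopped.

(** * Concentration *)

Section Concentration.
Context {R : realType}.
Local Notation lam := (@lebesgue_measure R).
Variable mu : {finite_measure set (borelC R) -> \bar R}.
Hypothesis hsing : singular_wrt_length mu.

Local Notation Z := (circle `\` \bigcup_N unstopped_set mu N.+1).

Let measurable_Z : measurable (Z : set (borelC R)).
Proof.
apply: measurableD; first exact: measurable_circle.
by apply: bigcup_measurable => N _; exact: measurable_unstopped_set.
Qed.

Section Cover.
Variable V : set R.
Hypothesis oV : open V.

Let good (l : nat * nat) : bool :=
  [&& (l.2 < 2 ^ l.1)%N, ~~ heavy mu l.1 l.2 & `[< dyadic_cell l.1 l.2 `<=` V >]].

Let first_good n i : bool :=
  good (n, i) && [forall m : 'I_n, ~~ good (nat_of_ord m, (i %/ 2 ^ (n - m))%N)].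

Let arcs n : set (borelC R) :=
  \big[setU/set0]_(i < 2 ^ n) (if first_good n i then closed_arc n i else set0).

Let cells n : set R := \bigcup_(i in [set i | first_good n i]) dyadic_cell n i.

Let measurable_arc n i :
  measurable ((if first_good n i then closed_arc n i else set0) : set (borelC R)).
Proof. by case: ifP => _; [exact: measurable_closed_arc|exact: measurable0]. Qed.

Let measurable_arcs n : measurable (arcs n).
Proof. by apply: bigsetU_measurable => i _; exact: measurable_arc. Qed.

Let measurable_cells n : measurable (cells n).
Proof. by apply: bigcup_measurable => i _; exact: measurable_itv. Qed.

Let cells_sub n : cells n `<=` V.
Proof. by move=> t [i /= /andP[/and3P[_ _ /asboolP h] _] /h]. Qed.

Let cells_disj : trivIset setT cells.
Proof.
have key m n t : (m < n)%N -> cells m t -> cells n t -> False.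
  move=> mn [j /= /andP[gj _] tj] [i /= /andP[_ /forallP h] ti].
  have [a1 a2] := dyadic_nest (R := R) i (ltnW mn).
  have e : j = (i %/ 2 ^ (n - m))%N.
    apply: dyadic_cell_disj tj _; move: ti; rewrite /dyadic_cell/= !in_itv/= => /andP[t1 t2].
    by rewrite (le_trans a1 t1) (lt_le_trans t2 a2).
  by have := h (Ordinal mn); rewrite /= -e gj.
apply/trivIsetP => m n _ _ mn; rewrite -subset0 => t [tm tn].
by case: (ltngtP m n) mn => // h _; [exact: key h tm tn|exact: key h tn tm].
Qed.

Let mu_arcs n : (mu (arcs n) <= 72%:E * lam (cells n))%E.
Proof.
have h0 : 0 < (1 / 2 : R) ^+ n by rewrite exprn_gt0// divr_gt0.
apply: (@le_trans _ _ (\sum_(i < 2 ^ n) ((first_good n i)%:R * (72 * (1 / 2) ^+ n))%:E)%E).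
  apply: (le_trans (Boole_inequality mu (n := 2 ^ n) (fun i _ => measurable_arc n i))).
  apply: lee_sum => i _; case: ifP => [|_]; last by rewrite mul0r measure0.
  move=> /andP[/and3P[_ /= li _] _]; rewrite (mul1r (72 * _)).
  have fm : mu (closed_arc n i) \is a fin_num.
    exact: (fin_num_measure mu _ (measurable_closed_arc n i)).
  by move: li; rewrite /heavy -ltNge -(fineK fm) lee_fin => /ltW.
have hc := @dyadic_count R n (first_good n) _ (measurable_cells n)
  (fun i _ hi t ht => ex_intro2 _ _ i hi ht).
apply: (@le_trans _ _ (72%:E *
    (\sum_(i < 2 ^ n) (first_good n i)%:R * (2 * pi * (1 / 2) ^+ n))%:E)%E); last first.
  by apply: lee_wpmul2l hc; rewrite lee_fin ler0n.
rewrite sumEFin -EFinM lee_fin big_distrr/=; apply: ler_sum => i _.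
rewrite [leRHS]mulrCA; apply: ler_wpM2l => //; apply: ler_wpM2l; first exact: ler0n.
by rewrite ler_peMl ?ltW//; have := @pi_ge2 R; lra.
Qed.

(** The maximal dyadic intervals that are light and contained in a neighbourhood [V] of
    the lifted points are disjoint, and their arcs have [mu]-mass at most a constant
    times their length. *)
Lemma measure_unstopped_le (N0 : set (borelC R)) : measurable N0 ->
  `[0%R, 2 * pi[%classic `&` cis @^-1` N0 `<=` V ->
  (mu (Z `&` N0) <= 72%:E * lam V)%E.
Proof.
move=> mN0 NV; have pi0 := pi_gt0 R.
have cover : Z `&` N0 `<=` \bigcup_n arcs n.
  move=> x [[cx hx] xN].
  have [t t2 xt] := cis_surj cx.
  have Vt : V t by apply: NV; split; [rewrite /= in_itv|rewrite /= -xt].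
  have [d d0 dV] : exists2 d : R, 0 < d & forall s, `|t - s| < d -> V s.
    have := open_nbhs_nbhs (conj oV Vt); move/nbhs_ballP => [d d0 dV].
    by exists d => // s hs; apply: dV; rewrite /ball/=.
  have [N hN] : exists N, forall n, (N <= n)%N -> 2 * pi * (1 / 2) ^+ n < d.
    have cv : (fun k => 2 * pi * (1 / 2 : R) ^+ k) @ \oo --> 2 * pi * 0.
      apply: cvgM; [exact: cvg_cst|apply: cvg_expr].
      by rewrite ger0_norm; lra.
    have /cvgrPdist_lt/(_ _ d0)[N _ hN] := cv.
    exists N => n /hN; rewrite /= mulr0 sub0r normrN; exact: le_lt_trans (ler_norm _).
  have [[n i] hl xl] : exists2 l, stopped mu N.+1 l & open_arc l.1 l.2 x.
    by apply: contrapT => nl; apply: hx; exists N.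
  have /and4P[/= Nn i2 li _] := hl.
  have [s [s2 xs /andP[s3 s4]]] := open_arc_angle i2 xl.
  rewrite xt in xs; have ts := cis_inj t2 s2 xs; rewrite -{s s2 xs}ts in s3 s4.
  have gl : good (n, i).
    apply/and3P; split=> //; apply/asboolP => s /=.
    rewrite /dyadic_cell/= in_itv/= => /andP[s1 s2]; apply: dV.
    apply: le_lt_trans (hN n (ltnW Nn)).
    move: s4 s2 s3 s1; rewrite dyadic_angleS.
    set u := 2 * pi * _; set v := dyadic_angle n i => s4 s2 s3 s1.
    by rewrite ler_norml; apply/andP; split; lra.
  have ex : exists m, (m <= n)%N && good (m, (i %/ 2 ^ (n - m))%N).
    by exists n; rewrite leqnn subnn divn1.
  case: (ex_minnP ex) => m /andP[mn gm] hmin.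
  exists m => //.
  rewrite /arcs -(bigcup_mkord _ (fun j => if first_good m j then closed_arc m j else set0)).
  exists (i %/ 2 ^ (n - m))%N; first exact: dyadic_ancestor_lt.
  have [a1 a2] := dyadic_nest (R := R) i mn.
  rewrite ifT.
    exists t => //=; rewrite in_itv/= (le_trans a1 (ltW s3))/=.
    exact: le_trans (ltW s4) a2.
  rewrite /first_good gm/=; apply/forallP => k; apply/negP.
  have km := ltn_ord k.
  rewrite -divnMA -expnD.
  have -> : (n - m + (m - k) = n - k)%N by rewrite addnBA 1?ltnW// subnK.
  by move=> gk; have := hmin k; rewrite gk (leq_trans (ltnW km) mn) leqNgt km => /(_ isT).
have mZN : measurable (Z `&` N0 : set (borelC R)) by exact: measurableI.
apply: (le_trans (measure_sigma_subadditive mu measurable_arcs mZN cover)).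
apply: (@le_trans _ _ (\sum_(0 <= n <oo) 72%:E * lam (cells n))%E).
  by apply: lee_nneseries => n _ //; exact: mu_arcs.
rewrite nneseriesZl//.
apply: lee_wpmul2l; first by rewrite lee_fin ler0n.
have := measure_semi_bigcup lam measurable_cells cells_disj
  (bigcup_measurable (fun n _ => measurable_cells n)).
move=> <-; apply: le_measure; rewrite ?inE.
- by apply: bigcup_measurable => n _; exact: measurable_cells.
- exact: open_measurable.
by move=> t [n _ /cells_sub].
Qed.

End Cover.

(** A point outside all the sets lies in light arcs of arbitrarily late generation,
    hence in one whose angles stay inside a given neighbourhood of the null set that
    carries [mu]. *)
Lemma concentrated_unstopped : concentrated_on mu (\bigcup_N unstopped_set mu N.+1).
Proof.
split; first by apply: bigcup_measurable => N _; exact: measurable_unstopped_set.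
have [N0 [mN0 lN0 muN0]] := hsing.
pose T : set R := `[0%R, 2 * pi[%classic `&` cis @^-1` N0.
have mT : measurable T.
  apply: measurableI; first exact: measurable_itv.
  by rewrite -[X in measurable X]setTI; apply: measurable_cis.
have ZN0 : mu (Z `&` N0) = 0%E.
  apply/eqP; rewrite eq_le measure_ge0 andbT; apply/lee_addgt0Pr => e e0; rewrite add0e.
  have e1 : 0 < e / 72 by apply: divr_gt0 => //; rewrite ltr0n.
  have Tfin : (lam T < +oo)%E.
    by apply: le_lt_trans (ltry 0); rewrite le_eqVlt; apply/orP; left; apply/eqP.
  have [V [oV TV hV]] := lebesgue_regularity_outer mT Tfin e1.
  apply: (le_trans (measure_unstopped_le oV mN0 TV)).
  have lV : (lam V <= (e / 72)%:E)%E.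
    have VE : V = T `|` (V `\` T) by rewrite setDUK.
    rewrite {1}VE.
    have mD := measurableD (open_measurable oV) mT.
    apply: (le_trans (@measureU2 _ _ _ lam _ _ mT mD)).
    by rewrite [X in (X + _)%E]lN0 add0e; exact: ltW.
  apply: (@le_trans _ _ (72%:E * (e / 72)%:E)%E).
    by apply: lee_wpmul2l => //; rewrite lee_fin ler0n.
  by rewrite -EFinM mulrC divfK// pnatr_eq0.
have mZ1 : measurable (Z `&` N0 : set (borelC R)) by exact: measurableI.
have mZ2 : measurable (circle `\` N0 : set (borelC R)).
  by apply: measurableD => //; exact: measurable_circle.
apply/eqP; rewrite eq_le measure_ge0 andbT.
apply: (@le_trans _ _ (mu ((Z `&` N0) `|` (circle `\` N0)))).
  apply: le_measure; rewrite ?inE//; first exact: measurableU.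
  move=> z hz; have [zN|zN] := pselect (N0 z); [by left|right].
  by split=> //; case: hz.
apply: (le_trans (measureU2 mu mZ1 mZ2)).
by rewrite [X in (X + _)%E]ZN0 add0e [leLHS]muN0.
Qed.

End Concentration.

Theorem theorem1p2 (R : realType) (p : R)
    (mu : {finite_measure set (borelC R) -> \bar R})
    (hp : 0 < p < 1 / 2)
    (hcircle : carried_by_circle mu)
    (hsing : singular_wrt_length mu) :
  (hardy p (derive1 (singular_inner mu)) ->
     area_condition (1 + p) (singular_inner mu)) /\
  (area_condition (1 + p) (singular_inner mu) ->
     exists E : nat -> set (C R),
       (forall n, beurling_carleson (1 - p) (E n)) /\
       concentrated_on mu (\bigcup_n E n)).
Proof.
split; first exact: area_condition_of_hardy.
case/andP: hp => p0 p1.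
have p01 : 0 < p < 1 by rewrite p0/= (lt_trans p1)// ltr_pdivrMr// mul1r ltr1n.
move=> /(heavy_count p01)[B hB].
exists (fun N => unstopped_set mu N.+1); split; last exact: concentrated_unstopped.
by move=> N; exact: beurling_carleson_unstopped p01 hB N.
Qed.
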